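(* Let $M$ be a simply connected $m$-manifold, let $(f_0,\hat f_0)$ and $(f_0,\hat f_1)$ be distinct Ribaucour pairs of Legendre maps $M\to\mathcal{Z}$ whose sphere congruences $s_i=f_0\cap\hat f_i$ ($i=0,1$) are pointwise distinct, and let $V=\hat f_0\oplus\hat f_1$, a rank $4$ bundle with metric of signature $(2,2)$ and induced metric connection $\nabla$. If $V$ is flat (that is, $\nabla$ is flat), then there are two families $f_\alpha,\hat f_\beta:M\to\mathcal{Z}$, $\alpha,\beta\in\mathbb{R}P^1$, of Legendre maps such that: (i) $f_0,f_1\in\{f_\alpha\}$, where $f_1:M\to\mathcal{Z}$ is a Legendre map, pointwise distinct from $f_0$, which is a simultaneous Ribaucour transform of $\hat f_0$ and $\hat f_1$; (ii) $\hat f_0,\hat f_1\in\{\hat f_\beta\}$; (iii) $(f_\alpha,\hat f_\beta)$ is a Ribaucour pair for all $\alpha,\beta\in\mathbb{R}P^1$.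
   Context: $\mathbb{R}^{m+2,2}$ is an $(m+4)$-dimensional real vector space with metric $(\,,\,)$ of signature $(m+2,2)$; $\mathcal{Q}$ is its projective light-cone (the set of null lines) and $\mathcal{Z}$ the Grassmannian of null (totally isotropic) $2$-planes. A map of an $m$-manifold $M$ into a Grassmannian is identified with the corresponding subbundle of $M\times\mathbb{R}^{m+2,2}$; $\Gamma f$ denotes its sections. A sphere congruence is a map $s:M\to\mathcal{Q}$. A map $f:M\to\mathcal{Z}$ is Legendre if $(\mathrm{d}\sigma_0,\sigma_1)\equiv0$ for all $\sigma_0,\sigma_1\in\Gamma f$; it envelops $s$ if $s(p)\subset f(p)$ for all $p\in M$. If two pointwise distinct Legendre maps $f,\hat f$ envelop a common sphere congruence $s=f\cap\hat f$, let $\mathcal{N}_{f,\hat f}=(f+\hat f)/s\subset s^\perp/s$, on which the metric has signature $(1,1)$, let $\pi:s^\perp/s\to\mathcal{N}_{f,\hat f}$ be orthogonal projection, and let $\nabla^{f,\hat f}(\nu+s)=\pi(\mathrm{d}\nu+s)$ for $\nu\in\Gamma(f+\hat f)$; this is a metric connection on $\mathcal{N}_{f,\hat f}$. $(f,\hat f)$ is a Ribaucour pair (and $f,\hat f$ are Ribaucour transforms of each other) if $\nabla^{f,\hat f}$ is flat. When $s_0,s_1$ are pointwise distinct, $\hat f_0\cap\hat f_1=\{0\}$ pointwise, and $V=\hat f_0\oplus\hat f_1\subset M\times\mathbb{R}^{m+2,2}$ inherits a metric of signature $(2,2)$ and a metric connection $\nabla$ obtained by orthogonally projecting $\mathrm{d}$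 to $V$. *)

(* Defs.v *)
From HB Require Import structures.
From mathcomp Require Import all_boot all_order all_algebra.
From mathcomp Require Import all_classical all_reals all_analysis.

Set Implicit Arguments.
Unset Strict Implicit.
Unset Printing Implicit Defensive.

Import Order.TTheory GRing.Theory Num.Theory.
Import numFieldNormedType.Exports.

Local Open Scope classical_set_scope.
Local Open Scope ring_scope.

(** * Smooth maps between Euclidean spaces *)

(* [F] is of class C^k on the open set [A]. *)
Fixpoint Ck (R : realType) (m n k : nat) (A : set 'rV[R]_m)
    (F : 'rV[R]_m -> 'rV[R]_n) : Prop :=
  if k is k'.+1 then
    (forall x, A x -> differentiable F x) /\
    (forall v, Ck k' A (fun x => 'D_v F x))
  else forall x, A x -> {for x, continuous F}.

Definition Csmooth (R : realType) (m n : nat) (A : set 'rV[R]_m)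
    (F : 'rV[R]_m -> 'rV[R]_n) : Prop :=
  forall k, Ck k A F.

(** * Smooth manifolds *)

(* [chart_map] and [chart_inv] only matter on [chart_dom] and on its image. *)
Record chart (R : realType) (m : nat) (M : topologicalType) := Chart {
  chart_dom : set M;
  chart_map : M -> 'rV[R]_m;
  chart_inv : 'rV[R]_m -> M;
  chart_dom_open : open chart_dom;
  chart_im_open : open (chart_map @` chart_dom);
  chart_map_cont : {within chart_dom, continuous chart_map};
  chart_inv_cont : {within chart_map @` chart_dom, continuous chart_inv};
  chart_mapK : forall p, chart_dom p -> chart_inv (chart_map p) = p
}.

Record manifold (R : realType) (m : nat) := Manifold {
  man_top :> topologicalType;
  man_hausdorff : hausdorff_space man_top;
  man_second_countable : @second_countable man_top;
  atlas : set (chart R m man_top);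
  atlas_cover : forall p, exists2 c, atlas c & chart_dom c p;
  atlas_compat : forall c c', atlas c -> atlas c' ->
    Csmooth (chart_map c @` (chart_dom c `&` chart_dom c'))
      (chart_map c' \o chart_inv c)
}.

Definition simply_connected (R : realType) (m : nat) (M : manifold R m) : Prop :=
  let I := `[0, 1]%classic : set R in
  [/\ [set: M] !=set0,
      forall p q : M, exists g : R -> M,
        [/\ {within I, continuous g}, g 0 = p & g 1 = q]
    & forall g : R -> M, {within I, continuous g} -> g 0 = g 1 ->
        exists H : R * R -> M,
          [/\ {within I `*` I, continuous H},
              forall t, I t -> H (0, t) = g t,
              forall t, I t -> H (1, t) = g 0
            & forall s, I s -> H (s, 0) = g 0 /\ H (s, 1) = g 0]].

Section Maps.
Variables (R : realType) (m n : nat) (M : manifold R m).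
Implicit Types (U : set M) (sigma : M -> 'rV[R]_n).
Implicit Types (c : chart R m M) (v : 'rV[R]_m).

(* [U] is meant to be open. *)
Definition smooth_on U sigma : Prop :=
  forall c, atlas c ->
    Csmooth (chart_map c @` (U `&` chart_dom c)) (sigma \o chart_inv c).

(* d_p sigma applied to the tangent vector sum_i v_i (d/dx_i)(p), where the x_i
   are the coordinates of [c]; meaningful for p in [chart_dom c]. *)
Definition chart_deriv c v sigma : M -> 'rV[R]_n :=
  fun p => 'D_v (sigma \o chart_inv c) (chart_map c p).

Implicit Types W : M -> {vspace 'rV[R]_n}.

(* A smooth map into the Grassmannian of k-planes, i.e. a smooth subbundle of
   rank k: it is locally spanned by a smooth frame. *)
Definition subbundle (k : nat) W : Prop :=
  (forall p, \dim (W p) = k) /\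
  forall p, exists U, [/\ open U, U p
    & exists e : 'I_k -> M -> 'rV[R]_n,
        (forall i, smooth_on U (e i)) /\
        forall q, U q -> basis_of (W q) [tuple e i q | i < k]].

(* Gamma(W|_U) *)
Definition section U W sigma : Prop :=
  smooth_on U sigma /\ forall p, U p -> sigma p \in W p.

End Maps.

(** * Lie sphere geometry *)

(* The metric of R^{m+2,2}. *)
Definition ip (R : realType) (m : nat) (x y : 'rV[R]_(m + 4)) : R :=
  \sum_(i < m + 4) (if (i < m + 2)%N then 1 else -1) * x 0 i * y 0 i.

Definition totally_null (R : realType) (m : nat)
    (W : {vspace 'rV[R]_(m + 4)}) : Prop :=
  forall x y, x \in W -> y \in W -> ip x y = 0.

Section Geometry.
Variables (R : realType) (m : nat) (M : manifold R m).
Local Notation E := 'rV[R]_(m + 4).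
Local Notation planes := (M -> {vspace E}).
Implicit Types (f fh s W S : planes) (nu mu : M -> E).

Definition pointwise_distinct f fh : Prop := forall p, f p <> fh p.

Definition sphere_congruence s : Prop :=
  subbundle 1 s /\ forall p, totally_null (s p).

Definition legendre f : Prop :=
  [/\ subbundle 2 f, forall p, totally_null (f p)
    & forall (U : set M) (sigma0 sigma1 : M -> E),
        open U -> section U f sigma0 -> section U f sigma1 ->
        forall c, atlas c -> forall v p, U p -> chart_dom c p ->
          ip (chart_deriv c v sigma0 p) (sigma1 p) = 0].

Definition envelops f s : Prop := forall p, (s p <= f p)%VS.

Definition cap_bundle f fh : planes := fun p => (f p :&: fh p)%VS.
Definition sum_bundle f fh : planes := fun p => (f p + fh p)%VS.

(* Let [S] be the radical of the metric on [W].  Then W/S is a nondegenerate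
   subspace of S^perp/S, and [proj_rep W x y] says that y + S is the orthogonal
   projection of x + S to W/S; it forces x to lie in S^perp, and determines y
   up to S only.  With S = 0 this is orthogonal projection to [W] itself. *)
Definition proj_rep (W : {vspace E}) (x y : E) : Prop :=
  y \in W /\ forall w, w \in W -> ip (x - y) w = 0.

(* On [U], nabla_v (nu + S) = mu + S for the connection nabla on W/S given by
   nabla (nu + S) = pi (d nu + S), with pi the projection to W/S and [v]
   standing for the constant vector field sum_i v_i d/dx_i of the chart [c]. *)
Definition covariant_deriv W (c : chart R m M) (v : 'rV[R]_m) (U : set M)
    nu mu : Prop :=
  forall p, U p -> proj_rep (W p) (chart_deriv c v nu p) (mu p).

(* The curvature of the connection nabla on W/S vanishes.  The constant vector
   fields [v], [w] of a chart commute, so that R(v, w) is the commutator of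
   nabla_v and nabla_w, and R is determined by these values. *)
Definition flat_connection W S : Prop :=
  forall c, atlas c -> forall U, open U -> U `<=` chart_dom c ->
  forall (v w : 'rV[R]_m) nu mu_v mu_w mu_vw mu_wv,
    section U W nu -> section U W mu_v -> section U W mu_w ->
    covariant_deriv W c v U nu mu_v -> covariant_deriv W c w U nu mu_w ->
    covariant_deriv W c v U mu_w mu_vw -> covariant_deriv W c w U mu_v mu_wv ->
    forall p, U p -> mu_vw p - mu_wv p \in S p.

(* The bundle is (f + fh)/s with s = f :&: fh. *)
Definition ribaucour_pair f fh : Prop :=
  let s := cap_bundle f fh in
  [/\ legendre f, legendre fh, pointwise_distinct f fh,
      [/\ sphere_congruence s, envelops f s & envelops fh s]
    & flat_connection (sum_bundle f fh) s].

(* Flatness of a subbundle with nondegenerate induced metric. *)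
Definition flat_bundle W : Prop := flat_connection W (fun=> 0%VS).

End Geometry.

Definition RP1 (R : realType) : Type :=
  {L : {vspace 'rV[R]_2} | \dim L == 1%N}.

(* Main.v *)
Require Import Defs.
From HB Require Import structures.
From mathcomp Require Import all_boot all_order all_algebra.
From mathcomp Require Import all_classical all_reals all_analysis.
From mathcomp Require Import ring lra zify.

Set Implicit Arguments.
Unset Strict Implicit.
Unset Printing Implicit Defensive.

Import Order.TTheory GRing.Theory Num.Theory.
Import numFieldNormedType.Exports.

Local Open Scope classical_set_scope.
Local Open Scope ring_scope.

(** Put V = fh0 + fh1.  Legendre maps are maximal isotropic, so f0, fh0, fh1 and the
    spheres s0 = f0 :&: fh0, s1 = f0 :&: fh1 are parallel subbundles of V.  Flatness of the
    two Ribaucour pairs makes the connections of the lines s1 and s0 flat, and by the Poincare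
    lemma these have local parallel sections; the only remaining component of the connection
    of V is then a 1-form, closed because V is flat, so V has local parallel Witt bases
    adapted to f0, fh0, fh1.  On a simply connected manifold these extend, by monodromy, to a
    global one, which identifies V with the constant R^{2,2} = R^2 (x) R^2.  The null planes
    of R^{2,2} form two families u (x) R^2 and R^2 (x) w, the rulings of a quadric in RP^3;
    the constant bundles they define are the two families of Legendre maps.  The pairs are
    Ribaucour because, against a parallel section, covariant differentiation is ordinary
    differentiation, and second partial derivatives commute. *)

(** * Smooth functions on open sets of R^m *)

(** Flatness is given only through sections, so every use of it must be fed explicit covariant
    derivatives. In a quotient such as (f0 + fh0)/s0, of rank 2 and signature (1,1), a metric
    connection preserves the two null lines; its whole content is one 1-form b, with curvature db.
    The null line f0/s0 is spanned by s1: each sphere is therefore normalised by the pair to which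
    it does not belong. Let s and t be the resulting parallel sections of s0 and s1, completed by x
    in fh0 and z in fh1 that are dual to t and s. The Legendre conditions and the constancy of the
    pairings leave only dx = b s and dz = - b t modulo the orthogonal complement of V, and flatness
    of V gives db = 0; if dg = b, then x - g s and z + g t are parallel. On a chart ball such a
    frame is determined by its value at one point, and near a common point two of them differ by a
    constant matrix. Monodromy uses nothing else, so it is carried out for an abstract class of
    local maps whose values carry no topology. *)

Lemma differentiable_eps (R : realType) (V W : normedModType R) (f : V -> W)
    (x : V) (L : {linear V -> W}) :
  continuous L ->
  (forall e : R, 0 < e -> \forall h \near (0 : V), `|f (h + x) - f x - L h| <= e * `|h|) ->
  differentiable f x.
Proof.
move=> cL Lf.
have H : f \o shift x = cst (f x) + L +o_ 0 id.
  apply/eqaddoP => e e0; have := Lf e e0.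
  apply: filterS => h /=.
  by rewrite !fctE /= opprD addrA.
by apply/diff_locallyP; rewrite (diff_unique cL H).
Qed.

Lemma differentiable_near (R : realType) (V W : normedModType R) (f g : V -> W) (x : V) :
  (\forall y \near x, f y = g y) -> differentiable f x -> differentiable g x.
Proof.
move=> fg df; have fgx := nbhs_singleton fg.
apply: (@differentiable_eps _ _ _ g x ('d f x)).
  exact: diff_continuous.
move=> e e0; have /eqaddoP/(_ e e0) := diff_locally df.
move=> H; near=> h; rewrite -fgx -(_ : f (h + x) = g (h + x)).
  suff : `|(f \o shift x - (cst (f x) + 'd f x)) h| <= e * `|id h|.
    by rewrite !fctE /= opprD addrA.
  by near: h.
near: h.
by move: fg; rewrite (near_shift 0) subr0.
Unshelve. all: by end_near. Qed.

Section ScalarCk.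
Variables (R : realType) (m : nat).
Implicit Types (A B : set 'rV[R]_m) (f g : 'rV[R]_m -> R) (k : nat).

(** [Ck] for scalar functions. Products, inverses and exponentials are treated here, and [CkP]
    carries regularity over to vectors coordinate by coordinate. *)
Fixpoint sCk k A f : Prop :=
  if k is k'.+1 then
    (forall x, A x -> differentiable f x) /\ (forall v, sCk k' A (fun x => 'D_v f x))
  else forall x, A x -> {for x, continuous f}.

Lemma open_near A x (P : 'rV[R]_m -> Prop) :
  open A -> A x -> (forall y, A y -> P y) -> \forall y \near x, P y.
Proof.
move=> oA Ax AP; have : nbhs x A by exact: open_nbhs_nbhs.
exact: filterS.
Qed.

Lemma sCk_ext k A f g : open A -> (forall x, A x -> f x = g x) ->
  sCk k A f -> sCk k A g.
Proof.
move=> oA; elim: k f g => [|k IH] f g fg /=.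
  move=> cf x Ax.
  have fgx : {near x, f =1 g} by exact: (@open_near A).
  rewrite /prop_for /continuous_at -fg//.
  exact: cvg_trans (near_eq_cvg fgx) (cf x Ax).
move=> [df Df]; split=> [x Ax|v].
  by apply: differentiable_near (df x Ax); exact: (@open_near A).
apply: IH (Df v) => x Ax.
by apply: near_eq_derive; exact: (@open_near A).
Qed.

Lemma sCk_sub k A B f : B `<=` A -> sCk k A f -> sCk k B f.
Proof.
move=> BA; elim: k f => [|k IH] f /=; first by move=> cf x /BA; exact: cf.
by move=> [df Df]; split=> [x /BA|v]; [exact: df|exact: IH].
Qed.

Lemma sCkW k A f : sCk k.+1 A f -> sCk k A f.
Proof.
elim: k f => [|k IH] f; first by move=> [df _] x Ax; exact/differentiable_continuous/df.
by move=> [df Df]; split=> // v; exact: IH.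
Qed.

Lemma sCk_cst k A c : sCk k A (fun=> c).
Proof.
elim: k c => [|k IH] c /=; first by move=> x _; exact: cst_continuous.
split=> [x _|v]; first exact: differentiable_cst.
rewrite (_ : (fun x => 'D_v _ x) = (fun=> 0)); first exact: IH.
by apply/funext => x; exact: derive_cst.
Qed.

Lemma sCkD k A f g : open A -> sCk k A f -> sCk k A g -> sCk k A (fun x => f x + g x).
Proof.
move=> oA; elim: k f g => [|k IH] f g /=.
  by move=> cf cg x Ax; apply: continuousD; [exact: cf|exact: cg].
move=> [df Df] [dg Dg]; split=> [x Ax|v].
  by apply: differentiableD; [exact: df|exact: dg].
apply: sCk_ext (IH _ _ (Df v) (Dg v)) => // x Ax.
by rewrite -deriveD//; apply: diff_derivable; [exact: df|exact: dg].
Qed.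

Lemma sCkM k A f g : open A -> sCk k A f -> sCk k A g -> sCk k A (fun x => f x * g x).
Proof.
move=> oA; elim: k f g => [|k IH] f g.
  by move=> cf cg x Ax; exact: (@continuousM R _ f g x (cf x Ax) (cg x Ax)).
move=> fk gk; have [df Df] := fk; have [dg Dg] := gk; split=> [x Ax|v].
  by apply: differentiableM; [exact: df|exact: dg].
apply: (@sCk_ext k A (fun x => f x * 'D_v g x + g x * 'D_v f x)) => // [x Ax|].
  by rewrite (@deriveM _ _ f g)//; apply: diff_derivable; [exact: df|exact: dg].
by apply: sCkD => //; apply: IH; [exact: sCkW|exact: Dg|exact: sCkW|exact: Df].
Qed.

Lemma sCkN k A f : open A -> sCk k A f -> sCk k A (fun x => - f x).
Proof.
move=> oA fk; apply: (@sCk_ext k A (fun x => -1 * f x)) => // [x _|].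
  by rewrite mulN1r.
by apply: sCkM => //; exact: sCk_cst.
Qed.

Lemma sCk_sum k A n (f : 'I_n -> 'rV[R]_m -> R) : open A ->
  (forall i, sCk k A (f i)) -> sCk k A (fun x => \sum_i f i x).
Proof.
move=> oA; elim: n f => [|n IH] f fk.
  by apply: sCk_ext (@sCk_cst k A 0) => // x _; rewrite big_ord0.
apply: (@sCk_ext k A (fun x => \sum_(i < n) f (widen_ord (leqnSn n) i) x + f ord_max x)) => // [x _|].
  by rewrite big_ord_recr.
by apply: sCkD => //; exact: IH.
Qed.

Lemma sCkV k A f : open A -> (forall x, A x -> f x != 0) ->
  sCk k A f -> sCk k A (fun x => (f x)^-1).
Proof.
move=> oA f0; elim: k => [|k IH].
  by move=> cf x Ax; apply: continuousV; [exact: f0|exact: cf].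
move=> fk; have [df Df] := fk; split=> [x Ax|v].
  by apply: differentiableV; [exact: df|exact: f0].
apply: (@sCk_ext k A (fun x => - ((f x)^-1 * (f x)^-1 * 'D_v f x))) => // [x Ax|].
  rewrite (@deriveV _ _ f)// ?f0//; last exact/diff_derivable/df.
  by rewrite scaleNr -exprVn expr2.
by apply: sCkN => //; apply: sCkM; [|apply: sCkM => //; apply: IH; exact: sCkW|exact: Df].
Qed.

Lemma derive_expR_comp f x v : differentiable f x ->
  'D_v (fun y => expR (f y)) x = 'D_v f x * expR (f x).
Proof.
move=> df.
have dE : differentiable (expR : R -> R) (f x) by exact/derivable1_diffP/derivable_expR.
rewrite deriveE; last exact: (differentiable_comp df dE).
rewrite (_ : (fun y => _) = expR \o f)// diff_comp//= -(deriveE _ df).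
set d := 'D_v f x; have -> : d = d *: (1:R) by rewrite [RHS]mulr1.
rewrite linearZ /= -(deriveE _ dE).
have /= -> := congr1 (@^~ (f x)) (@derive_expR R).
by rewrite /GRing.scale /= mulr1.
Qed.

Lemma sCk_expR k A f : open A -> sCk k A f -> sCk k A (fun x => expR (f x)).
Proof.
move=> oA; elim: k => [|k IH].
  by move=> cf x Ax; apply: continuous_comp; [exact: cf|exact: continuous_expR].
move=> fk; have [df Df] := fk; split=> [x Ax|v].
  apply: (@differentiable_comp _ _ _ _ f expR); first exact: df.
  exact/derivable1_diffP/derivable_expR.
apply: (@sCk_ext k A (fun x => 'D_v f x * expR (f x))) => // [x Ax|].
  by rewrite derive_expR_comp//; exact: df.
by apply: sCkM; [|exact: Df|apply: IH; exact: sCkW].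
Qed.

End ScalarCk.

(** * Vector-valued maps and the chain rule *)

Section VectorCk.
Variables (R : realType) (m : nat).
Implicit Types (A : set 'rV[R]_m) (k : nat).

Lemma rV_sum_delta n (F : 'rV[R]_m -> 'rV[R]_n) :
  F = \sum_(i < n) (fun x => F x 0 i *: delta_mx 0 i).
Proof.
apply/funext => x; rewrite fct_sumE; apply/rowP => j.
rewrite summxE (bigD1 j)//= big1 ?addr0 => [|i ij]; rewrite !mxE eqxx/=.
  by rewrite eqxx mulr1.
by rewrite eq_sym (negPf ij) mulr0.
Qed.

Lemma differentiable_rowP n (F : 'rV[R]_m -> 'rV[R]_n) x :
  differentiable F x <-> forall i, differentiable (fun y => F y 0 i) x.
Proof.
split=> [dF i|dF].
  exact: (@differentiable_comp _ _ _ _ F (fun N : 'rV[R]_n => N 0 i) x dF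
    (differentiable_coord _ _ _)).
rewrite (rV_sum_delta F); apply: differentiable_sum => i.
by apply: differentiableZl.
Qed.

Lemma continuous_rowP (T : topologicalType) n (F : T -> 'rV[R]_n) (x : T) :
  {for x, continuous F} <-> forall i, {for x, continuous (fun y => F y 0 i)}.
Proof.
split=> [cF i|cF].
  apply: (@continuous_comp _ _ _ F (fun N : 'rV[R]_n => N 0 i)) => //.
  exact: coord_continuous.
rewrite /prop_for /continuous_at.
apply/cvgrPdist_le => /= e e0.
have : \forall t \near x, forall i, `|F x 0 i - F t 0 i| <= e.
  by apply: filter_forall => i; have /cvgrPdist_le/(_ e e0) := cF i.
apply: filterS => t Ft.
rewrite /Num.Def.normr/= mx_normrE (bigmax_le _ (ltW e0))//= => -[j i] _.
by rewrite ord1 !mxE/=.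
Qed.

Lemma derive_coord n (F : 'rV[R]_m -> 'rV[R]_n) x v i :
  derivable F x v -> ('D_v F x) 0 i = 'D_v (fun y => F y 0 i) x.
Proof. by move=> dF; rewrite derive_mx// mxE. Qed.

Lemma CkP n k A (F : 'rV[R]_m -> 'rV[R]_n) : open A ->
  Ck k A F <-> forall i, sCk k A (fun x => F x 0 i).
Proof.
move=> oA; elim: k F => [|k IH] F /=.
  split=> [cF i x Ax|cF x Ax]; first by apply/continuous_rowP : i; exact: cF.
  by apply/continuous_rowP => i; exact: cF.
split=> [[dF DF] i|dF].
  split=> [x Ax|v]; first by apply/differentiable_rowP : i; exact: dF.
  have /IH/(_ i) := DF v; apply: sCk_ext => // x Ax.
  by rewrite derive_coord//; exact/diff_derivable/dF.
have dFx x : A x -> differentiable F x.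
  by move=> Ax; apply/differentiable_rowP => i; exact: (dF i).1.
split=> // v; apply/IH => i; apply: sCk_ext ((dF i).2 v) => // x Ax.
by rewrite derive_coord//; exact/diff_derivable/dFx.
Qed.

Lemma derive_linear_sum n (V : normedModType R) (f : 'rV[R]_n -> V) x w :
  differentiable f x -> 'D_w f x = \sum_i w 0 i *: 'D_(delta_mx 0 i) f x.
Proof.
move=> df; rewrite deriveE// [in LHS](row_sum_delta w) linear_sum /=.
by apply: eq_bigr => i _; rewrite linearZ /= deriveE.
Qed.

Lemma derive_comp n (V : normedModType R) (f : 'rV[R]_n -> V)
    (phi : 'rV[R]_m -> 'rV[R]_n) x v :
  differentiable phi x -> differentiable f (phi x) ->
  'D_v (f \o phi) x = 'D_('D_v phi x) f (phi x).
Proof.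
move=> dp df; rewrite deriveE; last exact: differentiable_comp.
by rewrite diff_comp//= -(deriveE _ dp) -(deriveE _ df).
Qed.

(** [sCk] iterates derivatives in constant directions, whereas the chain rule differentiates f along
    ['D_v phi x], which moves with x. Expanding over the canonical basis gives constant directions
    with C^k coefficients, and the induction goes through. *)
Lemma sCk_comp n k A (B : set 'rV[R]_n) (f : 'rV[R]_n -> R) (phi : 'rV[R]_m -> 'rV[R]_n) :
  open A -> (forall x, A x -> B (phi x)) ->
  Ck k A phi -> sCk k B f -> sCk k A (f \o phi).
Proof.
move=> oA AB; elim: k f phi AB => [|k IH] f phi AB.
  move=> cp cf x Ax; apply: continuous_comp; first exact: cp.
  by apply: cf; exact: AB.
move=> pk fk; have [dp Dp] := pk; have [df Df] := fk; split=> [x Ax|v].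
  exact: (@differentiable_comp _ _ _ _ phi f x (dp x Ax) (df _ (AB _ Ax))).
apply: (@sCk_ext _ _ _ _ (fun x => \sum_i ('D_v phi x) 0 i * 'D_(delta_mx 0 i) f (phi x))) => //.
  move=> x Ax; rewrite (derive_comp _ (dp x Ax) (df _ (AB _ Ax))).
  by rewrite [RHS]derive_linear_sum//; exact/df/AB.
apply: sCk_sum => // i; apply: sCkM => //.
  by move/(CkP _ _ oA) : (Dp v).
apply: (IH (fun y => 'D_(delta_mx 0 i) f y)) => //; last exact: Df.
by apply/(CkP _ _ oA) => j; apply: sCkW; move/(CkP _ _ oA) : pk.
Qed.

End VectorCk.

(** * Symmetry of second derivatives and the Poincare lemma *)

Section Line.
Variables (R : realType) (V : normedModType R).
Implicit Types (f : V -> R) (x v : V).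

Lemma is_derive_line f x v t df : is_derive (x + t *: v) v f df ->
  is_derive t 1 (fun s => f (x + s *: v)) df.
Proof.
have E : (fun h : R => h^-1 *: (((fun s => f (x + s *: v)) \o shift t) (h *: 1) - f (x + t *: v)))
       = (fun h : R => h^-1 *: ((f \o shift (x + t *: v)) (h *: v) - f (x + t *: v))).
  apply/funext => h /=; congr (_ *: (f _ - _)).
  by rewrite [h *: 1]mulr1 scalerDl addrCA.
case=> dfx <-; apply: DeriveDef; first by rewrite /derivable E.
by rewrite /derive E.
Qed.

Lemma is_derive_translate f a b v df : is_derive (a + b) v f df ->
  is_derive a v (fun y => f (y + b)) df.
Proof.
have E : (fun h : R => h^-1 *: (((fun y => f (y + b)) \o shift a) (h *: v) - f (a + b)))
       = (fun h : R => h^-1 *: ((f \o shift (a + b)) (h *: v) - f (a + b))).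
  by apply/funext => h /=; rewrite addrA.
case=> dfx <-; apply: DeriveDef; first by rewrite /derivable E.
by rewrite /derive E.
Qed.

Lemma mvt_line f (df : V -> R) x v (h : R) : 0 < h ->
  (forall t, 0 <= t <= h -> is_derive (x + t *: v) v f (df (x + t *: v))) ->
  exists2 c, 0 < c < h & f (x + h *: v) - f x = df (x + c *: v) * h.
Proof.
move=> h0 Df.
have D t : 0 <= t <= h -> is_derive t 1 (fun s => f (x + s *: v)) (df (x + t *: v)).
  by move=> th; apply: is_derive_line; exact: Df.
have [||c ch] := @MVT R (fun s => f (x + s *: v)) (fun s => df (x + s *: v)) _ _ h0.
- by move=> t; rewrite in_itv /= => /andP[t0 t1]; apply: D; rewrite !ltW.
- apply: derivable_within_continuous => t; rewrite in_itv /= => th.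
  by have [] := D _ th.
rewrite scale0r addr0 subr0 => E; exists c => //.
Qed.
End Line.

Section Schwarz.
Variables (R : realType) (m : nat) (A : set 'rV[R]_m).

Lemma ball_line (x v w : 'rV[R]_m) (d : R) : 0 < d ->
  exists2 h : R, 0 < h & forall s t, `|s| <= h -> `|t| <= h -> ball x d (x + s *: v + t *: w).
Proof.
move=> d0; exists (d / (`|v| + `|w| + 1)).
  by rewrite divr_gt0// ltr_wpDl// addr_ge0.
move=> s t sh th; rewrite -ball_normE /ball_ /= !opprD !addrA subrr sub0r.
rewrite -opprD normrN (le_lt_trans (ler_normD _ _))// !normrZ.
have p0 : 0 < `|v| + `|w| + 1 by rewrite ltr_wpDl// addr_ge0.
apply: (@le_lt_trans _ _ ((d / (`|v| + `|w| + 1)) * (`|v| + `|w|))).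
  by rewrite mulrDr lerD// ler_wpM2r.
by rewrite mulrAC ltr_pdivrMr// ltr_pM2l// ltrDl.
Qed.

(** The second difference of f over a small parallelogram is symmetric in v and w. Two applications
    of the mean value theorem, in either order, turn it into h^2 times one or the other mixed
    derivative at a nearby point; continuity of both at x concludes. *)
Lemma schwarz (f : 'rV[R]_m -> R) v w x : open A -> A x -> sCk 2 A f ->
  'D_w (fun y => 'D_v f y) x = 'D_v (fun y => 'D_w f y) x.
Proof.
move=> oA Ax [df Df].
have key (u1 u2 : 'rV[R]_m) (d : R) : 0 < d -> ball x d `<=` A -> forall h : R, 0 < h ->
    (forall s t, `|s| <= h -> `|t| <= h -> ball x d (x + s *: u1 + t *: u2)) ->
    exists2 y, ball x d y & 
      f (x + h *: u1 + h *: u2) - f (x + h *: u1) - (f (x + h *: u2) - f x) =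
      'D_u2 (fun y => 'D_u1 f y) y * h * h.
  move=> d0 dA h h0 Bh.
  (* The second difference is the increment of [g] along u1; a second mean value theorem then acts
     on ['D_u1 f] along u2. *)
  pose g y := f (y + h *: u2) - f y.
  have hh : `|h| <= h by rewrite gtr0_norm.
  have nt t : 0 <= t <= h -> `|t| <= h by case/andP=> t0 t1; rewrite ger0_norm.
  have [|c /andP[c0 c1]] := @mvt_line _ _ g (fun y => 'D_u1 f (y + h *: u2) - 'D_u1 f y) x u1 h h0.
    move=> t th.
    have B1 : A (x + t *: u1 + h *: u2) by apply/dA/Bh => //; exact: nt.
    have B0 : A (x + t *: u1).
      by apply: dA; have := Bh t 0; rewrite scale0r addr0; apply; [exact: nt|rewrite normr0 ltW].
    apply: is_deriveB; last exact/derivableP/diff_derivable/df.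
    by apply: is_derive_translate; exact/derivableP/diff_derivable/df.
  rewrite /g => ->.
  have nc : `|c| <= h by rewrite ger0_norm ltW.
  have [|e /andP[e0 e1]] := @mvt_line _ _ (fun y => 'D_u1 f y) (fun y => 'D_u2 (fun y => 'D_u1 f y) y) (x + c *: u1) u2 h h0.
    move=> t th.
    have B1 : A (x + c *: u1 + t *: u2) by apply/dA/Bh => //; exact: nt.
    by apply/derivableP/diff_derivable; have [+ _] := Df u1; exact.
  move=> ->; exists (x + c *: u1 + e *: u2) => //.
  by apply: Bh => //; rewrite ger0_norm ltW.
apply/eqP; rewrite -subr_eq0 -normr_le0; apply/ler_addgt0Pr => e e0; rewrite add0r.
have c1 : {for x, continuous (fun y => 'D_w (fun y => 'D_v f y) y)}.
  by have [_ +] := Df v; move/(_ w x Ax).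
have c2 : {for x, continuous (fun y => 'D_v (fun y => 'D_w f y) y)}.
  by have [_ +] := Df w; move/(_ v x Ax).
have e2 : 0 < e / 2 by rewrite divr_gt0.
move/cvgrPdist_le/(_ _ e2)/nbhs_ballP : c1 => [d1 /= d10 B1].
move/cvgrPdist_le/(_ _ e2)/nbhs_ballP : c2 => [d2 /= d20 B2].
have /nbhs_ballP[d3 /= d30 B3] : nbhs x A by exact: open_nbhs_nbhs.
pose d := Num.min d1 (Num.min d2 d3).
have d0 : 0 < d by rewrite !lt_min d10 d20.
have dd1 : d <= d1 by rewrite ge_min lexx.
have dd2 : d <= d2 by rewrite !ge_min lexx orbT.
have dd3 : d <= d3 by rewrite !ge_min lexx !orbT.
have dA : ball x d `<=` A by move=> y /(le_ball dd3)/B3.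
have [h h0 Bh] := @ball_line x v w d d0.
have [y By E1] := key v w d d0 dA h h0 Bh.
have [|z Bz E2] := key w v d d0 dA h h0.
  by move=> s t sh th; rewrite addrAC; exact: Bh.
have hn0 : h * h != 0 by rewrite mulf_neq0// gt_eqF.
move: E1 E2 (B1 _ (le_ball dd1 By)) (B2 _ (le_ball dd2 Bz)) => {B1 B2 df Df key} E1 E2 H1 H2.
rewrite (addrAC x (h *: w) (h *: v)) in E2.
move: E1 E2 H1 H2.
move: ('D_w (fun y => 'D_v f y) x) ('D_v (fun y => 'D_w f y) x) ('D_w (fun y => 'D_v f y) y) ('D_v (fun y => 'D_w f y) z) => p q p' q'.
move: (f (x + h *: v + h *: w)) (f (x + h *: v)) (f (x + h *: w)) (f x) => f1 f2 f3 f4 E1 E2.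
have -> : q' = p' by apply: (mulIf hn0); rewrite !mulrA -E1 -E2; ring.
rewrite !ler_norml => /andP[H1 H2] /andP[H3 H4].
by apply/andP; split; lra.
Qed.

End Schwarz.

Lemma near_forall (T : topologicalType) (I : finType) (x : T) (P : I -> T -> Prop) :
  (forall i, \forall y \near x, P i y) -> \forall y \near x, forall i, P i y.
Proof. by move=> H; apply: filter_forall. Qed.

Section Ball.
Variables (R : realType) (m : nat).
Implicit Types (a x y v w : 'rV[R]_m) (r : R).

Lemma ball_segment a r x y (t : R) : ball a r x -> ball a r y -> 0 <= t <= 1 ->
  ball a r (x + t *: (y - x)).
Proof.
rewrite -!ball_normE /ball_ /= => ax ay /andP[t0 t1].
have -> : a - (x + t *: (y - x)) = (1 - t) *: (a - x) + t *: (a - y).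
  by apply/rowP => i; rewrite !mxE; ring.
rewrite (le_lt_trans (ler_normD _ _))// !normrZ (ger0_norm t0) ger0_norm ?subr_ge0//.
have [->|tn0] := eqVneq t 0; first by rewrite subr0 mul1r mul0r addr0.
have t0' : 0 < t by rewrite lt_neqAle eq_sym tn0.
apply: (@lt_le_trans _ _ ((1 - t) * r + t * r)); last by rewrite -mulrDl subrK mul1r.
by apply: ler_ltD; [rewrite ler_wpM2l ?subr_ge0// ltW|rewrite ltr_pM2l].
Qed.

Lemma derive0_constant a r (f : 'rV[R]_m -> R) :
  (forall x, ball a r x -> differentiable f x /\ forall v, 'D_v f x = 0) ->
  forall x, ball a r x -> f x = f a.
Proof.
move=> Df x ax.
have r0 : 0 < r.
  by move: ax; rewrite -ball_normE /ball_ /=; apply: le_lt_trans.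
have [t /andP[t0 t1]|c _] := @mvt_line _ _ f (fun=> 0) a (x - a) 1 ltr01.
  have [df dv] := Df _ (ball_segment (ballxx _ r0) ax (introT andP (conj t0 t1))).
  by rewrite -(dv (x - a)); exact/derivableP/diff_derivable.
by rewrite scale1r subrKC mul0r => /eqP; rewrite subr_eq0 => /eqP.
Qed.

Definition linform (c : 'I_m -> R) v : R := \sum_i v 0 i * c i.

Lemma linform_linear c : linear (linform c).
Proof.
move=> k u v; rewrite /linform scaler_sumr -big_split /=.
by apply: eq_bigr => i _; rewrite !mxE mulrDl -mulrA.
Qed.
HB.instance Definition _ c := @GRing.isLinear.Build R _ _ _ (linform c) (linform_linear c).

Lemma linform_continuous c : continuous (linform c).
Proof.
move=> x; rewrite /linform.
have H : (fun v => \sum_(i < m) v 0 i * c i) = \sum_(i < m) (fun v => v 0 i * c i).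
  by apply/funext => v; rewrite fct_sumE.
rewrite H; apply: differentiable_continuous; apply: differentiable_sum => i.
apply: (@differentiableM _ _ (fun v : 'rV[R]_m => v 0 i) (cst (c i))).
  exact: differentiable_coord.
exact: differentiable_cst.
Qed.

(** Directional derivatives alone do not give differentiability. The mean value theorem on the
    segment from x to x + h replaces the increment of f by the form at an intermediate point, and
    continuity of the coefficients makes the error o(h). *)
Lemma gradient_differentiable a r (f : 'rV[R]_m -> R) (th : 'I_m -> 'rV[R]_m -> R) :
  (forall x, ball a r x -> forall i, {for x, continuous (th i)}) ->
  (forall x, ball a r x -> forall v, is_derive x v f (linform (th ^~ x) v)) ->
  forall x, ball a r x -> differentiable f x.
Proof.
move=> cth df x ax.
apply: (@differentiable_eps _ _ _ f x (linform (th ^~ x))); first exact: linform_continuous.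
move=> e e0.
(* Each of the m coefficients may err by this much; m + 1 rather than m also covers m = 0. *)
have e0' : 0 < e / m.+1%:R by rewrite divr_gt0.
have H1 : \forall y \near x, forall i, `|th i x - th i y| <= e / m.+1%:R.
  apply: (@near_forall _ _ _ (fun i y => `|th i x - th i y| <= e / m.+1%:R)) => i.
  by have /cvgrPdist_le/(_ _ e0') := cth x ax i.
have H2 : \forall y \near x, ball a r y.
  by apply: open_nbhs_nbhs; split => //; exact: ball_open.
have /nbhs_ballP[d /= d0 B] : nbhs x ([set y | forall i, `|th i x - th i y| <= e / m.+1%:R] `&` ball a r).
  exact: filterI.
apply/nbhs_ballP; exists d => //= h.
rewrite -ball_normE /ball_ /= sub0r normrN => hd.
have Bt t : 0 <= t <= 1 -> ball x d (x + t *: h).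
  move=> /andP[t0 t1]; rewrite -ball_normE /ball_ /= opprD addrA subrr sub0r normrN.
  by rewrite normrZ ger0_norm// (le_lt_trans _ hd)// ler_piMl.
have [t /Bt/B[_ Bt']|c /andP[c0 c1]] := @mvt_line _ _ f (fun y => linform (th ^~ y) h) x h 1 ltr01.
  exact: df.
rewrite scale1r mulr1 (addrC h) => ->.
have /Bt/B[Bc _] : 0 <= c <= 1 by rewrite !ltW.
rewrite /linform -sumrB (le_trans (ler_norm_sum _ _ _))//.
apply: (@le_trans _ _ (\sum_(i < m) (e / m.+1%:R) * `|h|)).
  apply: ler_sum => i _; rewrite -mulrBr normrM mulrC ler_pM//.
    by rewrite distrC; exact: Bc.
  rewrite [leRHS]/Num.Def.normr/= mx_normrE.
  exact: (le_bigmax _ (fun i => `|h i.1 i.2|) (0, i)).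
rewrite sumr_const card_ord -[leLHS]mulr_natl mulrA ler_wpM2r// mulrCA ler_piMr ?ltW//.
by rewrite ltr_pdivrMr// mul1r ltr_nat.
Qed.

End Ball.

(** The algebra behind [phi_derive]: T stands for the values of the form, B and C for derivatives of
    its coefficients, and the hypothesis is closedness as given by [D_sym]. *)
Lemma weighted_sum_swap (R : comRingType) n (v w T B C : 'I_n -> R) t :
  \sum_i w i * B i = \sum_i v i * C i ->
  \sum_i v i * (T i + t * C i) = \sum_i (w i * (t * B i) + T i * v i).
Proof.
move=> E; transitivity (t * (\sum_i v i * C i) + \sum_i v i * T i).
  by rewrite mulr_sumr -big_split /=; apply: eq_bigr => i _; ring.
by rewrite -E mulr_sumr -big_split /=; apply: eq_bigr => i _; ring.
Qed.

(** * A primitive of a closed 1-form on a ball *)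

Section Poincare.
Variables (R : realType) (m : nat) (a : 'rV[R]_m) (r M : R) (th : 'I_m -> 'rV[R]_m -> R).
Local Notation A := (ball a r).
Local Notation e_ j := (delta_mx 0 j : 'rV[R]_m).
Hypothesis th1 : forall i, sCk 1 A (th i).
Hypothesis thM : forall i x, A x -> `|th i x| <= M.
Hypothesis DthM : forall i j x, A x -> `|'D_(e_ j) (th i) x| <= M.
Hypothesis thC : forall i j x, A x -> 'D_(e_ j) (th i) x = 'D_(e_ i) (th j) x.
Local Notation mu := (@lebesgue_measure R).

(** The homotopy operator of the contraction of the ball to its centre, applied to the 1-form
    [th]. *)
Definition poincare_potential x :=
  \int[mu]_(t in `[0, 1]) linform (th ^~ (a + t *: (x - a))) (x - a).

Let dth i x : A x -> differentiable (th i) x.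
Proof. by have [+ _] := th1 i; exact. Qed.

Section Point.
Variables x v : 'rV[R]_m.
Hypothesis Ax : A x.
Let u := x - a.
Let p (s t : R) := a + t *: (u + s *: v).
Let phi (s t : R) := linform (th ^~ (p s t)) (u + s *: v).
Let dphi (s t : R) := \sum_i v 0 i * (th i (p s t) + t * 'D_(u + s *: v) (th i) (p s t)).

Let sub_r_gt0 : 0 < r - `|u|.
Proof. by rewrite subr_gt0; move: Ax; rewrite -ball_normE /ball_ /= /u distrC. Qed.

(** For |s| < d the point x + s v stays in the ball, and with it the whole segment from a; the 1 in
    the denominator covers v = 0. *)
Let d := (r - `|u|) / (`|v| + 1).

Let d0 : 0 < d.
Proof. by rewrite divr_gt0// ltr_wpDl. Qed.

Let Ap (s t : R) : `|s| < d -> 0 <= t <= 1 -> A (p s t) /\ `|u + s *: v| < r.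
Proof.
move=> sd /andP[t0 t1].
have H : `|u + s *: v| < r.
  rewrite (le_lt_trans (ler_normD _ _))// normrZ -ltrBrDl.
  have v0 : 0 < `|v| + 1 by rewrite ltr_wpDl.
  apply: (@le_lt_trans _ _ (`|s| * (`|v| + 1))).
    by rewrite ler_wpM2l// lerDl.
  by rewrite -ltr_pdivlMr.
split=> //; rewrite -ball_normE /ball_ /= /p opprD addrA subrr sub0r normrN.
by rewrite normrZ ger0_norm// (le_lt_trans _ H)// ler_piMl.
Qed.

Let D_sym (w y : 'rV[R]_m) : A y -> \sum_i w 0 i * 'D_v (th i) y = \sum_i v 0 i * 'D_w (th i) y.
Proof.
move=> Ay.
have -> : \sum_i w 0 i * 'D_v (th i) y = \sum_i \sum_j w 0 i * (v 0 j * 'D_(e_ j) (th i) y).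
  by apply: eq_bigr => i _; rewrite derive_linear_sum ?mulr_sumr//; exact: dth.
rewrite exchange_big /=; apply: eq_bigr => j _.
rewrite (derive_linear_sum _ (dth j Ay)) mulr_sumr; apply: eq_bigr => i _.
by rewrite (thC i j Ay); rewrite [RHS]mulrCA.
Qed.

Let phi_derive (s t : R) : `|s| < d -> 0 <= t <= 1 -> is_derive s 1 (phi ^~ t) (dphi s t).
Proof.
move=> sd t01; have [Apst _] := Ap sd t01.
have -> : phi ^~ t = \sum_i (fun s' => (u + s' *: v) 0 i * th i (p s' t)).
  by apply/funext => s'; rewrite fct_sumE.
have -> : dphi s t = \sum_i ((u + s *: v) 0 i * (t * 'D_v (th i) (p s t)) + th i (p s t) * v 0 i).
  by apply: weighted_sum_swap; rewrite -D_sym.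
apply: is_derive_sum => i.
have H1 : is_derive s 1 (fun s' : R => (u + s' *: v) 0 i) (v 0 i).
  have -> : (fun s' => (u + s' *: v) 0 i) = cst (u 0 i) + (fun s' : R => s' *: v 0 i).
    by apply/funext => s'; rewrite !mxE.
  rewrite -[X in is_derive _ _ _ X]add0r.
  apply: is_deriveD.
  apply: DeriveDef.
    by apply/derivable1_diffP; exact: ex_diff.
  rewrite deriveE; last exact: ex_diff.
  by rewrite diff_val scale1r.
have H2 : is_derive s 1 (fun s' : R => th i (p s' t)) (t * 'D_v (th i) (p s t)).
  have -> : (fun s' => th i (p s' t)) = (fun s' => th i ((a + t *: u) + s' *: (t *: v))).
    by apply/funext => s'; rewrite /p scalerDr addrA !scalerA mulrC.
  have pE : p s t = a + t *: u + s *: (t *: v).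
    by rewrite /p scalerDr addrA !scalerA mulrC.
  apply: is_derive_line; rewrite -pE.
  have -> : t * 'D_v (th i) (p s t) = 'D_(t *: v) (th i) (p s t).
    have dt := dth i Apst.
    by rewrite (deriveE (t *: v) dt) (deriveE v dt) linearZ.
  exact/derivableP/diff_derivable/dth.
exact: (is_deriveM H1 H2).
Qed.

Let line_continuous (f : 'rV[R]_m -> R) (s t : R) : `|s| < d -> 0 <= t <= 1 ->
  (forall y, A y -> {for y, continuous f}) -> {for t, continuous (fun t' => f (p s t'))}.
Proof.
move=> sd t01 cf; apply: (@continuous_comp _ _ _ (p s) f).
  apply: continuousD; first exact: cst_continuous.
  exact: scalel_continuous.
by apply: cf; have [] := Ap sd t01.
Qed.

Let integrable_line (f : R -> R) :
  (forall t, 0 <= t <= 1 -> {for t, continuous f}) -> mu.-integrable `[0, 1] (EFin \o f).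
Proof.
move=> cf; apply: continuous_compact_integrable; first exact: segment_compact.
apply: continuous_in_subspaceT => t; rewrite inE /= in_itv /=; exact: cf.
Qed.

Let ftc_w (s : R) i (t : R) : `|s| < d -> 0 <= t <= 1 ->
  is_derive t 1 (fun t' => t' * th i (p s t'))
    (th i (p s t) + t * 'D_(u + s *: v) (th i) (p s t)).
Proof.
move=> sd t01; have [Apst _] := Ap sd t01.
have H : is_derive t 1 (fun t' => th i (p s t')) ('D_(u + s *: v) (th i) (p s t)).
  by apply: is_derive_line; exact/derivableP/diff_derivable/dth.
have H' := is_deriveM (is_derive_id t (1 : R)) H.
by rewrite /GRing.scale /= mulr1 addrC in H'.
Qed.

Let continuous_sum n (f : 'I_n -> R -> R) t :
  (forall i, {for t, continuous (f i)}) -> {for t, continuous (fun t' => \sum_i f i t')}.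
Proof.
elim: n f => [|n IH] f cf.
  rewrite (_ : (fun _ => _) = cst 0); first exact: cst_continuous.
  by apply/funext => y; rewrite big_ord0.
rewrite (_ : (fun _ => _) = (fun t' => \sum_(i < n) f (widen_ord (leqnSn n) i) t' + f ord_max t')).
  by apply: continuousD; [exact: IH|exact: cf].
by apply/funext => y; rewrite big_ord_recr.
Qed.

Let norm0d : `|0 : R| < d. Proof. by rewrite normr0. Qed.

Let D_bound (w : 'rV[R]_m) i (y : 'rV[R]_m) : A y -> `|w| <= r -> `|'D_w (th i) y| <= \sum_(j < m) r * M.
Proof.
move=> Ay wr; rewrite (derive_linear_sum _ (dth i Ay)) (le_trans (ler_norm_sum _ _ _))//.
apply: ler_sum => j _; rewrite normrM ler_pM//; last exact: DthM.
rewrite (le_trans _ wr)// [leRHS]/Num.Def.normr/= mx_normrE.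
exact: (le_bigmax _ (fun i => `|w i.1 i.2|) (0, j)).
Qed.

(** A constant majorant of [dphi], the domination demanded by differentiation under the integral
    sign; this is where the bounds by M are spent. *)
Let G := \sum_i `|v 0 i| * (M + \sum_(j < m) r * M).

Let dphi_bound (s t : R) : `|s| < d -> 0 <= t <= 1 -> `|dphi s t| <= G.
Proof.
move=> sd t01; have [Apst ur] := Ap sd t01.
rewrite (le_trans (ler_norm_sum _ _ _))//; apply: ler_sum => i _.
rewrite normrM ler_wpM2l// (le_trans (ler_normD _ _))// lerD ?thM//.
have /andP[t0 t1] := t01.
rewrite normrM ger0_norm// (le_trans _ (D_bound i Apst (ltW ur)))//.
by rewrite ler_piMl.
Qed.

Let int_dphi : \int[mu]_(t in `[0, 1]) dphi 0 t = linform (th ^~ x) v.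
Proof.
have px : p 0 1 = x by rewrite /p scale0r addr0 scale1r /u subrKC.
pose F t := \sum_i v 0 i * (t * th i (p 0 t)).
have dF (t : R) : 0 <= t <= 1 -> is_derive t 1 F (dphi 0 t).
  move=> t01.
  have -> : F = \sum_i (fun t' => v 0 i * (t' * th i (p 0 t'))).
    by apply/funext => s'; rewrite fct_sumE.
  apply: is_derive_sum => i.
  exact: (@is_deriveZ _ _ _ _ (v 0 i) _ _ _ (ftc_w i norm0d t01)).
have cF (t : R) : 0 <= t <= 1 -> {for t, continuous F}.
  by move=> /dF[+ _]; move=> /derivable1_diffP/differentiable_continuous.
rewrite /Rintegral (@continuous_FTC2 _ (dphi 0) F)//.
- rewrite -EFinB /= /F px [X in _ - X]big1 ?subr0 => [|i _]; last by rewrite mul0r mulr0.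
  by apply: eq_bigr => i _; rewrite mul1r.
- apply: continuous_in_subspaceT => t; rewrite inE /= in_itv /= => t01.
  apply: continuous_sum => i; apply: continuousM; first exact: cst_continuous.
  apply: continuousD.
    apply: line_continuous => // y Ay; exact/differentiable_continuous/dth.
  apply: continuousM; first exact: (@cvg_id _ (nbhs t)).
  apply: (line_continuous (f := fun y => 'D_(u + 0 *: v) (th i) y)) => // y Ay.
  by have [_ +] := th1 i; move/(_ (u + 0 *: v) y Ay).
- split=> [t||].
  + by rewrite in_itv /= => /andP[t0 t1]; have [] // := dF t; rewrite !ltW.
  + by apply: cvg_at_right_filter; apply: cF; rewrite lexx ler01.
  + by apply: cvg_at_left_filter; apply: cF; rewrite lexx ler01.
- move=> t; rewrite in_itv /= => /andP[t0 t1].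
  by rewrite derive1E; have [] // := dF t; rewrite !ltW.
Qed.

(* By closedness, dphi is the t-derivative of t * linform (th ^~ (p s t)) v. *)
Lemma poincare_potential_derive : is_derive x v poincare_potential (linform (th ^~ x) v).
Proof.
have I0 : `]- d, d[%classic 0 by rewrite /= in_itv /= oppr_lt0 d0.
have Id (s : R) : `]- d, d[%classic s -> `|s| < d by rewrite /= in_itv /= ltr_norml.
have H := @cvg_differentiation_under_integral R _ _ mu phi `[0, 1] (measurable_itv _) 0 (- d) d I0.
have {}H : h^-1 *: ((\int[mu]_(t in `[0, 1]) phi (h + 0) t) - \int[mu]_(t in `[0, 1]) phi 0 t) @[h --> 0^'] -->
   \int[mu]_(t in `[0, 1]) partial1of2 phi 0 t.
  apply: (H _ _ (fun=> G)).
  - move=> s /Id sd; apply: integrable_line => t t01.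
    apply: continuous_sum => i; apply: continuousM; first exact: cst_continuous.
    apply: line_continuous => // y Ay; exact/differentiable_continuous/dth.
  - move=> s t /Id sd; rewrite /= in_itv /= => t01.
    by have [] := phi_derive sd t01.
  - move=> _; apply: le_trans (dphi_bound norm0d (t := 0) _) => //.
    by rewrite lexx ler01.
  - apply: integrable_line => t _; exact: cst_continuous.
  - move=> s t /Id sd; rewrite /= in_itv /= => t01.
    rewrite partial1of2E; have [_ ->] := phi_derive sd t01; exact: dphi_bound.
have E : \int[mu]_(t in `[0, 1]) partial1of2 phi 0 t = linform (th ^~ x) v.
  rewrite -int_dphi; apply: eq_Rintegral => t; rewrite inE /= in_itv /= => t01.
  by rewrite partial1of2E; have [_ ->] := phi_derive norm0d t01.
rewrite E in H.
have F1 (s : R) : \int[mu]_(t in `[0, 1]) phi s t = poincare_potential (s *: v + x).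
  rewrite /poincare_potential /phi /p; apply: eq_Rintegral => t _.
  have -> : x - a + s *: v = s *: v + x - a by rewrite addrAC (addrC x).
  by [].
have F : (fun h : R => h^-1 *: ((\int[mu]_(t in `[0, 1]) phi (h + 0) t) - \int[mu]_(t in `[0, 1]) phi 0 t))
  = (fun h : R => h^-1 *: ((poincare_potential \o shift x) (h *: v) - poincare_potential x)).
  by apply/funext => h; rewrite !F1 addr0 scale0r add0r.
rewrite F in H.
apply: DeriveDef; first by apply/cvg_ex; exists (linform (th ^~ x) v).
by rewrite /derive; apply/cvg_lim.
Qed.

End Point.
End Poincare.

Lemma near_bounded (R : realType) (T : topologicalType) (I : finType) (a : T)
    (f : I -> T -> R) : (forall i, {for a, continuous (f i)}) ->
  exists M : R, \forall x \near a, forall i, `|f i x| <= M.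
Proof.
move=> cf; exists (\sum_i (`|f i a| + 1)); apply: near_forall => i.
have /cvgrPdist_le/(_ 1 ltr01) := cf i; apply: filterS => x /= fx.
rewrite (bigD1 i)//= ler_wpDr//; first by apply: sumr_ge0 => j _; rewrite addr_ge0.
by rewrite -lerBlDl (le_trans _ fx)// distrC lerB_dist.
Qed.

(** Here b v is a form evaluated on the constant field v. The ball is taken so small that continuity
    at a bounds the coefficients and their first derivatives, as the domination argument
    requires. *)
Lemma poincare (R : realType) (m : nat) (A : set 'rV[R]_m) (a : 'rV[R]_m)
    (b : 'rV[R]_m -> 'rV[R]_m -> R) : open A -> A a ->
  (forall x v, A x -> b v x = \sum_i v 0 i * b (delta_mx 0 i) x) ->
  (forall v k, sCk k A (b v)) ->
  (forall x v w, A x -> 'D_w (b v) x = 'D_v (b w) x) ->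
  exists2 r : R, 0 < r & ball a r `<=` A /\ exists h : 'rV[R]_m -> R,
    (forall k, sCk k (ball a r) h) /\
    forall x, ball a r x -> forall v, 'D_v h x = b v x.
Proof.
move=> oA Aa blin bs bc.
pose th i := b (delta_mx 0 i : 'rV[R]_m).
pose dth (ij : 'I_m * 'I_m) x := 'D_(delta_mx 0 ij.2 : 'rV[R]_m) (th ij.1) x.
have [|M1 H1] := @near_bounded R _ _ a th; first by move=> i; exact: (bs _ 0%N).
have [|M2 H2] := @near_bounded R _ _ a dth.
  by move=> [i j]; have [_ +] := bs (delta_mx 0 i) 1%N; move/(_ (delta_mx 0 j) a Aa).
pose M := Num.max M1 M2.
have : nbhs a (A `&` [set x | (forall i, `|th i x| <= M1) /\ forall ij, `|dth ij x| <= M2]).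
  by apply: filterI; [exact: open_nbhs_nbhs|exact: filterI].
move=> /nbhs_ballP[r /= r0 B].
exists r => //; split; first by move=> x /B[].
have AB x : ball a r x -> A x by move=> /B[].
have B1 i x : ball a r x -> `|th i x| <= M.
  by move=> /B[_ [H _]]; rewrite (le_trans (H i))// le_max lexx.
have B2 ij x : ball a r x -> `|dth ij x| <= M.
  by move=> /B[_ [_ H]]; rewrite (le_trans (H ij))// le_max lexx orbT.
have ths i k : sCk k (ball a r) (th i) by apply: sCk_sub (bs _ k) => x /AB.
have D x v : ball a r x -> is_derive x v (poincare_potential a th) (linform (th ^~ x) v).
  apply: (@poincare_potential_derive _ _ _ _ M) => //.
  - by move=> i j y; exact: (B2 (i, j)).
  - by move=> i j y /AB; exact: bc.
have dh : forall x, ball a r x -> differentiable (poincare_potential a th) x.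
  apply: (@gradient_differentiable _ _ _ _ _ th).
    by move=> x xr i; exact: (ths i 0%N).
  by move=> x xr v; exact: D.
exists (poincare_potential a th); split.
  (* No further differentiation under the integral is needed: the derivatives of the potential are
     the smooth functions b v. *)
  move=> [|k].
    by move=> x xr; exact/differentiable_continuous/dh.
  split=> // v; apply: (@sCk_ext _ _ _ _ (b v)) => // [|x xr|].
  - exact: ball_open.
  - by have [_ ->] := D x v xr; rewrite (blin _ _ (AB _ xr)).
  - by apply: sCk_sub (bs _ k) => x /AB.
by move=> x xr v; have [_ ->] := D x v xr; rewrite (blin _ _ (AB _ xr)).
Qed.

(** * Monodromy *)

(** Real induction on the supremum of the points t with P a t. It stands in for subdivisions finer
    than a Lebesgue number: P need only be additive and hold on short intervals around each
    point. *)
Lemma cousin (R : realType) (P : R -> R -> Prop) :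
  (forall a b c, a <= b -> b <= c -> P a b -> P b c -> P a c) ->
  (forall t, exists2 d : R, 0 < d & forall a b, a <= t -> t <= b -> t - d < a -> b < t + d -> P a b) ->
  forall a b, a <= b -> P a b.
Proof.
move=> Padd Ploc a b ab.
pose S := [set t | a <= t <= b /\ P a t].
have Sa : S a.
  by have [d d0 H] := Ploc a; split; [rewrite lexx|apply: H; rewrite ?ltrBlDr ?ltrDl].
have Sb : ubound S b by move=> t [/andP[]].
have hS : has_sup S by split; [exists a|exists b].
have [d d0 H] := Ploc (sup S).
have as_ : a <= sup S by apply: ub_le_sup => //; exists b.
have sb : sup S <= b by apply: sup_le_ub => //; exists a.
have [t St st] := sup_adherent d0 hS.
have ts : t <= sup S by apply: ub_le_sup => //; exists b.
have [/andP[at_ tb] Pat] := St.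
have Ps u : sup S <= u -> u < sup S + d -> P a u.
  move=> su ud; apply: (Padd _ t) => //; first exact: le_trans su.
  exact: H.
have [sb'|bs] := ltP (sup S) b; last first.
  by apply: Ps => //; rewrite (le_lt_trans bs)// ltrDl.
(* A point of [S] beyond its supremum, capped at b to remain in the interval. *)
pose u := Num.min b (sup S + d / 2).
have su : sup S < u by rewrite lt_min sb' ltrDl divr_gt0.
have Su : S u.
  split; first by rewrite (le_trans as_ (ltW su)) ge_min lexx.
  apply: Ps; first exact: ltW.
  by rewrite gt_min ltrD2l ltr_pdivrMr// ltr_pMr// ltr1n orbT.
have : u <= sup S by apply: ub_le_sup => //; exists b.
by rewrite leNgt su.
Qed.

Lemma continuous_fun_pair (T U V : topologicalType) (f : T -> U) (g : T -> V) :
  continuous f -> continuous g -> continuous (fun t => (f t, g t)).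
Proof.
move=> cf cg t A [[B C] /= [nB nC] BC].
have : nbhs t ((f @^-1` B) `&` (g @^-1` C)).
  by apply: filterI; [exact: (cf t _ nB)|exact: (cg t _ nC)].
by apply: filterS => s [Bs Cs]; exact: (BC (f s, g s)).
Qed.

(** * Paths in a topological space *)

Section Paths.
Variables (R : realType).

(** The retraction of R onto [0, 1], by a formula whose continuity is immediate. Composing with it
    extends maps known to be continuous only on [0, 1], or on the square, to continuous maps on the
    line or the plane. *)
Definition clamp (t : R) : R := (`|t| - `|t - 1| + 1) / 2.

Lemma clamp01 t : 0 <= clamp t <= 1.
Proof.
rewrite /clamp; have [t0|t0] := leP 0 t; have [t1|t1] := leP 0 (t - 1);
  rewrite ?(ger0_norm t0) ?(ltr0_norm t0) ?(ger0_norm t1) ?(ltr0_norm t1);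
  apply/andP; split; lra.
Qed.

Lemma clamp_id t : 0 <= t <= 1 -> clamp t = t.
Proof.
by case/andP=> t0 t1; rewrite /clamp ger0_norm// distrC ger0_norm ?subr_ge0//; lra.
Qed.

Lemma clamp_continuous : continuous clamp.
Proof.
move=> t; apply: (@continuousM _ _ (fun t : R => `|t| - `|t - 1| + 1) (cst 2^-1)); last exact: cst_continuous.
apply: continuousD; last exact: cst_continuous.
apply: continuousB; first exact: norm_continuous.
apply: (@continuous_comp _ _ _ (fun s : R => s - 1) (fun s : R => `|s|)); last exact: norm_continuous.
by apply: continuousD; [exact: (@cvg_id _ (nbhs t))|exact: cst_continuous].
Qed.

Lemma within_comp (T T' U : topologicalType) (A : set T) (f : T -> U) (g : T' -> T) :
  {within A, continuous f} -> continuous g -> (forall t, A (g t)) -> continuous (f \o g).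
Proof.
move=> /subspace_continuousP cf cg Ag t B fB.
have H : nbhs t (g @^-1` [set x | A x -> B (f x)]) by exact: (cg t _ (cf _ (Ag t) B fB)).
by apply: filterS H => s; apply.
Qed.

Definition path_cat (T : Type) (g h : R -> T) (t : R) : T :=
  if t <= 1 / 2 then g (2 * t) else h (2 * t - 1).

Lemma path_catl T (g h : R -> T) t : t <= 1 / 2 -> path_cat g h t = g (2 * t).
Proof. by rewrite /path_cat => ->. Qed.

Lemma path_catr T (g h : R -> T) t : g 1 = h 0 -> 1 / 2 <= t ->
  path_cat g h t = h (2 * t - 1).
Proof.
rewrite /path_cat => gh; case: ltgtP => //= <- _.
by rewrite mul1r divff// gh subrr.
Qed.

Lemma affine_continuous (a b : R) : continuous (fun t : R => a * t + b).
Proof.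
move=> t; apply: continuousD; last exact: cst_continuous.
by apply: continuousM; [exact: cst_continuous|exact: (@cvg_id _ (nbhs t))].
Qed.

Lemma path_cat_continuous (T : topologicalType) (g h : R -> T) :
  continuous g -> continuous h -> g 1 = h 0 -> continuous (path_cat g h).
Proof.
move=> cg ch gh; apply/continuous_subspace_setT.
have -> : [set: R] = `]-oo, 1 / 2]%classic `|` `[1 / 2, +oo[%classic.
  apply/seteqP; split=> // t _; rewrite /= !in_itv /= andbT.
  by have [|/ltW] := leP t (1 / 2); [left|right].
apply: withinU_continuous; [exact: interval_closed|exact: interval_closed| |].
  pose f1 (t : R) := g (2 * t + 0).
  have c1 : continuous f1.
    by move=> t; apply: (@continuous_comp _ _ _ (fun s : R => 2 * s + 0) g); [exact: affine_continuous|exact: cg].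
  apply: (subspace_eq_continuous _ (continuous_subspaceT (A := _) c1)).
  move=> t; rewrite inE /= in_itv /= => t12. by rewrite /from_subspace path_catl// /f1 addr0.
pose f2 (t : R) := h (2 * t - 1).
have c2 : continuous f2.
  by move=> t; apply: (@continuous_comp _ _ _ (fun s : R => 2 * s - 1) h); [exact: affine_continuous|exact: ch].
apply: (subspace_eq_continuous _ (continuous_subspaceT (A := _) c2)).
by move=> t; rewrite inE /= in_itv /= andbT => t12; rewrite /from_subspace path_catr.
Qed.

End Paths.

(** * Continuation of admissible maps along paths and homotopies *)

Section Monodromy.
Variables (R : realType) (M : topologicalType) (X : Type).
Variable Adm : set M -> (M -> X) -> Prop.
Hypothesis adm_open : forall U e, Adm U e -> open U.
Hypothesis adm_cover : forall p, exists U e, Adm U e /\ U p.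
(* Admissible maps stand for the local parallel sections of a flat bundle. *)
Hypothesis adm_extend : forall U U' e e' q, Adm U e -> Adm U' e' -> U q -> U' q ->
  exists e'', Adm U e'' /\ \forall x \near q, e'' x = e' x.
Hypothesis adm_unique : forall U e e' q, Adm U e -> Adm U e' -> U q ->
  e q = e' q -> forall x, U x -> e x = e' x.

Lemma adm_near U e p : Adm U e -> U p -> \forall x \near p, U x.
Proof. by move=> /adm_open oU Up; exact: open_nbhs_nbhs. Qed.

(** Continue e' into U by [adm_extend]; the continuation agrees with e at q, hence on U. *)
Lemma adm_agree U U' e e' q : Adm U e -> Adm U' e' -> U q -> U' q ->
  e q = e' q -> \forall x \near q, e x = e' x.
Proof.
move=> aU aU' Uq U'q eq_; have [e'' [aU'' e''e']] := adm_extend aU aU' Uq U'q.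
have e''q := nbhs_singleton e''e'.
near=> x; rewrite -(near e''e' x)//; apply: (adm_unique aU aU'' Uq); first by rewrite eq_ e''q.
by near: x; exact: (adm_near aU Uq).
Unshelve. all: by end_near. Qed.

Section Lift.
Variables (T : topologicalType).
Implicit Types (H : T -> M) (Q : set T) (x : T -> X).

(** A lift of H to the space of germs of admissible maps. By [adm_agree] a value determines its
    germ, so X needs no topology. Only the points of Q matter, even near its boundary. *)
Definition is_lift H Q x := forall z, Q z -> exists U e,
  [/\ Adm U e, U (H z) & \forall z' \near z, Q z' -> x z' = e (H z')].

Lemma is_liftW H Q Q' x : Q' `<=` Q -> is_lift H Q x -> is_lift H Q' x.
Proof.
move=> Q'Q lx z /Q'Q/lx[U [e [aU UHz xe]]]; exists U, e; split=> //.
by apply: filterS xe => z' + /Q'Q.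
Qed.

Lemma is_lift_ext H H' Q x : (forall z, Q z -> H z = H' z) ->
  is_lift H Q x -> is_lift H' Q x.
Proof.
move=> HH' lx z Qz; have [U [e [aU UHz xe]]] := lx z Qz; exists U, e; split=> //.
  by rewrite -HH'.
by apply: filterS xe => z' xz' Qz'; rewrite -HH'// xz'.
Qed.

Lemma lift_adm H Q x z : is_lift H Q x -> Q z -> exists U e,
  [/\ Adm U e, U (H z) & x z = e (H z)].
Proof.
move=> lx Qz; have [U [e [aU Uz xe]]] := lx z Qz; exists U, e; split=> //.
exact: (nbhs_singleton xe).
Qed.

(** Near a point of Q both lifts come from maps admissible on one open set, so agreement and
    disagreement are both open conditions in Q. *)
Lemma lift_unique H Q x y z0 : continuous H -> connected Q ->
  is_lift H Q x -> is_lift H Q y -> Q z0 -> x z0 = y z0 ->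
  forall z, Q z -> x z = y z.
Proof.
move=> cH cQ lx ly Qz0 xy0.
pose E := [set z | Q z -> x z = y z]; pose D := [set z | Q z -> x z <> y z].
have key z : Q z -> (x z = y z -> E^° z) /\ (x z <> y z -> D^° z).
  move=> Qz; have [U [e [aU Uz xe]]] := lx z Qz.
  have [U' [e' [aU' U'z ye]]] := ly z Qz.
  have [e'' [aU'' e''e']] := adm_extend aU aU' Uz U'z.
  have He : \forall z' \near z, e'' (H z') = e' (H z') by exact: (cH z _ e''e').
  have HU : \forall z' \near z, U (H z') by exact: (cH z _ (adm_near aU Uz)).
  have xz := nbhs_singleton xe Qz; have yz := nbhs_singleton ye Qz.
  have e''z := nbhs_singleton He.
  split=> xyz.
    rewrite /interior; near=> z' => Qz'.
    have -> : x z' = e (H z') by apply: (near xe z').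
    have -> : y z' = e' (H z') by apply: (near ye z').
    have <- : e'' (H z') = e' (H z') by apply: (near He z').
    apply: (adm_unique aU aU'' Uz); first by rewrite e''z -xz -yz.
    by apply: (near HU z').
  rewrite /interior; near=> z' => Qz' xyz'; apply: xyz.
  rewrite xz yz -e''z; apply: (adm_unique aU aU'' (q := H z')) => //.
    by apply: (near HU z').
  have <- : x z' = e (H z') by apply: (near xe z').
  have -> : e'' (H z') = e' (H z') by apply: (near He z').
  by rewrite xyz'; apply: (near ye z').
have B : Q `&` E = Q.
  apply: cQ; first by exists z0; split => // _.
    exists E^°; first exact: open_interior.
    apply/seteqP; split=> z [Qz Ez]; split=> //.
      by apply: (key z Qz).1; exact: Ez.
    exact: interior_subset.
  exists (~` D^°); first by apply: open_closedC; exact: open_interior.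
  apply/seteqP; split=> z [Qz Ez]; split=> //.
    by move=> /interior_subset Dz; exact: (Dz Qz (Ez Qz)).
  by move=> _; apply: contrapT => xyz; apply: Ez; apply: (key z Qz).2.
move=> z Qz; have [_ Ez] : (Q `&` E) z by rewrite B.
exact: Ez.
Unshelve. all: by end_near. Qed.

(** Both the point and the value there are arbitrary: gluing two pieces restarts the lift on the
    second one at a point of the overlap. *)
Definition liftable H Q := forall z U e, Q z -> Adm U e -> U (H z) ->
  exists2 x, is_lift H Q x & x z = e (H z).

(** A lift on the piece containing z is continued on the other one from a common point. On the
    connected overlap the two coincide by uniqueness; the pieces being closed, a point outside one
    of them sees only the other nearby. *)
Lemma liftable_union H Q1 Q2 : continuous H -> closed Q1 -> closed Q2 ->
  connected (Q1 `&` Q2) -> Q1 `&` Q2 !=set0 ->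
  liftable H Q1 -> liftable H Q2 -> liftable H (Q1 `|` Q2).
Proof.
move=> cH c1 c2 c12 n12 l1 l2.
have key P1 P2 : closed P1 -> closed P2 -> connected (P1 `&` P2) -> P1 `&` P2 !=set0 ->
  liftable H P1 -> liftable H P2 -> forall z U e, P1 z -> Adm U e -> U (H z) ->
  exists2 x, is_lift H (P1 `|` P2) x & x z = e (H z).
  move=> {}c1 {}c2 {}c12 [z0 [P1z0 P2z0]] {}l1 {}l2 z U e P1z aU Uz.
  have [x1 lx1 x1z] := l1 z U e P1z aU Uz.
  have [U' [e' [aU' U'z0 x1z0]]] := lift_adm lx1 P1z0.
  have [x2 lx2 x2z0] := l2 z0 U' e' P2z0 aU' U'z0.
  have x12 : forall z, (P1 `&` P2) z -> x1 z = x2 z.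
    apply: (lift_unique cH c12 (is_liftW (@subIsetl _ P1 P2) lx1)
      (is_liftW (@subIsetr _ P1 P2) lx2) (conj P1z0 P2z0)).
    by rewrite x2z0.
  exists (fun z => if `[< P1 z >] then x1 z else x2 z); last by rewrite asboolT.
  move=> w Pw.
  have [P1w|nP1w] := pselect (P1 w); have [P2w|nP2w] := pselect (P2 w).
  - have [V [f [aV Vw x1f]]] := lx1 w P1w; have [V' [f' [aV' V'w x2f]]] := lx2 w P2w.
    exists V, f; split=> //.
    (* At an overlap point the two local representatives take the same value, hence agree nearby,
       and [f] alone represents the glued map. *)
    have ff' : \forall z' \near w, f (H z') = f' (H z').
      apply: (cH w [set q | f q = f' q]); apply: (adm_agree aV aV' Vw V'w).
      rewrite -(nbhs_singleton x1f P1w) -(nbhs_singleton x2f P2w).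
      exact: x12.
    near=> z' => Pz'; case: asboolP => [P1z'|nP1z'].
      by apply: (near x1f z').
    have -> : f (H z') = f' (H z') by apply: (near ff' z').
    apply: (near x2f z') => //.
    by case: Pz'.
  - have [V [f [aV Vw x1f]]] := lx1 w P1w; exists V, f; split=> //.
    have nP2 : \forall z' \near w, ~ P2 z'.
      by apply: open_nbhs_nbhs; split=> //; exact: closed_openC.
    near=> z' => Pz'.
    have P1z' : P1 z' by case: Pz' => // P2z'; exfalso; apply: (near nP2 z').
    by rewrite asboolT//; apply: (near x1f z').
  - have [V [f [aV Vw x2f]]] := lx2 w P2w; exists V, f; split=> //.
    have nP1 : \forall z' \near w, ~ P1 z'.
      by apply: open_nbhs_nbhs; split=> //; exact: closed_openC.
    near=> z' => Pz'.
    have nP1z' : ~ P1 z' by apply: (near nP1 z').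
    by rewrite asboolF//; apply: (near x2f z') => //; case: Pz'.
  - by case: Pw.
move=> z U e [Q1z|Q2z] aU Uz.
  exact: (key Q1 Q2 c1 c2 c12 n12 l1 l2 z U e Q1z aU Uz).
rewrite setIC in c12 n12; rewrite setUC.
exact: (key Q2 Q1 c2 c1 c12 n12 l2 l1 z U e Q2z aU Uz).
Unshelve. all: by end_near. Qed.

Lemma liftable_local H (z : T) : continuous H ->
  exists2 N : set T, nbhs z N & forall Q, Q `<=` N -> liftable H Q.
Proof.
move=> cH; have [U [e [aU Uz]]] := adm_cover (H z).
exists (H @^-1` U); first exact: (cH z _ (adm_near aU Uz)).
move=> Q NU w V f Qw aV Vw.
have [e'' [aU'' e''f]] := adm_extend aU aV (NU _ Qw) Vw.
exists (e'' \o H); last exact: (nbhs_singleton e''f).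
move=> y Qy; exists U, e''; split=> //; first exact: NU.
exact: nearW.
Qed.

End Lift.

Lemma is_lift_comp (T T' : topologicalType) (g : T' -> T) (H : T -> M) (Q : set T) x :
  continuous g -> is_lift H Q x -> is_lift (H \o g) (g @^-1` Q) (x \o g).
Proof.
move=> cg lx z Qz; have [U [e [aU Uz xe]]] := lx _ Qz; exists U, e; split=> //.
exact: cg xe.
Qed.

Definition rect (a b c d : R) := [set z : R * R | a <= z.1 <= b /\ c <= z.2 <= d].

Lemma rect_closed a b c d : closed (rect a b c d).
Proof.
have c1 : continuous (fst : R * R -> R) by move=> z; exact: cvg_fst.
have c2 : continuous (snd : R * R -> R) by move=> z; exact: cvg_snd.
have -> : rect a b c d = (fst @^-1` `[a, b]%classic) `&` (snd @^-1` `[c, d]%classic).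
  by apply/seteqP; split=> z; rewrite /rect /= !in_itv.
apply: closedI; apply: preimage_closed => //; exact: interval_closed.
Qed.

Lemma vrect_connected b c d : connected (rect b b c d).
Proof.
have -> : rect b b c d = (fun t => (b, t)) @` `[c, d]%classic.
  apply/seteqP; split=> [[x y] [/= xb yc]|_ [y] /= + <-].
    by exists y; [rewrite in_itv|congr (_, _); apply/eqP; rewrite eq_le].
  by rewrite in_itv => H; rewrite /rect /= lexx.
apply: connected_continuous_connected; first exact: segment_connected.
apply: continuous_subspaceT; apply: continuous_fun_pair => t.
  exact: cvg_cst.
exact: cvg_id.
Qed.

Lemma hrect_connected a b c : connected (rect a b c c).
Proof.
have -> : rect a b c c = (fun t => (t, c)) @` `[a, b]%classic.
  apply/seteqP; split=> [[x y] [/= xb yc]|_ [y] /= + <-].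
    by exists x; [rewrite in_itv|congr (_, _); apply/eqP; rewrite eq_le].
  by rewrite in_itv => H; rewrite /rect /= lexx.
apply: connected_continuous_connected; first exact: segment_connected.
apply: continuous_subspaceT; apply: continuous_fun_pair => t.
  exact: cvg_id.
exact: cvg_cst.
Qed.

(** [cousin] is used twice: the heights are subdivided and, around a fixed height t, so is the
    horizontal side. Adjacent rectangles overlap in a segment, which is connected. *)
Lemma rect_liftable (H : R * R -> M) a b c d : continuous H -> a <= b -> c <= d ->
  liftable H (rect a b c d).
Proof.
move=> cH ab; move: c d; apply: cousin => [c d e cd de l1 l2|t].
  have -> : rect a b c e = rect a b c d `|` rect a b d e.
    apply/seteqP; split=> [z [z1 /andP[z2 z3]]|z [[z1 /andP[z2 z3]]|[z1 /andP[z2 z3]]]].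
    - by have [zd|/ltW dz] := leP z.2 d; [left|right]; split=> //; apply/andP.
    - by split=> //; rewrite z2 (le_trans z3).
    - by split=> //; rewrite z3 (le_trans cd).
  have E : rect a b c d `&` rect a b d e = rect a b d d.
    apply/seteqP; split=> [z [[z1 /andP[z2 z3]] [_ /andP[z4 z5]]]|z [z1 /andP[z2 z3]]].
      by split=> //; rewrite z4 z3.
    by split; split=> //; [rewrite (le_trans cd z2)|rewrite z2 (le_trans z3 de)].
  apply: liftable_union => //; rewrite ?E; try exact: rect_closed.
    exact: hrect_connected.
  by exists (a, d); split; rewrite /= ?lexx.
(* The admissible thickness [dl] of a strip around height t depends on its base; the minimum serves
   for two adjacent bases, so [P] is additive. *)
pose P (a b : R) := exists2 dl : R, 0 < dl & forall c d, c <= t -> t <= d ->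
  t - dl < c -> d < t + dl -> liftable H (rect a b c d).
suff [dl dl0 Hdl] : P a b by exists dl.
move: a b ab; apply: cousin => [a b b' ab bb' [d1 d10 H1] [d2 d20 H2]|s].
  exists (Num.min d1 d2); first by rewrite lt_min d10.
  move=> c d ct td tc dt.
  have l1 : liftable H (rect a b c d).
    apply: H1 => //; first by rewrite (le_lt_trans _ tc)// lerB// ge_min lexx.
    by rewrite (lt_le_trans dt)// lerD2l ge_min lexx.
  have l2 : liftable H (rect b b' c d).
    apply: H2 => //; first by rewrite (le_lt_trans _ tc)// lerB// ge_min lexx orbT.
    by rewrite (lt_le_trans dt)// lerD2l ge_min lexx orbT.
  have -> : rect a b' c d = rect a b c d `|` rect b b' c d.
    apply/seteqP; split=> [z [/andP[z2 z3] z1]|z [[/andP[z2 z3] z1]|[/andP[z2 z3] z1]]].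
    - by have [zd|/ltW dz] := leP z.1 b; [left|right]; split=> //; apply/andP.
    - by split=> //; rewrite z2 (le_trans z3).
    - by split=> //; rewrite z3 (le_trans ab).
  have E : rect a b c d `&` rect b b' c d = rect b b c d.
    apply/seteqP; split=> [z [[/andP[z2 z3] z1] [/andP[z4 z5] _]]|z [/andP[z2 z3] z1]].
      by split=> //; rewrite z4 z3.
    by split; split=> //; [rewrite (le_trans ab z2)|rewrite z2 (le_trans z3 bb')].
  apply: liftable_union => //; rewrite ?E; try exact: rect_closed.
    exact: vrect_connected.
  by exists (b, t); split; rewrite /= ?lexx ?ct.
have [N Nz HN] := @liftable_local _ H (s, t) cH.
have [dl /= dl0 B] : exists2 dl : R, 0 < dl & ball (s, t) dl `<=` N by apply/nbhs_ballP.
exists dl => // a b as_ sb sa bs; exists dl => // c d ct td tc dt.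
apply: HN => z [/andP[az zb] /andP[cz zd]]; apply: B; split; rewrite -ball_normE /ball_ /= ltr_norml; apply/andP; split; lra.
Qed.

Let I : set R := `[0, 1]%classic.

Let Iin t : 0 <= t <= 1 -> I t. Proof. by rewrite /I /= in_itv. Qed.

Let I0 : I 0. Proof. by apply: Iin; rewrite lexx ler01. Qed.
Let I1 : I 1. Proof. by apply: Iin; rewrite lexx ler01. Qed.

Hypothesis path_connected : forall p q : M, exists g : R -> M,
  [/\ {within I, continuous g}, g 0 = p & g 1 = q].
Hypothesis null_homotopic : forall g : R -> M, {within I, continuous g} -> g 0 = g 1 ->
  exists H : R * R -> M,
    [/\ {within I `*` I, continuous H},
        forall t, I t -> H (0, t) = g t,
        forall t, I t -> H (1, t) = g 0
      & forall s, I s -> H (s, 0) = g 0 /\ H (s, 1) = g 0].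
Hypothesis locally_path_connected : forall (U : set M) q, open U -> U q ->
  \forall r \near q, exists b : R -> M,
    [/\ continuous b, b 0 = q, b 1 = r & forall t, I t -> U (b t)].

(** A path is lifted as a map of the square that ignores the first coordinate, so that rectangles
    are the only domains to subdivide. *)
Lemma path_lift (g : R -> M) U e : continuous g -> Adm U e -> U (g 0) ->
  exists2 x, is_lift g I x & x 0 = e (g 0).
Proof.
move=> cg aU Ug.
have cH : continuous (g \o snd : R * R -> M).
  move=> z; apply: continuous_comp; [exact: cvg_snd|exact: cg].
have [x lx x0] : exists2 x, is_lift (g \o snd) (rect 0 1 0 1) x & x (0, 0) = e (g 0).
  by apply: (rect_liftable cH ler01 ler01) aU _ => //; rewrite /rect /= !lexx ler01.
exists (fun t => x (0, t)) => //.
have cj : continuous (fun t : R => (0 : R, t)).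
  by apply: continuous_fun_pair => t; [exact: cvg_cst|exact: (@cvg_id _ (nbhs t))].
apply: is_liftW (is_lift_comp cj lx) => t.
by rewrite /I /= in_itv /rect /= lexx ler01.
Qed.

Let I_connected : connected I. Proof. exact: segment_connected. Qed.

Lemma lift_constant (T : topologicalType) (g : T -> M) (Q : set T) (x : T -> X) z p :
  continuous g -> connected Q -> is_lift g Q x -> Q z ->
  (forall t, Q t -> g t = p) -> forall t, Q t -> x t = x z.
Proof.
move=> cg cQ lx Qz gp; have [U [e [aU Uz xz]]] := lift_adm lx Qz.
apply: (lift_unique cg cQ lx _ Qz) => //.
move=> w Qw; exists U, e; split=> //; first by rewrite gp// -(gp z).
by apply: nearW => w' Qw'; rewrite xz !gp.
Qed.

(** Lift a null-homotopy of the loop to the square. Its left side carries x; the other three sides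
    are mapped to the base point, where a lift is constant, so the two ends of the left side have
    equal values. *)
Lemma loop_lift (g : R -> M) (x : R -> X) : continuous g -> g 0 = g 1 ->
  is_lift g I x -> x 0 = x 1.
Proof.
move=> cg g01 lx.
have [H [cH H0 H1 Hs]] := null_homotopic (continuous_subspaceT cg) g01.
pose K := H \o (fun z => (clamp z.1, clamp z.2)).
have cK : continuous K.
  apply: (within_comp cH) => [|z]; last by split; apply: Iin; exact: clamp01.
  apply: continuous_fun_pair => z.
    by apply: continuous_comp; [exact: cvg_fst|exact: clamp_continuous].
  by apply: continuous_comp; [exact: cvg_snd|exact: clamp_continuous].
have KE s t : I s -> I t -> K (s, t) = H (s, t).
  by rewrite /I /= !in_itv /= => ? ?; rewrite /K /= !clamp_id.
have [U [e [aU Ug xe]]] := lift_adm lx I0.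
have [y ly y0] : exists2 y, is_lift K (rect 0 1 0 1) y & y (0, 0) = e (K (0, 0)).
  apply: (rect_liftable cK ler01 ler01) aU _; first by rewrite /rect /= !lexx ler01.
  by rewrite KE// H0.
have cl (s : R) : continuous (fun t : R => (s, t)).
  by apply: continuous_fun_pair => t; [exact: cvg_cst|exact: (@cvg_id _ (nbhs t))].
have cb (t : R) : continuous (fun s : R => (s, t)).
  by apply: continuous_fun_pair => s; [exact: (@cvg_id _ (nbhs s))|exact: cvg_cst].
have ll s : I s -> is_lift (K \o (fun t => (s, t))) I (y \o (fun t => (s, t))).
  move=> Is; apply: is_liftW (is_lift_comp (cl s) ly) => t It.
  by move: Is It; rewrite /I /= !in_itv.
have lb t : I t -> is_lift (K \o (fun s => (s, t))) I (y \o (fun s => (s, t))).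
  move=> It; apply: is_liftW (is_lift_comp (cb t) ly) => s Is.
  by move: Is It; rewrite /I /= !in_itv.
have cKl s : continuous (K \o (fun t => (s, t))).
  by move=> t; apply: continuous_comp; [exact: cl|exact: cK].
have cKb t : continuous (K \o (fun s => (s, t))).
  by move=> s; apply: (@continuous_comp _ _ _ (fun s : R => (s, t)) K); [exact: cb|exact: cK].
have left_side : forall t, I t -> y (0, t) = x t.
  apply: (@lift_unique _ (K \o (fun t => (0, t))) I (y \o (fun t => (0, t))) x 0) => //.
  - exact: ll.
  - apply: is_lift_ext lx => t It; by rewrite /= KE// H0.
  - by rewrite /= y0 xe KE// H0.
have right_side : y (1, 1) = y (1, 0).
  apply: (@lift_constant _ (K \o (fun t => (1, t))) I (y \o (fun t => (1, t))) 0 (g 0)) => //.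
    exact: ll.
  by move=> t It; rewrite /= KE// H1.
have bottom : y (1, 0) = y (0, 0).
  apply: (@lift_constant _ (K \o (fun s => (s, 0))) I (y \o (fun s => (s, 0))) 0 (g 0)) => //.
    exact: lb.
  by move=> s Is; rewrite /= KE//; have [] := Hs s Is.
have top : y (1, 1) = y (0, 1).
  apply: (@lift_constant _ (K \o (fun s => (s, 1))) I (y \o (fun s => (s, 1))) 0 (g 0)) => //.
    exact: lb.
  by move=> s Is; rewrite /= KE//; have [] := Hs s Is.
by rewrite -!left_side// -bottom -right_side top.
Qed.

Let half_in t : I t -> I (t / 2).
Proof. by rewrite /I /= !in_itv /= => /andP[t0 t1]; apply/andP; split; lra. Qed.
Let half_in' t : I t -> I (1 - t / 2).
Proof. by rewrite /I /= !in_itv /= => /andP[t0 t1]; apply/andP; split; lra. Qed.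

(** Lift the loop that runs along g and returns along h. By uniqueness its first half reproduces x
    and its second half, read backwards, reproduces y; the lift closes up, and x 1 and y 1 are both
    its value at 1/2. *)
Lemma lift_endpoint (g h : R -> M) (x y : R -> X) : continuous g -> continuous h ->
  g 0 = h 0 -> g 1 = h 1 -> is_lift g I x -> is_lift h I y -> x 0 = y 0 -> x 1 = y 1.
Proof.
move=> cg ch gh0 gh1 lx ly xy0.
pose h' t := h (-1 * t + 1).
have ch' : continuous h'.
  by move=> t; apply: (@continuous_comp _ _ _ (fun s : R => -1 * s + 1) h); [exact: affine_continuous|exact: ch].
have gh' : g 1 = h' 0 by rewrite /h' mulr0 add0r.
pose L := path_cat g h'.
have cL : continuous L by exact: path_cat_continuous.
have [U [e [aU Ug xe]]] := lift_adm lx I0.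
have L0 : L 0 = g 0 by rewrite /L path_catl ?mulr0// divr_ge0.
have [z lz z0] : exists2 z, is_lift L I z & z 0 = e (L 0).
  by apply: (path_lift cL aU); rewrite L0.
have z01 : z 0 = z 1.
  apply: loop_lift lz => //; rewrite L0 /L path_catr//; last lra.
  by rewrite /h' gh0; congr h; lra.
have caff (a b : R) : continuous (fun t : R => a * t + b) by exact: affine_continuous.
have xz : forall t, I t -> z (2^-1 * t + 0) = x t.
  apply: (@lift_unique _ g I (z \o (fun t => 2^-1 * t + 0)) x 0) => //.
  - have H := is_lift_comp (caff 2^-1 0) lz.
    apply: is_lift_ext (is_liftW _ H) => t It.
      move: It; rewrite /I /= in_itv /= => /andP[t0 t1].
      rewrite addr0 /L path_catl; last lra.
      by congr g; lra.
    by rewrite /= addr0 mulrC; exact: half_in.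
  - by rewrite /= mulr0 addr0 z0 xe L0.
have yz : forall t, I t -> z ((- 2^-1) * t + 1) = y t.
  apply: (@lift_unique _ h I (z \o (fun t => (- 2^-1) * t + 1)) y 0) => //.
  - have H := is_lift_comp (caff (- 2^-1) 1) lz.
    apply: is_lift_ext (is_liftW _ H) => t It.
      move: It; rewrite /I /= in_itv /= => /andP[t0 t1].
      rewrite /L path_catr//; last lra.
      by rewrite /h'; congr h; lra.
    by rewrite /= mulNr addrC mulrC; exact: half_in'.
  - by rewrite /= mulr0 add0r -z01 z0 L0 -xe.
rewrite -xz// -yz//; congr z; lra.
Qed.

(** The value at q is obtained by continuing [e0] from [p0] along any path. Near q it is given by a
    single admissible map, because a path to q can be prolonged inside the domain of that map. *)
Theorem global_section : [set: M] !=set0 -> exists s : M -> X, forall q, exists U e,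
  [/\ Adm U e, U q & \forall r \near q, s r = e r].
Proof.
move=> [p0 _]; have [U0 [e0 [aU0 U0p]]] := adm_cover p0.
pose Rel (q : M) (v : X) := exists (g : R -> M) (x : R -> X), [/\ continuous g, g 0 = p0, g 1 = q, is_lift g I x & x 0 = e0 p0 /\ x 1 = v].
have RelE q : exists v, Rel q v.
  have [g [cg g0 g1]] := path_connected p0 q.
  have cg' : continuous (g \o @clamp R).
    by apply: (within_comp cg) => [|t]; [exact: clamp_continuous|apply: Iin; exact: clamp01].
  have [|x lx x0] := path_lift cg' aU0.
    by rewrite /= clamp_id ?lexx ?ler01// g0.
  exists (x 1), (g \o @clamp R), x; split=> //=; rewrite ?clamp_id ?lexx ?ler01//.
  by split=> //; rewrite x0 /= clamp_id ?lexx ?ler01// g0.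
have RelU q v v' : Rel q v -> Rel q v' -> v = v'.
  move=> [g [x [cg g0 g1 lx [x0 <-]]]] [h [y [ch h0 h1 ly [y0 <-]]]].
  by apply: (lift_endpoint cg ch _ _ lx ly); congruence.
have [s sP] := choice RelE.
exists s => q.
have [g [x [cg g0 g1 lx [x0 x1]]]] := sP q.
have [U [e [aU Ug xe]]] := lx 1 I1.
rewrite g1 in Ug.
have eq_ : s q = e q by rewrite -x1 -g1; exact: (nbhs_singleton xe I1).
exists U, e; split=> //.
have := locally_path_connected (adm_open aU) Ug; apply: filterS => r [b [cb b0 b1 bU]].
have gb : g 1 = b 0 by rewrite g1.
have cL : continuous (path_cat g b) by exact: path_cat_continuous.
apply: (RelU r) => //.
exists (path_cat g b), (path_cat x (e \o b)); split=> //.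
- by rewrite path_catl ?mulr0// divr_ge0.
- by rewrite path_catr//; [rewrite -b1; congr b; lra|lra].
(* Away from the junction t = 1/2 only one half of the path matters; at the junction [e] on [U]
   represents both halves. *)
- move=> t It; have [t12|t12|t12] := ltgtP t (1 / 2).
  + have It2 : I (2 * t + 0).
      by move: It; rewrite /I /= !in_itv /= => /andP[t0 t1]; apply/andP; split; lra.
    have [V [f [aV Vt xf]]] := lx _ It2; exists V, f; split=> //.
      by move: Vt; rewrite addr0 path_catl// ltW.
    have N1 : \forall t' \near t, t' < 1 / 2 by exact: lt_nbhsl.
    have N2 : \forall t' \near t, I (2 * t' + 0) -> x (2 * t' + 0) = f (g (2 * t' + 0)).
      exact: (@affine_continuous R 2 0 t _ xf).
    near=> t' => It'.
    have t'12 : t' < 1 / 2 by apply: (near N1 t').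
    have := near N2 t'; rewrite addr0 !path_catl ?(ltW t'12)//; apply => //.
    by move: It'; rewrite /I /= !in_itv /= => /andP[? ?]; apply/andP; split; lra.
  + exists U, e; split=> //.
      rewrite path_catr//; last exact: ltW.
      by apply: bU; move: It; rewrite /I /= !in_itv /= => /andP[? ?]; apply/andP; split; lra.
    have N1 : \forall t' \near t, 1 / 2 < t' by exact: lt_nbhsr.
    near=> t' => It'.
    have t'12 : 1 / 2 < t' by apply: (near N1 t').
    by rewrite /path_cat leNgt t'12.
  + exists U, e; split=> //; first by rewrite t12 path_catl// mul1r divff// g1.
    have N2 : \forall t' \near t, I (2 * t' + 0) -> x (2 * t' + 0) = e (g (2 * t' + 0)).
      apply: (@affine_continuous R 2 0 t [set u | I u -> x u = e (g u)]).
      by rewrite t12 addr0 mul1r divff.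
    near=> t' => It'; rewrite /path_cat; case: ifP => // t'12.
    have := near N2 t'; rewrite addr0; apply => //.
    by move: It'; rewrite /I /= !in_itv /= => /andP[? ?]; apply/andP; split; lra.
- split; first by rewrite path_catl ?mulr0// divr_ge0.
  rewrite path_catr /= ?g1 -?eq_ ?x1 ?b0//; last lra.
  by rewrite -b1; congr (e (b _)); lra.
Unshelve. all: by end_near. Qed.

End Monodromy.

(** * Null planes *)

Section InnerProduct.
Variables (R : realType) (m : nat).
Local Notation E := 'rV[R]_(m + 4).
Implicit Types (x y z : E) (k : R) (W : {vspace E}).

Lemma ipC x y : ip x y = ip y x.
Proof. by apply: eq_bigr => i _; rewrite mulrAC. Qed.

Lemma ipDl x y z : ip (x + y) z = ip x z + ip y z.
Proof. by rewrite /ip -big_split /=; apply: eq_bigr => i _; rewrite mxE mulrDr mulrDl. Qed.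

Lemma ipZl k x y : ip (k *: x) y = k * ip x y.
Proof.
rewrite /ip mulr_sumr; apply: eq_bigr => i _; rewrite mxE.
by rewrite mulrCA -!mulrA.
Qed.

Lemma ipDr x y z : ip x (y + z) = ip x y + ip x z.
Proof. by rewrite ipC ipDl !(ipC x). Qed.

Lemma ipZr k x y : ip x (k *: y) = k * ip x y.
Proof. by rewrite ipC ipZl ipC. Qed.

Lemma ipNl x y : ip (- x) y = - ip x y.
Proof. by rewrite -scaleN1r ipZl mulN1r. Qed.

Lemma ipNr x y : ip x (- y) = - ip x y.
Proof. by rewrite ipC ipNl ipC. Qed.

Lemma ip0l x : ip 0 x = 0.
Proof. by rewrite -(scale0r 0) ipZl mul0r. Qed.

Lemma ip0r x : ip x 0 = 0.
Proof. by rewrite ipC ip0l. Qed.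

Definition ipE := (ipDl, ipDr, ipNl, ipNr, ipZl, ipZr, ip0l, ip0r).

Lemma ip_suml I (r : seq I) (F : I -> E) y :
  ip (\sum_(i <- r) F i) y = \sum_(i <- r) ip (F i) y.
Proof.
elim: r => [|i r IH]; first by rewrite !big_nil ip0l.
by rewrite !big_cons ipDl IH.
Qed.

Lemma ip_sumr I (r : seq I) (F : I -> E) y :
  ip y (\sum_(i <- r) F i) = \sum_(i <- r) ip y (F i).
Proof. by rewrite ipC ip_suml; apply: eq_bigr => i _; rewrite ipC. Qed.

Fact timelike_index_proof (j : 'I_2) : (m + 2 + j < m + 4)%N.
Proof. by rewrite -addnA ltn_add2l (@ltn_add2l 2 j 2). Qed.
Definition timelike_index j : 'I_(m + 4) := Ordinal (timelike_index_proof j).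
Definition timelike_part x : 'rV[R]_2 := \row_j x 0 (timelike_index j).

Fact timelike_part_linear : linear timelike_part.
Proof. by move=> k x y; apply/rowP => j; rewrite !mxE. Qed.
HB.instance Definition _ := GRing.isLinear.Build R E 'rV[R]_2 _ timelike_part timelike_part_linear.

(** When the timelike part vanishes, the metric evaluated on x is a sum of squares. *)
Lemma null_timelike_eq0 x : ip x x = 0 -> timelike_part x = 0 -> x = 0.
Proof.
move=> xx x0.
have xt (i : 'I_(m + 4)) : (i < m + 2)%N = false -> x 0 i = 0.
  move=> im; have /rowP/(_ (inord (i - (m + 2)))) := x0; rewrite !mxE => <-.
  congr (x 0 _); apply: val_inj => /=; rewrite inordK; first by lia.
  by have := ltn_ord i; lia.
apply/rowP => i; rewrite [RHS]mxE.
case im : (i < m + 2)%N; last exact: xt.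
have : \sum_(i < m + 4) x 0 i * x 0 i = 0.
  rewrite -[RHS]xx; apply: eq_bigr => j _; case: ifP => jm; first by rewrite mul1r.
  by rewrite (xt j jm) !mulr0.
move/eqP; rewrite psumr_eq0 => [/allP/(_ i (mem_index_enum _))|j _]; last first.
  by rewrite -expr2 sqr_ge0.
by rewrite /= mulf_eq0 orbb => /eqP.
Qed.

(** The two timelike coordinates are injective on a totally null subspace; 2 is the number of minus
    signs of the metric. *)
Lemma totally_null_dim W : totally_null W -> (\dim W <= 2)%N.
Proof.
move=> nW; pose phi : 'Hom(E, 'rV[R]_2) := linfun timelike_part.
have W0 : (W :&: lker phi)%VS = 0%VS.
  apply/eqP; rewrite -subv0; apply/subvP => x; rewrite memv_cap memv_ker lfunE /= memv0.
  case/andP=> xW /eqP x0; apply/eqP; apply: null_timelike_eq0 => //; exact: nW.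
by rewrite -(limg_dim_eq W0) (leq_trans (dimvS (subvf _)))// dimvf /dim /= mul1n.
Qed.

Lemma totally_null_add W x : totally_null W -> ip x x = 0 ->
  (forall w, w \in W -> ip x w = 0) -> totally_null (W + <[x]>)%VS.
Proof.
move=> nW xx xW _ _ /memv_addP[w1 w1W [_ /vlineP[k1 ->] ->]] /memv_addP[w2 w2W [_ /vlineP[k2 ->] ->]].
by rewrite !ipE (nW _ _ w1W w2W) xx (ipC w1) !xW// !mulr0 !addr0.
Qed.

(** Adjoining x keeps the space totally null, so the dimension cannot exceed that of W. This is how
    orthogonality is turned into membership later on. *)
Lemma totally_null_maximal W x : totally_null W -> \dim W = 2%N -> ip x x = 0 ->
  (forall w, w \in W -> ip x w = 0) -> x \in W.
Proof.
move=> nW dW xx xW; have /totally_null_dim := totally_null_add nW xx xW.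
move=> dle.
have /eqP -> : (W == W + <[x]>)%VS by rewrite eqEdim addvSl dW.
by rewrite (subvP (addvSr _ _))// memv_line.
Qed.

(** A common non-zero vector x is orthogonal to the two distinct lines in which F meets W0 and W1,
    hence to F, hence lies in F by maximality; both lines are then spanned by x. *)
Lemma totally_null_disjoint F W0 W1 :
  totally_null F -> \dim F = 2%N -> totally_null W0 -> totally_null W1 ->
  \dim (F :&: W0) = 1%N -> \dim (F :&: W1) = 1%N -> (F :&: W0)%VS <> (F :&: W1)%VS ->
  (W0 :&: W1)%VS = 0%VS.
Proof.
move=> nF dF n0 n1 d0 d1 d01; apply/eqP; rewrite -subv0; apply/subvP => x.
rewrite memv_cap memv0 => /andP[x0 x1]; apply: contrapT => /negP xn0.
apply: d01.
have FE : F = ((F :&: W0) + (F :&: W1))%VS \/ (F :&: W0)%VS = (F :&: W1)%VS.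
  have [->|ne] := eqVneq (F :&: W0)%VS (F :&: W1)%VS; first by right.
  left; apply/esym/eqP; rewrite eqEdim subv_add !capvSl /= dF.
  have lt1 : (1 < \dim ((F :&: W0) + (F :&: W1)))%N; last by [].
  rewrite ltnNge; apply: contra ne => le1.
  have e0 : (F :&: W0 == (F :&: W0) + (F :&: W1))%VS by rewrite eqEdim addvSl d0.
  have e1 : (F :&: W1 == (F :&: W0) + (F :&: W1))%VS by rewrite eqEdim addvSr d1.
  by rewrite (eqP e0) {2}(eqP e1).
case: FE => // FE.
have xF : x \in F.
  apply: totally_null_maximal => //; first exact: n0.
  move=> w; rewrite FE => /memv_addP[a + [b + ->]].
  by rewrite !memv_cap => /andP[_ a0] /andP[_ b1]; rewrite ipDr (n0 x a)// (n1 x b)// addr0.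
have line W : x \in W -> \dim (F :&: W) = 1%N -> (F :&: W)%VS = <[x]>%VS.
  move=> xW dFW; apply/esym/eqP; rewrite eqEdim dim_vline xn0 dFW leqnn andbT.
  by apply/subvP => _ /vlineP[k ->]; rewrite memvZ// memv_cap xF.
exact: etrans (line _ x0 d0) (esym (line _ x1 d1)).
Qed.

(** The vectors a' and b' are dual to a and b: they show that a and b are independent and read off
    the coordinates of x. *)
Lemma dual_span W a b a' b' x : \dim W = 2%N -> a \in W -> b \in W ->
  ip a a' = 1 -> ip b a' = 0 -> ip a b' = 0 -> ip b b' = 1 -> x \in W ->
  x = ip x a' *: a + ip x b' *: b.
Proof.
move=> dW aW bW aa ba ab bb.
have -> : W = <<[:: a; b]>>%VS.
  apply/esym/eqP; rewrite eqEdim dW; apply/andP; split.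
    by apply/span_subvP => y; rewrite !inE => /orP[] /eqP ->.
  suff /eqP -> : free [:: a; b] by [].
  apply/(@freeP _ _ _ [tuple a; b]) => k; rewrite !big_ord_recl big_ord0 /= addr0 => k0 i.
  have E1 : k ord0 = 0.
    by have := congr1 (fun z => ip z a') k0; rewrite /= !ipE aa ba mulr0 mulr1 addr0.
  have E2 : k (lift ord0 ord0) = 0.
    by have := congr1 (fun z => ip z b') k0; rewrite /= !ipE ab bb mulr0 mulr1 add0r.
  case: i => [[|[|//]] ?]; [rewrite -[RHS]E1|rewrite -[RHS]E2]; congr k; exact: val_inj.
rewrite span_cons span_seq1 => /memv_addP[_ /vlineP[k ->] [_ /vlineP[l ->] ->]].
by rewrite !ipE aa ba ab bb !mulr0 !mulr1 addr0 add0r.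
Qed.

End InnerProduct.

(** * The two rulings of the null planes of R^{2,2} *)

Section Rulings.
Variables (R : realType) (m : nat).
Local Notation E := 'rV[R]_(m + 4).
Local Notation b0 := (delta_mx 0 0 : 'rV[R]_2)%R.
Local Notation b1 := (delta_mx 0 1 : 'rV[R]_2)%R.
Implicit Types (e : 'I_4 -> E) (u w : 'rV[R]_2) (x y : E).

Definition o0 : 'I_4 := @Ordinal 4 0 isT.
Definition o1 : 'I_4 := @Ordinal 4 1 isT.
Definition o2 : 'I_4 := @Ordinal 4 2 isT.
Definition o3 : 'I_4 := @Ordinal 4 3 isT.

Lemma forall_ord4 (P : 'I_4 -> Prop) : P o0 -> P o1 -> P o2 -> P o3 -> forall i, P i.
Proof.
move=> P0 P1 P2 P3 [[|[|[|[|//]]]] Hi].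
- by rewrite (_ : Ordinal Hi = o0)//; exact: val_inj.
- by rewrite (_ : Ordinal Hi = o1)//; exact: val_inj.
- by rewrite (_ : Ordinal Hi = o2)//; exact: val_inj.
- by rewrite (_ : Ordinal Hi = o3)//; exact: val_inj.
Qed.

Lemma sum_ord4 (V : nmodType) (F : 'I_4 -> V) :
  \sum_i F i = F o0 + F o1 + F o2 + F o3.
Proof.
rewrite !big_ord_recl big_ord0 addr0 !addrA.
by do !congr (_ + _); congr F; exact: val_inj.
Qed.

Lemma sum_ord2 (V : nmodType) (F : 'I_2 -> V) : \sum_i F i = F 0 + F 1.
Proof.
by rewrite !big_ord_recl big_ord0 addr0; do !congr (_ + _); congr F; exact: val_inj.
Qed.

(** Two hyperbolic pairs, e0 with e3 and e1 with e2, orthogonal to each other. In the adapted frames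
    e0, e1 span f0, e0, e2 span fh0 and e1, e3 span fh1. *)
Definition witt e := forall i j : 'I_4, ip (e i) (e j) = (i + j == 3)%N%:R.

Definition det2 u w : R := u 0 0 * w 0 1 - u 0 1 * w 0 0.

(* With [e] a Witt basis, the isomorphism of R^{2,2} with R^2 (x) R^2, under which
   the metric becomes, up to sign, the product of the two area forms. *)
Definition tens e u w : E :=
  (u 0 0 * w 0 0) *: e o0 + (u 0 0 * w 0 1) *: e o1
  + (u 0 1 * w 0 0) *: e o2 - (u 0 1 * w 0 1) *: e o3.

(** Exchanging e1 and e2 exchanges the two tensor factors, so that the second ruling is the first
    one for [swap12 e]. *)
Definition swap12 e : 'I_4 -> E := fun i =>
  if i == o1 then e o2 else if i == o2 then e o1 else e i.

Lemma wittE e : witt e ->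
  ((ip (e o0) (e o0) = 0) * (ip (e o0) (e o1) = 0) * (ip (e o0) (e o2) = 0) * (ip (e o0) (e o3) = 1) *
   (ip (e o1) (e o0) = 0) * (ip (e o1) (e o1) = 0) * (ip (e o1) (e o2) = 1) * (ip (e o1) (e o3) = 0) *
   (ip (e o2) (e o0) = 0) * (ip (e o2) (e o1) = 1) * (ip (e o2) (e o2) = 0) * (ip (e o2) (e o3) = 0) *
   (ip (e o3) (e o0) = 1) * (ip (e o3) (e o1) = 0) * (ip (e o3) (e o2) = 0) * (ip (e o3) (e o3) = 0))%type.
Proof. by move=> We; rewrite !We. Qed.

Lemma wittP e :
  ip (e o0) (e o0) = 0 -> ip (e o0) (e o1) = 0 -> ip (e o0) (e o2) = 0 -> ip (e o0) (e o3) = 1 ->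
  ip (e o1) (e o1) = 0 -> ip (e o1) (e o2) = 1 -> ip (e o1) (e o3) = 0 ->
  ip (e o2) (e o2) = 0 -> ip (e o2) (e o3) = 0 -> ip (e o3) (e o3) = 0 -> witt e.
Proof.
move=> *; apply: forall_ord4; apply: forall_ord4 => //; by rewrite ipC.
Qed.

Lemma witt_swap12 e : witt e -> witt (swap12 e).
Proof. by move=> We; apply: wittP; rewrite /swap12 /= wittE. Qed.

Lemma tens_swap12 e u w : tens (swap12 e) u w = tens e w u.
Proof.
rewrite /tens /swap12 /= -!(mulrC (w 0 _)) -!addrA; congr (_ + _).
by rewrite addrCA.
Qed.

(** The minus sign before e3 in [tens] is what makes the metric split; every decomposable tensor is
    therefore null. *)
Lemma ip_tens e u w u' w' : witt e ->
  ip (tens e u w) (tens e u' w') = det2 u u' * det2 w' w.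
Proof. by move=> We; rewrite /tens /det2 !ipE !wittE//; ring. Qed.

Lemma tensDr e u w w' : tens e u (w + w') = tens e u w + tens e u w'.
Proof. by apply/rowP => i; rewrite !mxE; ring. Qed.

Lemma tensZr e u k w : tens e u (k *: w) = k *: tens e u w.
Proof. by apply/rowP => i; rewrite !mxE; ring. Qed.

Lemma tensZl e u k w : tens e (k *: u) w = k *: tens e u w.
Proof. by apply/rowP => i; rewrite !mxE; ring. Qed.

Lemma det2C u w : det2 u w = - det2 w u.
Proof. by rewrite /det2; ring. Qed.

Lemma det2_id u : det2 u u = 0.
Proof. by rewrite /det2 mulrC subrr. Qed.

Lemma row2P u w : u 0 0 = w 0 0 -> u 0 1 = w 0 1 -> u = w.
Proof.
move=> H0 H1; apply/rowP => -[[|[|//]] Hi].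
  by rewrite (_ : Ordinal Hi = 0)//; exact: val_inj.
by rewrite (_ : Ordinal Hi = 1)//; exact: val_inj.
Qed.

Lemma row2_neq0 u : u != 0 -> u 0 0 != 0 \/ u 0 1 != 0.
Proof.
move=> un0; have [u0|] := eqVneq (u 0 0) 0; last by left.
have [u1|] := eqVneq (u 0 1) 0; last by right.
by case/eqP: un0; apply: row2P; rewrite ?u0 ?u1 mxE.
Qed.

Lemma det2_eq0 u w : u != 0 -> det2 u w = 0 -> exists k, w = k *: u.
Proof.
move=> un0; rewrite /det2 => /eqP; rewrite subr_eq0 => /eqP uw.
have [u0|u1] := row2_neq0 un0.
  exists (w 0 0 / u 0 0); apply: row2P; rewrite !mxE; first by rewrite divfK.
  by rewrite mulrAC mulrC -(mulrC (u 0 1)) -uw mulrA mulVf ?mul1r.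
exists (w 0 1 / u 0 1); apply: row2P; rewrite !mxE; last by rewrite divfK.
by rewrite mulrAC mulrC -(mulrC (u 0 0)) uw mulrA mulVf ?mul1r.
Qed.

Lemma det2_neq0 u : u != 0 -> exists w, det2 u w != 0.
Proof.
move=> /row2_neq0[u0|u1].
  exists (delta_mx 0 1); rewrite /det2 !mxE !eqxx /=.
  by rewrite mulr1 mulr0 subr0.
exists (delta_mx 0 0); rewrite /det2 !mxE !eqxx /=.
by rewrite mulr1 mulr0 sub0r oppr_eq0.
Qed.

Definition ruling e u : {vspace E} :=
  <<[:: tens e u b0; tens e u b1]>>%VS.

Lemma rulingP e u x : reflect (exists w, x = tens e u w) (x \in ruling e u).
Proof.
rewrite /ruling span_cons span_seq1; apply: (iffP memv_addP).
  move=> [_ /vlineP[k ->] [_ /vlineP[l ->] ->]].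
  exists (k *: b0 + l *: b1).
  by rewrite tensDr !tensZr.
move=> [w ->]; exists (w 0 0 *: tens e u b0); first by rewrite memvZ// memv_line.
exists (w 0 1 *: tens e u b1); first by rewrite memvZ// memv_line.
rewrite -!tensZr -tensDr [in LHS](row_sum_delta w) sum_ord2.
by [].
Qed.

Lemma mem_ruling e u w : tens e u w \in ruling e u.
Proof. by apply/rulingP; exists w. Qed.

Lemma mem_ruling_swap12 e u w : tens e u w \in ruling (swap12 e) w.
Proof. by rewrite -tens_swap12 mem_ruling. Qed.

Lemma ruling_swap12P e w x : reflect (exists u, x = tens e u w) (x \in ruling (swap12 e) w).
Proof.
by apply: (iffP (rulingP _ _ _)) => -[u ->]; exists u; rewrite tens_swap12.
Qed.

Section Witt.
Variable e : 'I_4 -> E.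
Hypothesis We : witt e.

Lemma tens_eq0 u w : u != 0 -> tens e u w = 0 -> w = 0.
Proof.
move=> /det2_neq0[a ua] T0; apply/eqP; apply: contraT => /det2_neq0[b wb].
have := ip_tens u w a b We; rewrite T0 ip0l => /esym/eqP.
by rewrite mulf_eq0 (negPf ua) det2C oppr_eq0 (negPf wb).
Qed.

Lemma free_tens u : u != 0 -> free [:: tens e u b0; tens e u b1].
Proof.
move=> un0; apply/(@freeP _ _ _ [tuple tens e u b0; tens e u b1]) => k.
rewrite sum_ord2 /= -!tensZr -tensDr => /(tens_eq0 un0)/rowP k0 i.
have := k0 i; rewrite !mxE eqxx /=; case: i => [[|[|//]] Hi] /=.
  rewrite mulr1 mulr0 addr0 => <-; congr k; exact: val_inj.
rewrite mulr1 mulr0 add0r => <-; congr k; exact: val_inj.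
Qed.

Lemma dim_ruling u : u != 0 -> \dim (ruling e u) = 2%N.
Proof. by move=> /free_tens/eqP. Qed.

Lemma ruling_null u : totally_null (ruling e u).
Proof.
by move=> _ _ /rulingP[w ->] /rulingP[w' ->]; rewrite ip_tens// det2_id mul0r.
Qed.

Lemma ruling_inj u u' : u != 0 -> u' != 0 -> ruling e u = ruling e u' ->
  exists k, u' = k *: u.
Proof.
move=> un0 u'n0 eq_; apply: det2_eq0 => //.
have [w wd] : exists w, det2 w b0 != 0.
  have [|w] := @det2_neq0 b0.
    by apply/eqP => /rowP/(_ 0)/eqP; rewrite !mxE eqxx oner_eq0.
  by exists w; rewrite det2C oppr_eq0.
have /rulingP[w' E1] : tens e u b0 \in ruling e u' by rewrite -eq_ mem_ruling.
have := ip_tens u b0 u' w We; rewrite E1 ip_tens// det2_id mul0r.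
by move/esym/eqP; rewrite mulf_eq0 (negPf wd) orbF => /eqP.
Qed.

Lemma ruling_cap u w : u != 0 -> w != 0 ->
  (ruling e u :&: ruling (swap12 e) w)%VS = <[tens e u w]>%VS.
Proof.
move=> un0 wn0; apply/vspaceP => x; apply/idP/idP; last first.
  move=> /vlineP[k ->]; rewrite memvZ// memv_cap mem_ruling.
  by rewrite -tens_swap12 mem_ruling.
rewrite memv_cap => /andP[/rulingP[w' ->] /ruling_swap12P[u' E1]].
have [a ua] := det2_neq0 un0.
have := ip_tens u w' a w We; rewrite E1 ip_tens// det2_id mulr0 => /esym/eqP.
rewrite mulf_eq0 (negPf ua) /= => /eqP/(det2_eq0 wn0)[k wk].
by rewrite -E1 wk tensZr memvZ// memv_line.
Qed.

(** Write x as u (x) w1 + u1 (x) w. Pairing with u (x) b, for b independent of w, forces u1 to be a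
    multiple of u; pairing with a (x) w, for a independent of u, forces w1 to be a multiple of w. *)
Lemma ruling_sum_radical u w x : u != 0 -> w != 0 ->
  x \in (ruling e u + ruling (swap12 e) w)%VS ->
  (forall w', ip x (tens e u w') = 0) -> (forall u', ip x (tens e u' w) = 0) ->
  x \in (ruling e u :&: ruling (swap12 e) w)%VS.
Proof.
move=> un0 wn0 /memv_addP[_ /rulingP[w1 ->] [_ /ruling_swap12P[u1 ->] ->]] H1 H2.
have [b wb] := det2_neq0 wn0; have [a ua] := det2_neq0 un0.
have /eqP := H1 b; rewrite ipDl !ip_tens// det2_id mul0r add0r mulf_eq0.
rewrite (det2C b) oppr_eq0 (negPf wb) orbF det2C oppr_eq0 => /eqP/(det2_eq0 un0)[k ->].
have /eqP := H2 a; rewrite ipDl !ip_tens// det2_id mulr0 addr0 mulf_eq0 (negPf ua) /=.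
move=> /eqP/(det2_eq0 wn0)[l ->].
by rewrite tensZr tensZl -scalerDl memvZ// ruling_cap// memv_line.
Qed.

(** The factor k is there because the generator chosen for a point of [RP1] is known only up to
    scale. *)
Lemma ruling_delta0 (F : {vspace E}) k : k != 0 -> \dim F = 2%N -> e o0 \in F -> e o1 \in F ->
  ruling e (k *: b0) = F.
Proof.
move=> k0 dF F0 F1.
have d0 : (k *: b0 : 'rV[R]_2) != 0.
  by rewrite scaler_eq0 negb_or k0; apply/eqP => /rowP/(_ 0)/eqP; rewrite !mxE eqxx oner_eq0.
apply/eqP; rewrite eqEdim dim_ruling// dF leqnn andbT.
apply/subvP => _ /rulingP[w ->]; rewrite /tens !mxE /= !mulr0 !mul0r !scale0r subr0 addr0.
by apply: memvD; exact: memvZ.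
Qed.

Lemma ruling_delta1 (F : {vspace E}) k : k != 0 -> \dim F = 2%N -> e o2 \in F -> e o3 \in F ->
  ruling e (k *: b1) = F.
Proof.
move=> k0 dF F0 F1.
have d0 : (k *: b1 : 'rV[R]_2) != 0.
  by rewrite scaler_eq0 negb_or k0; apply/eqP => /rowP/(_ 1)/eqP; rewrite !mxE eqxx oner_eq0.
apply/eqP; rewrite eqEdim dim_ruling// dF leqnn andbT.
apply/subvP => _ /rulingP[w ->]; rewrite /tens !mxE /= !mulr0 !mul0r !scale0r !add0r.
by apply: memvB; exact: memvZ.
Qed.

End Witt.
End Rulings.

(** * Calculus on manifolds *)

Section Manifold.
Variables (R : realType) (m : nat) (M : manifold R m).
Implicit Types (c : chart R m M) (U : set M) (f g h : M -> R) (p q : M) (v w : 'rV[R]_m).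

Definition chart_image c U := chart_map c @` (U `&` chart_dom c).

Lemma chart_map_for c p : chart_dom c p -> {for p, continuous (chart_map c)}.
Proof.
move=> cp; have /subspace_continuousP/(_ p cp) := @chart_map_cont _ _ _ c.
by rewrite within_interior//; rewrite /interior; apply: open_nbhs_nbhs; split => //; exact: chart_dom_open.
Qed.

Lemma chart_inv_for c x : (chart_map c @` chart_dom c) x -> {for x, continuous (chart_inv c)}.
Proof.
move=> cx; have /subspace_continuousP/(_ x cx) := @chart_inv_cont _ _ _ c.
by rewrite within_interior//; rewrite /interior; apply: open_nbhs_nbhs; split => //; exact: chart_im_open.
Qed.

Lemma chart_imageP c U x : chart_image c U x <->
  [/\ chart_dom c (chart_inv c x), U (chart_inv c x) & chart_map c (chart_inv c x) = x].
Proof.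
split=> [[p [Up cp] <-]|[cx Ux xx]]; first by rewrite chart_mapK.
by exists (chart_inv c x).
Qed.

Lemma chart_image_open c U : open U -> open (chart_image c U).
Proof.
move=> oU; rewrite openE => x cUx.
have [cx Ux xx] := (chart_imageP c U x).1 cUx.
have imx : (chart_map c @` chart_dom c) x by exists (chart_inv c x).
have N1 : \forall y \near x, (chart_map c @` chart_dom c) y.
  by apply: open_nbhs_nbhs; split => //; exact: chart_im_open.
have N2 : \forall y \near x, U (chart_inv c y).
  by apply: (chart_inv_for imx); exact: open_nbhs_nbhs.
have : nbhs x ((chart_map c @` chart_dom c) `&` [set y | U (chart_inv c y)]) by exact: filterI.
apply: filterS => y [[q cq <-] /= Uq].
by exists q => //; split => //; rewrite -(chart_mapK cq).
Qed.

Lemma chart_image_mem c U p : U p -> chart_dom c p -> chart_image c U (chart_map c p).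
Proof. by move=> Up cp; exists p. Qed.

Lemma chart_image_sub c U U' : U `<=` U' -> chart_image c U `<=` chart_image c U'.
Proof. by move=> UU' _ [p [Up cp] <-]; exists p => //; split => //; exact: UU'. Qed.

Definition ssmooth U f := forall c, atlas c -> forall k, sCk k (chart_image c U) (f \o chart_inv c).

Lemma smooth_onP n U (s : M -> 'rV[R]_n) : open U ->
  smooth_on U s <-> forall i, ssmooth U (fun p => s p 0 i).
Proof.
move=> oU; split=> [ss i c ac k|ss c ac k].
  by have /(CkP _ _ (chart_image_open (c := c) oU))/(_ i) := ss c ac k.
by apply/(CkP _ _ (chart_image_open (c := c) oU)) => i; exact: ss.
Qed.

Lemma smooth_on_coord n U (s : M -> 'rV[R]_n) i : open U -> smooth_on U s -> ssmooth U (fun p => s p 0 i).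
Proof. by move=> oU /(smooth_onP _ oU). Qed.

Lemma ssmooth_sub U U' f : U `<=` U' -> ssmooth U' f -> ssmooth U f.
Proof. by move=> UU' sf c ac k; apply: sCk_sub (sf c ac k); exact: chart_image_sub. Qed.

Lemma ssmooth_ext U f g : open U -> (forall p, U p -> f p = g p) -> ssmooth U f -> ssmooth U g.
Proof.
move=> oU fg sf c ac k; apply: sCk_ext (sf c ac k); first exact: chart_image_open.
by move=> x /chart_imageP[_ Ux _]; exact: fg.
Qed.

Lemma ssmoothD U f g : open U -> ssmooth U f -> ssmooth U g -> ssmooth U (fun p => f p + g p).
Proof.
by move=> oU sf sg c ac k; apply: (sCkD (chart_image_open (c := c) oU)); [exact: sf|exact: sg].
Qed.

Lemma ssmoothM U f g : open U -> ssmooth U f -> ssmooth U g -> ssmooth U (fun p => f p * g p).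
Proof.
by move=> oU sf sg c ac k; apply: (sCkM (chart_image_open (c := c) oU)); [exact: sf|exact: sg].
Qed.

Lemma ssmooth_cst U (a : R) : ssmooth U (fun=> a).
Proof. by move=> c ac k; exact: sCk_cst. Qed.

Lemma ssmoothN U f : open U -> ssmooth U f -> ssmooth U (fun p => - f p).
Proof. by move=> oU sf c ac k; apply: (sCkN (chart_image_open (c := c) oU)); exact: sf. Qed.

Lemma ssmooth_sum U n (f : 'I_n -> M -> R) : open U -> (forall i, ssmooth U (f i)) ->
  ssmooth U (fun p => \sum_i f i p).
Proof.
by move=> oU sf c ac k; apply: (sCk_sum (chart_image_open (c := c) oU)) => i; exact: sf.
Qed.

Lemma ssmoothV U f : open U -> (forall p, U p -> f p != 0) -> ssmooth U f ->
  ssmooth U (fun p => (f p)^-1).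
Proof.
move=> oU f0 sf c ac k; apply: (sCkV (chart_image_open (c := c) oU)); last exact: sf.
by move=> x /chart_imageP[_ Ux _]; exact: f0.
Qed.

Lemma ssmooth_expR U f : open U -> ssmooth U f -> ssmooth U (fun p => expR (f p)).
Proof. by move=> oU sf c ac k; apply: (sCk_expR (chart_image_open (c := c) oU)); exact: sf. Qed.

Lemma sCk_local k (A : set 'rV[R]_m) (f : 'rV[R]_m -> R) :
  (forall x, A x -> exists2 B, B x & sCk k B f) -> sCk k A f.
Proof.
elim: k f => [|k IH] f H /=; first by move=> x /H[B Bx]; exact.
split=> [x /H[B Bx [df _]]|v]; first exact: df.
apply: IH => x /H[B Bx [_ Df]]; exists B => //; exact: Df.
Qed.

Lemma ssmooth_local U f : (forall p, U p -> exists2 U', U' p & ssmooth U' f) -> ssmooth U f.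
Proof.
move=> H c ac k; apply: sCk_local => x /chart_imageP[cx Ux xx].
have [U' U'x sf] := H _ Ux; exists (chart_image c U'); last exact: sf.
by apply/chart_imageP.
Qed.

Lemma smooth_on_local n U (s : M -> 'rV[R]_n) : open U ->
  (forall p, U p -> exists U', [/\ open U', U' p & smooth_on U' s]) -> smooth_on U s.
Proof.
move=> oU H; apply/(smooth_onP _ oU) => i; apply: ssmooth_local => p /H[U' [oU' U'p ss]].
by exists U' => //; exact: smooth_on_coord.
Qed.

Lemma smooth_on_sub n U U' (s : M -> 'rV[R]_n) : U `<=` U' -> smooth_on U' s -> smooth_on U s.
Proof.
move=> UU' ss c ac k; have := ss c ac k.
elim: k (s \o chart_inv c) => [|k IH] F /=.
  by move=> cF x Ux; apply: cF; exact: (chart_image_sub UU').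
move=> [dF DF]; split=> [x Ux|v]; first by apply: dF; exact: (chart_image_sub UU').
exact: IH.
Qed.

Lemma smooth_on_ext n U (s s' : M -> 'rV[R]_n) : open U -> (forall p, U p -> s p = s' p) ->
  smooth_on U s -> smooth_on U s'.
Proof.
move=> oU ss' /(smooth_onP _ oU) H; apply/(smooth_onP _ oU) => i.
by apply: ssmooth_ext (H i) => // p /ss' ->.
Qed.

Lemma smooth_onD n U (s t : M -> 'rV[R]_n) : open U -> smooth_on U s -> smooth_on U t ->
  smooth_on U (fun p => s p + t p).
Proof.
move=> oU /(smooth_onP _ oU) Hs /(smooth_onP _ oU) Ht; apply/(smooth_onP _ oU) => i.
by apply: ssmooth_ext (ssmoothD oU (Hs i) (Ht i)) => // p _; rewrite mxE.
Qed.

Lemma smooth_onZ n U f (s : M -> 'rV[R]_n) : open U -> ssmooth U f -> smooth_on U s ->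
  smooth_on U (fun p => f p *: s p).
Proof.
move=> oU Hf /(smooth_onP _ oU) Hs; apply/(smooth_onP _ oU) => i.
by apply: ssmooth_ext (ssmoothM oU Hf (Hs i)) => // p _; rewrite mxE.
Qed.

Lemma smooth_onZc n U (k : R) (s : M -> 'rV[R]_n) : open U -> smooth_on U s ->
  smooth_on U (fun p => k *: s p).
Proof. by move=> oU ss; apply: smooth_onZ => //; exact: ssmooth_cst. Qed.

Lemma smooth_onN n U (s : M -> 'rV[R]_n) : open U -> smooth_on U s -> smooth_on U (fun p => - s p).
Proof.
move=> oU ss; apply: smooth_on_ext (smooth_onZc (-1) oU ss) => // p _.
by rewrite scaleN1r.
Qed.

Lemma smooth_on_cst n U (a : 'rV[R]_n) : open U -> smooth_on U (fun=> a).
Proof. by move=> oU; apply/(smooth_onP _ oU) => i; exact: ssmooth_cst. Qed.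

Lemma smooth_on_sum n U I (r : seq I) (s : I -> M -> 'rV[R]_n) : open U ->
  (forall i, smooth_on U (s i)) -> smooth_on U (fun p => \sum_(i <- r) s i p).
Proof.
move=> oU Hs; elim: r => [|i r IH].
  by apply: smooth_on_ext (@smooth_on_cst n U 0 oU) => // p _; rewrite big_nil.
by apply: smooth_on_ext (smooth_onD oU (Hs i) IH) => // p _; rewrite big_cons.
Qed.

Lemma ssmooth_ip U (s t : M -> 'rV[R]_(m + 4)) : open U -> smooth_on U s -> smooth_on U t ->
  ssmooth U (fun p => ip (s p) (t p)).
Proof.
move=> oU Hs Ht; apply: ssmooth_sum => // i; apply: ssmoothM => //; last exact: smooth_on_coord.
by apply: ssmoothM => //; [exact: ssmooth_cst|exact: smooth_on_coord].
Qed.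

(** On a set inside one chart domain that chart suffices: any other differs from it by a smooth
    change of coordinates. *)
Lemma ssmooth_chart U c f : open U -> atlas c -> U `<=` chart_dom c ->
  (forall k, sCk k (chart_image c U) (f \o chart_inv c)) -> ssmooth U f.
Proof.
move=> oU ac Uc sf c' ac' k.
have oI := chart_image_open (c := c') oU.
apply: (@sCk_ext _ _ _ _ ((f \o chart_inv c) \o (chart_map c \o chart_inv c'))) => //.
  move=> x /chart_imageP[c'x Ux xx] /=.
  by rewrite chart_mapK//; exact: Uc.
apply: (sCk_comp (B := chart_image c U)) => //.
  move=> x /chart_imageP[c'x Ux xx] /=; apply: chart_image_mem => //; exact: Uc.
apply/(CkP _ _ oI) => i.
apply: (@sCk_sub _ _ _ (chart_map c' @` (chart_dom c' `&` chart_dom c))).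
  move=> x /chart_imageP[c'x Ux xx]; exists (chart_inv c' x) => //; split => //; exact: Uc.
have := @atlas_compat _ _ M c' c ac' ac k.
have oI' : open (chart_map c' @` (chart_dom c' `&` chart_dom c)).
  by rewrite setIC; apply: (@chart_image_open c' (chart_dom c)); exact: chart_dom_open.
by move/(CkP _ _ oI').
Qed.

Lemma ssmooth_near U f p : open U -> ssmooth U f -> U p -> {for p, continuous f}.
Proof.
move=> oU sf Up; have [c ac cp] := atlas_cover p.
have cf : {for chart_map c p, continuous (f \o chart_inv c)}.
  by apply: (sf c ac 0%N); exact: chart_image_mem.
have H : {for p, continuous ((f \o chart_inv c) \o chart_map c)}.
  by apply: continuous_comp => //; exact: chart_map_for.
have E : {near p, (f \o chart_inv c) \o chart_map c =1 f}.
  have : nbhs p (chart_dom c) by apply: open_nbhs_nbhs; split=> //; exact: chart_dom_open.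
  by apply: filterS => q cq /=; rewrite chart_mapK.
rewrite /prop_for /continuous_at -(nbhs_singleton E).
exact: cvg_trans (near_eq_cvg E) H.
Qed.

Lemma ssmooth_neq0 U f p : open U -> ssmooth U f -> U p -> f p != 0 ->
  exists U', [/\ open U', U' p, U' `<=` U & forall q, U' q -> f q != 0].
Proof.
move=> oU sf Up fp.
have N1 : \forall q \near p, f q != 0.
  have N0 : nbhs (f p) [set y : R | y != 0] by apply: open_nbhs_nbhs; split => //; exact: open_neq.
  exact: (ssmooth_near oU sf Up N0).
have N : nbhs p (U `&` [set q | f q != 0]) by apply: filterI => //; exact: open_nbhs_nbhs.
exists (U `&` [set q | f q != 0])^°; split.
- exact: open_interior.
- exact: N.
- by move=> q /interior_subset[].
- by move=> q /interior_subset[].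
Qed.

End Manifold.

(** * Derivatives of functions and sections in a chart *)

Section ManifoldDeriv.
Variables (R : realType) (m : nat) (M : manifold R m).
Implicit Types (c : chart R m M) (U : set M) (f g h : M -> R) (p q : M) (v w : 'rV[R]_m).

Definition sderiv c v f : M -> R := fun p => 'D_v (f \o chart_inv c) (chart_map c p).

Lemma ssmooth_differentiable c U f p : ssmooth U f -> atlas c -> U p -> chart_dom c p ->
  differentiable (f \o chart_inv c) (chart_map c p).
Proof. by move=> sf ac Up cp; have [+ _] := sf c ac 1%N; apply; exact: chart_image_mem. Qed.

Lemma smooth_on_differentiable c n U (s : M -> 'rV[R]_n) p : smooth_on U s -> atlas c ->
  U p -> chart_dom c p -> differentiable (s \o chart_inv c) (chart_map c p).
Proof. by move=> ss ac Up cp; have [+ _] := ss c ac 1%N; apply; exact: chart_image_mem. Qed.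

Lemma near_chart_inv c U p (P : M -> Prop) : open U -> U p -> chart_dom c p ->
  (forall q, U q -> P q) -> \forall x \near chart_map c p, P (chart_inv c x).
Proof.
move=> oU Up cp UP; have : nbhs (chart_map c p) (chart_image c U).
  by apply: open_nbhs_nbhs; split; [exact: chart_image_open|exact: chart_image_mem].
by apply: filterS => x /chart_imageP[_ Ux _]; exact: UP.
Qed.

Lemma sderiv_ext c v U f g p : open U -> U p -> chart_dom c p ->
  (forall q, U q -> f q = g q) -> sderiv c v f p = sderiv c v g p.
Proof.
move=> oU Up cp fg; apply: near_eq_derive.
exact: (near_chart_inv oU Up cp fg).
Qed.

Lemma chart_deriv_ext c v n U (s t : M -> 'rV[R]_n) p : open U -> U p -> chart_dom c p ->
  (forall q, U q -> s q = t q) -> chart_deriv c v s p = chart_deriv c v t p.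
Proof.
move=> oU Up cp st; apply: near_eq_derive.
exact: (near_chart_inv oU Up cp st).
Qed.

Lemma sderiv_cst c v (a : R) p : sderiv c v (fun=> a) p = 0.
Proof. exact: derive_cst. Qed.

Section AtPoint.
Variables (c : chart R m M) (U : set M) (p : M) (v : 'rV[R]_m).
Hypotheses (ac : atlas c) (oU : open U) (Up : U p) (cp : chart_dom c p).

Let dff f : ssmooth U f -> derivable (f \o chart_inv c) (chart_map c p) v.
Proof. by move=> sf; apply: diff_derivable; exact: (ssmooth_differentiable sf). Qed.

Lemma sderivD f g : ssmooth U f -> ssmooth U g ->
  sderiv c v (fun q => f q + g q) p = sderiv c v f p + sderiv c v g p.
Proof. by move=> sf sg; exact: (deriveD (dff sf) (dff sg)). Qed.

Lemma sderivN f : ssmooth U f -> sderiv c v (fun q => - f q) p = - sderiv c v f p.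
Proof. by move=> sf; exact: (deriveN (dff sf)). Qed.

Lemma sderivM f g : ssmooth U f -> ssmooth U g ->
  sderiv c v (fun q => f q * g q) p = sderiv c v f p * g p + f p * sderiv c v g p.
Proof.
move=> sf sg; have := deriveM (dff sf) (dff sg).
rewrite /= chart_mapK// addrC => E; rewrite (mulrC (sderiv _ _ _ _)).
exact: E.
Qed.

Lemma sderiv_expR f : ssmooth U f ->
  sderiv c v (fun q => expR (f q)) p = sderiv c v f p * expR (f p).
Proof.
move=> sf; rewrite /sderiv.
have := @derive_expR_comp _ _ (f \o chart_inv c) (chart_map c p) v (ssmooth_differentiable sf ac Up cp).
by rewrite /= chart_mapK.
Qed.

Lemma sderiv_sum n (f : 'I_n -> M -> R) : (forall i, ssmooth U (f i)) ->
  sderiv c v (fun q => \sum_i f i q) p = \sum_i sderiv c v (f i) p.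
Proof.
elim: n f => [|n IH] f sf.
  rewrite big_ord0 -[RHS](sderiv_cst c v 0 p).
  by apply: (sderiv_ext v oU Up cp) => q _; rewrite big_ord0.
rewrite big_ord_recr /= -IH// -sderivD//; last by apply: ssmooth_sum.
by apply: (sderiv_ext v oU Up cp) => q _; rewrite big_ord_recr.
Qed.

Lemma chart_deriv_coord n (s : M -> 'rV[R]_n) i : smooth_on U s ->
  (chart_deriv c v s p) 0 i = sderiv c v (fun q => s q 0 i) p.
Proof.
move=> ss; rewrite /chart_deriv derive_coord//.
by apply: diff_derivable; exact: (smooth_on_differentiable ss).
Qed.

Lemma chart_derivD n (s t : M -> 'rV[R]_n) : smooth_on U s -> smooth_on U t ->
  chart_deriv c v (fun q => s q + t q) p = chart_deriv c v s p + chart_deriv c v t p.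
Proof.
move=> ss st; apply/rowP => i; rewrite mxE !chart_deriv_coord//; last exact: smooth_onD.
rewrite -sderivD; [|exact: smooth_on_coord|exact: smooth_on_coord].
by apply: (sderiv_ext v oU Up cp) => q _; rewrite mxE.
Qed.

Lemma chart_derivZ n f (s : M -> 'rV[R]_n) : ssmooth U f -> smooth_on U s ->
  chart_deriv c v (fun q => f q *: s q) p = sderiv c v f p *: s p + f p *: chart_deriv c v s p.
Proof.
move=> sf ss; apply/rowP => i; rewrite !mxE !chart_deriv_coord//; last exact: smooth_onZ.
rewrite -sderivM//; last exact: smooth_on_coord.
by apply: (sderiv_ext v oU Up cp) => q _; rewrite mxE.
Qed.

Lemma chart_derivZc n (k : R) (s : M -> 'rV[R]_n) : smooth_on U s ->
  chart_deriv c v (fun q => k *: s q) p = k *: chart_deriv c v s p.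
Proof.
move=> ss; rewrite chart_derivZ//; last exact: ssmooth_cst.
by rewrite sderiv_cst scale0r add0r.
Qed.

Lemma chart_deriv_sum n k (s : 'I_k -> M -> 'rV[R]_n) : (forall i, smooth_on U (s i)) ->
  chart_deriv c v (fun q => \sum_i s i q) p = \sum_i chart_deriv c v (s i) p.
Proof.
move=> ss; apply/rowP => j; rewrite chart_deriv_coord; last exact: smooth_on_sum.
rewrite summxE; under eq_bigr do rewrite chart_deriv_coord//.
rewrite -sderiv_sum; last by move=> i; exact: smooth_on_coord.
by apply: (sderiv_ext v oU Up cp) => q _; rewrite summxE.
Qed.

Lemma sderiv_ip (s t : M -> 'rV[R]_(m + 4)) : smooth_on U s -> smooth_on U t ->
  sderiv c v (fun q => ip (s q) (t q)) p =
  ip (chart_deriv c v s p) (t p) + ip (s p) (chart_deriv c v t p).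
Proof.
move=> ss st; rewrite /ip sderiv_sum; last first.
  move=> i; apply: ssmoothM => //; last exact: smooth_on_coord.
  by apply: ssmoothM => //; [exact: ssmooth_cst|exact: smooth_on_coord].
rewrite -big_split /=; apply: eq_bigr => i _.
rewrite sderivM; [|apply: ssmoothM => //; [exact: ssmooth_cst|exact: smooth_on_coord]|exact: smooth_on_coord].
rewrite sderivM; [|exact: ssmooth_cst|exact: smooth_on_coord].
by rewrite sderiv_cst mul0r add0r !chart_deriv_coord.
Qed.

Lemma chart_deriv_linear n (s : M -> 'rV[R]_n) : smooth_on U s ->
  chart_deriv c v s p = \sum_i v 0 i *: chart_deriv c (delta_mx 0 i) s p.
Proof. by move=> ss; exact: (derive_linear_sum v (smooth_on_differentiable ss ac Up cp)). Qed.

(** The vector v of the chart c is pushed forward to c0 by the change of charts. What is proved in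
    one chart for all vectors then holds in every chart. *)
Lemma chart_deriv_change c0 n (s : M -> 'rV[R]_n) : atlas c0 -> chart_dom c0 p -> smooth_on U s ->
  chart_deriv c v s p = chart_deriv c0 ('D_v (chart_map c0 \o chart_inv c) (chart_map c p)) s p.
Proof.
move=> ac0 c0p ss; rewrite /chart_deriv.
have E : chart_map c0 p = (chart_map c0 \o chart_inv c) (chart_map c p) by rewrite /= chart_mapK.
rewrite [in RHS]E -derive_comp.
- apply: near_eq_derive.
  have oU' : open (U `&` chart_dom c0) by apply: openI => //; exact: chart_dom_open.
  apply: (@near_chart_inv c (U `&` chart_dom c0) p (fun q => s q = (s \o chart_inv c0) (chart_map c0 q))) => //.
  by move=> q [Uq c0q] /=; rewrite chart_mapK.
- have [+ _] := atlas_compat ac ac0 1%N; apply.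
  by exists p.
- by rewrite -E; exact: (smooth_on_differentiable ss).
Qed.

End AtPoint.

Lemma sderiv_smooth c U v f : open U -> atlas c -> U `<=` chart_dom c -> ssmooth U f ->
  ssmooth U (sderiv c v f).
Proof.
move=> oU ac Uc sf; apply: (ssmooth_chart oU ac Uc) => k.
have [_ /(_ v)] := sf c ac k.+1; apply: sCk_ext; first exact: chart_image_open.
by move=> x /chart_imageP[_ _ xx]; rewrite /sderiv /= xx.
Qed.

Lemma chart_deriv_smooth c n U v (s : M -> 'rV[R]_n) : open U -> atlas c -> U `<=` chart_dom c ->
  smooth_on U s -> smooth_on U (chart_deriv c v s).
Proof.
move=> oU ac Uc ss; apply/(smooth_onP _ oU) => i.
apply: ssmooth_ext (sderiv_smooth v oU ac Uc (smooth_on_coord i oU ss)) => //.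
by move=> p Up; rewrite (chart_deriv_coord v ac Up)//; exact: Uc.
Qed.

Lemma sderiv_comm c U v w f p : open U -> atlas c -> U `<=` chart_dom c -> ssmooth U f -> U p ->
  sderiv c v (sderiv c w f) p = sderiv c w (sderiv c v f) p.
Proof.
move=> oU ac Uc sf Up; have cp := Uc p Up.
have oI := chart_image_open (c := c) oU.
have key u1 u2 : sderiv c u1 (sderiv c u2 f) p =
    'D_u1 (fun x => 'D_u2 (f \o chart_inv c) x) (chart_map c p).
  apply: near_eq_derive; have : nbhs (chart_map c p) (chart_image c U).
    by apply: open_nbhs_nbhs; split => //; exact: chart_image_mem.
  by apply: filterS => x /chart_imageP[_ _ xx]; rewrite /sderiv /= xx.
rewrite !key; apply: (schwarz _ _ oI (chart_image_mem Up cp)); exact: (sf c ac 2%N).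
Qed.

Lemma chart_ball_pullback c U (x : 'rV[R]_m) (r : R) : open U -> ball x r `<=` chart_image c U ->
  exists U', [/\ open U', U' `<=` U, U' `<=` chart_dom c, chart_image c U' = ball x r
    & forall q, U' q <-> [/\ U q, chart_dom c q & ball x r (chart_map c q)]].
Proof.
move=> oU B; exists [set q | [/\ U q, chart_dom c q & ball x r (chart_map c q)]].
split=> //; try by move=> q [].
- rewrite openE => q [Uq cq Bq].
  have N1 : nbhs q U by exact: open_nbhs_nbhs.
  have N2 : nbhs q (chart_dom c) by apply: open_nbhs_nbhs; split=> //; exact: chart_dom_open.
  have N3 : nbhs q [set q' | ball x r (chart_map c q')].
    by apply: (chart_map_for cq); apply: open_nbhs_nbhs; split => //; exact: ball_open.
  have : nbhs q (U `&` (chart_dom c `&` [set q' | ball x r (chart_map c q')])).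
    by apply: filterI => //; exact: filterI.
  by apply: filterS => q' [? [? ?]].
- apply/seteqP; split=> [_ [q [[Uq _ Bq] cq] <-]//|y By].
  have /chart_imageP[cy Uy yy] := B y By.
  by exists (chart_inv c y) => //; split => //; split => //; rewrite yy.
Qed.

Lemma chart_ball_nbhs c U p : open U -> U p -> chart_dom c p ->
  exists U' r, [/\ open U', U' `<=` U, U' `<=` chart_dom c, U' p & 0 < r] /\
    chart_image c U' = ball (chart_map c p) r.
Proof.
move=> oU Up cp; have : nbhs (chart_map c p) (chart_image c U).
  by apply: open_nbhs_nbhs; split; [exact: chart_image_open|exact: chart_image_mem].
move=> /nbhs_ballP[r /= r0 B].
have [U' [oU' U'U U'c E U'P]] := chart_ball_pullback oU B.
exists U', r; split=> //; split=> //.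
by apply/U'P; split=> //; exact: ballxx.
Qed.

Lemma sderiv0_constant c U f x r : atlas c -> U `<=` chart_dom c ->
  chart_image c U = ball x r -> ssmooth U f ->
  (forall q v, U q -> sderiv c v f q = 0) -> forall p q, U p -> U q -> f p = f q.
Proof.
move=> ac Uc E sf f0.
have H : forall y, ball x r y -> (f \o chart_inv c) y = (f \o chart_inv c) x.
  apply: derive0_constant => y; rewrite -E => -[q [Uq cq] <-]; split.
    exact: (ssmooth_differentiable sf).
  by move=> v; exact: f0.
have K q : U q -> f q = (f \o chart_inv c) x.
  move=> Uq; have cq := Uc q Uq.
  by rewrite -(H (chart_map c q)) /= ?chart_mapK// -E; exact: chart_image_mem.
by move=> p q Up Uq; rewrite !K.
Qed.

Lemma manifold_poincare c U p (b : 'rV[R]_m -> M -> R) : atlas c -> open U ->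
  U `<=` chart_dom c -> U p ->
  (forall v, ssmooth U (b v)) ->
  (forall v q, U q -> b v q = \sum_i v 0 i * b (delta_mx 0 i) q) ->
  (forall v w q, U q -> sderiv c w (b v) q = sderiv c v (b w) q) ->
  exists U' h, [/\ open U', U' `<=` U, U' p, ssmooth U' h
    & forall q v, U' q -> sderiv c v h q = b v q].
Proof.
move=> ac oU Uc Up sb lb cb; have cp := Uc p Up.
have [|||r r0 [B [h [sh Dh]]]] := @poincare R m (chart_image c U) (chart_map c p)
  (fun v => b v \o chart_inv c) (chart_image_open oU) (chart_image_mem Up cp).
- by move=> x v /chart_imageP[_ Ux _] /=; exact: lb.
- by move=> v k; exact: sb.
- move=> x v w /chart_imageP[cx Ux xx]; have := cb v w _ Ux.
  by rewrite /sderiv xx.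
have [U' [oU' U'U U'c E U'P]] := chart_ball_pullback oU B.
have U'p : U' p by apply/U'P; split=> //; exact: ballxx.
exists U', (h \o chart_map c); split=> //.
  apply: (ssmooth_chart oU' ac U'c) => k; rewrite E.
  apply: sCk_ext (sh k); first exact: ball_open.
  by move=> x; rewrite -E => /chart_imageP[_ _ xx] /=; rewrite xx.
move=> q v U'q; have cq := U'c q U'q.
have Bq : ball (chart_map c p) r (chart_map c q) by rewrite -E; exact: chart_image_mem.
have := Dh _ Bq v; rewrite /= chart_mapK// => <-.
apply: near_eq_derive; have : nbhs (chart_map c q) (ball (chart_map c p) r).
  by apply: open_nbhs_nbhs; split => //; exact: ball_open.
by apply: filterS => x; rewrite -E => /chart_imageP[_ _ xx] /=; rewrite xx.
Qed.

(** Straight segments in a chart ball around q; [clamp] keeps them inside the ball for all real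
    parameters. *)
Lemma manifold_locally_path_connected U q : open U -> U q ->
  \forall r \near q, exists b : R -> M,
    [/\ continuous b, b 0 = q, b 1 = r & forall t, `[0, 1]%classic t -> U (b t)].
Proof.
move=> oU Uq; have [c ac cq] := atlas_cover q.
have [U' [d [[oU' U'U U'c U'q d0] E]]] := chart_ball_nbhs oU Uq cq.
have : nbhs q U' by exact: open_nbhs_nbhs.
apply: filterS => r U'r; have cr := U'c r U'r.
pose l t := chart_map c q + clamp t *: (chart_map c r - chart_map c q).
have Bl t : ball (chart_map c q) d (l t).
  apply: ball_segment; [exact: ballxx| |exact: clamp01].
  by rewrite -E; exact: chart_image_mem.
have Il t : (chart_map c @` chart_dom c) (l t).
  by have := Bl t; rewrite -E => -[s [_ cs] <-]; exists s.
exists (chart_inv c \o l); split=> /=.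
- move=> t; apply: continuous_comp; last exact: chart_inv_for.
  apply: continuousD; first exact: cst_continuous.
  apply: (@continuousZr_tmp R 'rV[R]_m R (@clamp R) (chart_map c r - chart_map c q) t).
  exact: clamp_continuous.
- by rewrite /l clamp_id ?lexx ?ler01// scale0r addr0 chart_mapK.
- by rewrite /l clamp_id ?lexx ?ler01// scale1r subrKC chart_mapK.
- by move=> t _; have := Bl t; rewrite -E => /chart_imageP[_ /U'U].
Qed.

End ManifoldDeriv.

(** * Parallel frames *)

Section Ribaucour.
Variables (R : realType) (m : nat) (M : manifold R m).
Local Notation E := 'rV[R]_(m + 4).
Local Notation planes := (M -> {vspace E}).
Implicit Types (F G W : planes) (s t : M -> E) (c : chart R m M) (U : set M) (p q : M) (v w : 'rV[R]_m).

Lemma subbundle_section k W p y : subbundle k W -> y \in W p ->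
  exists U s, [/\ open U, U p, section U W s & s p = y].
Proof.
move=> [dW /(_ p)[U [oU Up [e [se be]]]]] yW.
exists U, (fun q => \sum_(i < k) coord [tuple e i p | i < k] i y *: e i q); split=> //.
  split.
    by apply: smooth_on_sum => // i; exact: smooth_onZc.
  move=> q Uq; apply: memv_suml => i _; apply: memvZ.
  by apply: (basis_mem (be q Uq)); rewrite -[e i q](tnth_mktuple (fun i => e i q)) mem_tnth.
rewrite [RHS](coord_basis (be p Up) yW); apply: eq_bigr => i _.
by rewrite -tnth_nth tnth_mktuple.
Qed.

Lemma section_sub U U' W s : U' `<=` U -> section U W s -> section U' W s.
Proof. by move=> UU' [ss sW]; split; [exact: smooth_on_sub ss|move=> q /UU'; exact: sW]. Qed.

(** The Legendre condition involves only the value at p of its second section, and any vector of F p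
    extends to a local section. *)
Lemma legendre_pt F U s c v p y : legendre F -> open U -> section U F s -> atlas c ->
  U p -> chart_dom c p -> y \in F p -> ip (chart_deriv c v s p) y = 0.
Proof.
move=> [sF _ LF] oU sec ac Up cp yF.
have [U' [t [oU' U'p tF <-]]] := subbundle_section sF yF.
have oI : open (U `&` U') by exact: openI.
apply: (LF (U `&` U')) => //.
- by apply: section_sub sec => q [].
- by apply: section_sub tF => q [].
Qed.

(** The plane F is spanned by its intersection with G and by x, and y is orthogonal to both. *)
Lemma null_pair_cap (F G : {vspace E}) (x : E) : totally_null F -> \dim F = 2%N -> totally_null G ->
  \dim (F :&: G) = 1%N -> x \in F -> x \notin G ->
  forall y : E, y \in G -> ip x y = 0 -> y \in F.
Proof.
move=> nF dF nG dFG xF xG y yG xy.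
have FE : F = (F :&: G + <[x]>)%VS.
  have xFG : x \notin (F :&: G)%VS by rewrite memv_cap negb_and xG orbT.
  apply/esym/eqP; rewrite eqEdim subv_add capvSl /= -memvE xF dF.
  have [d1|//] := leqP (\dim (F :&: G + <[x]>)) 1.
  have /eqP E1 : (F :&: G == F :&: G + <[x]>)%VS by rewrite eqEdim addvSl dFG.
  by case/negP: xFG; rewrite E1 (subvP (addvSr _ _))// memv_line.
apply: totally_null_maximal => //; first exact: nG.
move=> w; rewrite FE => /memv_addP[a + [_ /vlineP[k ->] ->]].
by rewrite memv_cap => /andP[_ aG]; rewrite !ipE (nG y a)// (ipC y x) xy mulr0 addr0.
Qed.

(** By maximality of the null plane G p, a null vector outside it is not orthogonal to it. A vector
    of G p with non-zero pairing is extended to a section and divided by the pairing. *)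
Lemma pick_dual G U s p : subbundle 2 G -> (forall q, totally_null (G q)) ->
  open U -> U p -> smooth_on U s -> ip (s p) (s p) = 0 -> s p \notin G p ->
  exists U' t, [/\ open U', U' `<=` U, U' p, section U' G t & forall q, U' q -> ip (s q) (t q) = 1].
Proof.
move=> sG nG oU Up ss sp0 sG'.
have [y yG ipy] : exists2 y, y \in G p & ip (s p) y != 0.
  apply: contrapT => H; case/negP: sG'; apply: totally_null_maximal => //.
    by have [dG _] := sG.
  move=> w wG; apply/eqP; apply: contraT => sw; exfalso; apply: H; by exists w.
have [U1 [t [oU1 U1p [st tG] tp]]] := subbundle_section sG yG.
have oU2 : open (U `&` U1) by exact: openI.
have ss2 : smooth_on (U `&` U1) s by apply: smooth_on_sub ss => q [].
have st2 : smooth_on (U `&` U1) t by apply: smooth_on_sub st => q [].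
have [||U' [oU' U'p U'U n0]] := @ssmooth_neq0 _ _ _ _ _ p oU2 (ssmooth_ip oU2 ss2 st2).
- by split.
- by rewrite tp.
exists U', (fun q => (ip (s q) (t q))^-1 *: t q); split=> //.
- by move=> q /U'U[].
- split.
    apply: smooth_onZ => //; last by exact: smooth_on_sub st2.
    apply: ssmoothV => //; apply: ssmooth_ip => //; exact: smooth_on_sub U'U _.
  by move=> q /U'U[_ U1q]; apply: memvZ; exact: tG.
- by move=> q U'q; rewrite ipZr mulVf// n0.
Qed.

(** The class of s spans a null line of the quotient, which a metric connection in signature (1,1)
    preserves: nabla s = b s for a 1-form b. The curvature is db, so b = dh locally and exp(-h) s is
    parallel. *)
Lemma ribaucour_normalize F G U s p : ribaucour_pair F G -> open U -> U p ->
  section U F s -> (forall q, U q -> s q \notin G q) ->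
  exists U' h, [/\ open U', U' `<=` U, U' p, ssmooth U' h &
    forall c v q y, atlas c -> U' q -> chart_dom c q -> y \in (F q + G q)%VS ->
      ip (chart_deriv c v (fun r => expR (- h r) *: s r) q) y = 0].
Proof.
move=> [LF LG dFG [[[dcap _] _] _ _] flat] oU Up sF nsG.
have [sbF nF _] := LF; have [sbG nG _] := LG.
have [dF _] := sbF; have [dG _] := sbG.
have [sm sFq] := sF.
have [U1 [t [oU1 U1U U1p [st tG] st1]]] := pick_dual sbG nG oU Up sm
  (nF p _ _ (sFq p Up) (sFq p Up)) (nsG p Up).
have [c ac cp] := atlas_cover p.
have [U2 [r [[oU2 U2U1 U2c U2p r0] E]]] := chart_ball_nbhs oU1 U1p cp.
have U2U : U2 `<=` U by move=> q /U2U1/U1U.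
have sF2 : section U2 F s by apply: section_sub sF.
have sm2 : smooth_on U2 s by case: sF2.
have st2 : smooth_on U2 t by exact: smooth_on_sub st.
pose b v q := ip (chart_deriv c v s q) (t q).
have sb v : ssmooth U2 (b v).
  by apply: ssmooth_ip => //; exact: chart_deriv_smooth.
(* Against F this is the Legendre condition and nullity. A vector of G is split into its part along
   t, where b is chosen to fit, and a part orthogonal to s, which lies in F by [null_pair_cap]. *)
have perp v q y : U2 q -> y \in (F q + G q)%VS -> ip (chart_deriv c v s q - b v q *: s q) y = 0.
  move=> U2q.
  have HF x : x \in F q -> ip (chart_deriv c v s q - b v q *: s q) x = 0.
    move=> xF; rewrite !ipE (legendre_pt v LF oU2 sF2 ac U2q (U2c q U2q) xF).
    by rewrite (nF q _ _ (sFq q (U2U q U2q)) xF) mulr0 subr0.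
  move=> /memv_addP[x xF [z zG ->]]; rewrite ipDr HF// add0r.
  rewrite -(subrK (ip (s q) z *: t q) z) ipDr HF ?add0r.
    by rewrite ipZr ipDl ipNl ipZl (st1 q (U2U1 q U2q)) mulr1 -/(b v q) subrr mulr0.
  have sq := sFq q (U2U q U2q).
  apply: (null_pair_cap (nF q) (dF q) (nG q) (dcap q) sq (nsG q (U2U q U2q))).
    by rewrite memvB// memvZ// tG//; exact: U2U1.
  by rewrite ipDr ipNr ipZr (st1 q (U2U1 q U2q)) mulr1 subrr.
have sW2 : section U2 (sum_bundle F G) s.
  by split=> // q U2q; rewrite (subvP (addvSl _ _))// sFq//; exact: U2U.
have smu v : section U2 (sum_bundle F G) (fun q => b v q *: s q).
  split; first exact: smooth_onZ.
  by move=> q U2q; apply: memvZ; exact: sW2.2.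
have cov v : covariant_deriv (sum_bundle F G) c v U2 s (fun q => b v q *: s q).
  move=> q U2q; split; first exact: (smu v).2.
  by move=> y yW; exact: perp.
have cov2 v w : covariant_deriv (sum_bundle F G) c v U2 (fun q => b w q *: s q)
    (fun q => (sderiv c v (b w) q + b w q * b v q) *: s q).
  move=> q U2q; split; first by apply: memvZ; exact: sW2.2.
  move=> y yW; rewrite (chart_derivZ v ac oU2 U2q (U2c q U2q) (sb w) sm2).
  by rewrite scalerDl -scalerA opprD addrACA subrr add0r -scalerBr ipZl perp// mulr0.
(* The products of b v and b w cancel, leaving a multiple of s in the intersection of F and G; since
   s lies outside G, the factor vanishes. *)
have closed_b v w q : U2 q -> sderiv c w (b v) q = sderiv c v (b w) q.
  move=> U2q.
  move: (flat c ac U2 oU2 U2c w v s _ _ _ _ sW2 (smu w) (smu v) (cov w) (cov v)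
    (cov2 w v) (cov2 v w) q U2q) (nsG q (U2U q U2q)).
  rewrite /cap_bundle; move: (sderiv c w (b v) q) (sderiv c v (b w) q) (b v q) (b w q) (s q).
  move=> A B x y z H zG; apply/eqP; rewrite -subr_eq0; apply: contraT => n0.
  case/negP: zG; move: H; rewrite -scalerBl (mulrC y) opprD addrACA subrr addr0.
  by rewrite rpredZeq (negPf n0) memv_cap => /andP[].
have lin_b v q : U2 q -> b v q = \sum_i v 0 i * b (delta_mx 0 i) q.
  move=> U2q; rewrite /b (chart_deriv_linear v ac U2q (U2c q U2q) sm2) ip_suml.
  by apply: eq_bigr => i _; rewrite ipZl.
have [U3 [h [oU3 U3U2 U3p sh Dh]]] := manifold_poincare ac oU2 U2c U2p sb lin_b closed_b.
exists U3, h; split=> //; first by move=> q /U3U2/U2U.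
move=> c' v q y ac' U3q c'q yW.
have cq := U2c q (U3U2 q U3q).
have sm3 : smooth_on U3 s by exact: smooth_on_sub sm2.
have snh : ssmooth U3 (fun r => - h r) by exact: ssmoothN.
have sE : ssmooth U3 (fun r => expR (- h r)) by exact: ssmooth_expR.
have sEs : smooth_on U3 (fun r => expR (- h r) *: s r) by exact: smooth_onZ.
(* The form b lives in the chart [c], so the derivative is first carried over to it. *)
rewrite (chart_deriv_change v ac' oU3 U3q c'q ac cq sEs).
move: ('D_v _ _) => u.
rewrite (chart_derivZ u ac oU3 U3q cq sE sm3) (sderiv_expR u ac U3q cq snh) (sderivN u ac U3q cq sh) Dh//.
rewrite mulNr mulrC scaleNr -scalerA addrC -scalerBr ipZl perp ?mulr0//; exact: U3U2.
Qed.

End Ribaucour.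

(** * Local parallel frames adapted to f0, fh0 and fh1 *)

Section AdaptedFrames.
Variables (R : realType) (m : nat) (M : manifold R m).
Local Notation E := 'rV[R]_(m + 4).
Variables (f0 fh0 fh1 : M -> {vspace E}).
Implicit Types (c : chart R m M) (U : set M) (p q : M) (v w : 'rV[R]_m) (e : M -> 'I_4 -> E).

Definition mk4 (a b x y : E) : 'I_4 -> E := fun i =>
  match val i with 0%N => a | 1%N => b | 2%N => x | _ => y end.

(* In V = fh0 + fh1 the frame is parallel: each derivative is orthogonal to V. *)
Record parallel_frame U e : Prop := ParallelFrame {
  pf_smooth : forall i, smooth_on U (fun q => e q i);
  pf_witt : forall q, U q -> witt (e q);
  pf_f0 : forall q, U q -> e q o0 \in f0 q /\ e q o1 \in f0 q;
  pf_fh0 : forall q, U q -> e q o0 \in fh0 q /\ e q o2 \in fh0 q;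
  pf_fh1 : forall q, U q -> e q o1 \in fh1 q /\ e q o3 \in fh1 q;
  pf_parallel : forall i j c v q, atlas c -> U q -> chart_dom c q ->
    ip (chart_deriv c v (fun r => e r i) q) (e q j) = 0 }.

(** The domain is a chart ball, on which a function with zero derivative is constant; hence
    uniqueness from the value at one point. *)
Definition adapted U e : Prop :=
  [/\ open U, exists c x r, [/\ atlas c, U `<=` chart_dom c & chart_image c U = ball x r]
    & parallel_frame U e].

Hypothesis rib0 : ribaucour_pair f0 fh0.
Hypothesis rib1 : ribaucour_pair f0 fh1.
Hypothesis distinct : pointwise_distinct (cap_bundle f0 fh0) (cap_bundle f0 fh1).
Hypothesis flatV : flat_bundle (sum_bundle fh0 fh1).

Let L0 : legendre f0. Proof. by case: rib0. Qed.
Let Lh0 : legendre fh0. Proof. by case: rib0. Qed.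
Let Lh1 : legendre fh1. Proof. by case: rib1. Qed.
Let n0 q : totally_null (f0 q). Proof. by case: L0. Qed.
Let nh0 q : totally_null (fh0 q). Proof. by case: Lh0. Qed.
Let nh1 q : totally_null (fh1 q). Proof. by case: Lh1. Qed.
Let d0 q : \dim (f0 q) = 2%N. Proof. by case: L0 => -[]. Qed.
Let dh0 q : \dim (fh0 q) = 2%N. Proof. by case: Lh0 => -[]. Qed.
Let dh1 q : \dim (fh1 q) = 2%N. Proof. by case: Lh1 => -[]. Qed.
Let s0 : subbundle 1 (cap_bundle f0 fh0). Proof. by case: rib0 => _ _ _ [[]]. Qed.
Let s1 : subbundle 1 (cap_bundle f0 fh1). Proof. by case: rib1 => _ _ _ [[]]. Qed.

Lemma fh_disjoint q : (fh0 q :&: fh1 q)%VS = 0%VS.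
Proof.
apply: (totally_null_disjoint (n0 (q := q)) (d0 q) (nh0 (q := q)) (nh1 (q := q))).
- by have [H _] := s0; exact: H.
- by have [H _] := s1; exact: H.
- exact: distinct.
Qed.

Lemma notin_fh q x : x != 0 -> (x \in fh0 q -> x \notin fh1 q) /\ (x \in fh1 q -> x \notin fh0 q).
Proof.
move=> xn0; split=> xin; apply: contra xn0 => xin'; rewrite -memv0 -(fh_disjoint q) memv_cap.
  by rewrite xin.
by rewrite xin'.
Qed.

Lemma vline_neq0_section (W : M -> {vspace E}) p : subbundle 1 W -> exists U (s : M -> E),
  [/\ open U, U p, section U W s & forall q, U q -> s q != 0].
Proof.
move=> [dW /(_ p)[U [oU Up [s [ss bs]]]]]; exists U, (s ord0); split=> //.
  split=> // q Uq; apply: (basis_mem (bs q Uq)).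
  by rewrite -[s ord0 q](tnth_mktuple (fun i => s i q)) mem_tnth.
move=> q Uq; have /basis_free/free_not0 := bs q Uq; apply.
by rewrite -[s ord0 q](tnth_mktuple (fun i => s i q)) mem_tnth.
Qed.

(** A section a of s0 lies outside fh1, so it is the pair (f0, fh1) that normalises it; likewise
    (f0, fh0) normalises a section b of s1. Orthogonality of the derivative to the other half of V
    is the Legendre condition on fh0, which contains a, respectively on fh1, which contains b. *)
Lemma parallel_spheres p : exists U (s t : M -> E), [/\ open U, U p,
  [/\ section U f0 s, section U fh0 s, section U f0 t & section U fh1 t],
  forall q, U q -> s q != 0 /\ t q != 0 &
  forall c v q y, atlas c -> U q -> chart_dom c q -> y \in (fh0 q + fh1 q)%VS ->
    ip (chart_deriv c v s q) y = 0 /\ ip (chart_deriv c v t q) y = 0].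
Proof.
have [U1 [a [oU1 U1p [sa a01] an0]]] := vline_neq0_section p s0.
have [U2 [b [oU2 U2p [sb b01] bn0]]] := vline_neq0_section p s1.
have a0 q : U1 q -> a q \in f0 q /\ a q \in fh0 q.
  by move=> /a01; rewrite /cap_bundle memv_cap => /andP.
have b0 q : U2 q -> b q \in f0 q /\ b q \in fh1 q.
  by move=> /b01; rewrite /cap_bundle memv_cap => /andP.
have a1 q : U1 q -> a q \notin fh1 q.
  by move=> U1q; apply: (notin_fh q (an0 q U1q)).1; exact: (a0 q U1q).2.
have b1 q : U2 q -> b q \notin fh0 q.
  by move=> U2q; apply: (notin_fh q (bn0 q U2q)).2; exact: (b0 q U2q).2.
have [|U3 [h [oU3 U3U1 U3p sh Hh]]] := ribaucour_normalize rib1 oU1 U1p (s := a) _ a1.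
  by split=> // q U1q; exact: (a0 q U1q).1.
have [|U4 [k [oU4 U4U2 U4p sk Hk]]] := ribaucour_normalize rib0 oU2 U2p (s := b) _ b1.
  by split=> // q U2q; exact: (b0 q U2q).1.
have oU : open (U3 `&` U4) by exact: openI.
have sUa : smooth_on (U3 `&` U4) (fun r => expR (- h r) *: a r).
  apply: smooth_onZ => //; last by apply: smooth_on_sub sa => q [/U3U1].
  by apply: ssmooth_expR => //; apply: ssmoothN => //; apply: ssmooth_sub sh => q [].
have sUb : smooth_on (U3 `&` U4) (fun r => expR (- k r) *: b r).
  apply: smooth_onZ => //; last by apply: smooth_on_sub sb => q [_ /U4U2].
  by apply: ssmooth_expR => //; apply: ssmoothN => //; apply: ssmooth_sub sk => q [].
have secs : [/\ section (U3 `&` U4) f0 (fun r => expR (- h r) *: a r),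
    section (U3 `&` U4) fh0 (fun r => expR (- h r) *: a r),
    section (U3 `&` U4) f0 (fun r => expR (- k r) *: b r)
    & section (U3 `&` U4) fh1 (fun r => expR (- k r) *: b r)].
  split; (split; first by []); move=> q [/U3U1 U1q /U4U2 U2q]; apply: memvZ.
  - exact: (a0 q U1q).1.
  - exact: (a0 q U1q).2.
  - exact: (b0 q U2q).1.
  - exact: (b0 q U2q).2.
exists (U3 `&` U4), (fun r => expR (- h r) *: a r), (fun r => expR (- k r) *: b r); split=> //.
  move=> q [/U3U1 U1q /U4U2 U2q]; rewrite !scaler_eq0 !negb_or !gt_eqF ?expR_gt0//=.
  by rewrite an0// bn0.
move=> c v q y ac Uq cq /memv_addP[y0 y00 [y1 y11 ->]].
have [U3q U4q] := Uq; have [_ sec2 _ sec4] := secs.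
split; rewrite ipDr.
  rewrite (legendre_pt v Lh0 oU sec2 ac Uq cq y00) add0r.
  by apply: Hh => //; rewrite (subvP (addvSr _ _)).
rewrite (legendre_pt v Lh1 oU sec4 ac Uq cq y11) addr0.
by apply: Hk => //; rewrite (subvP (addvSr _ _)).
Qed.

Lemma exists_adapted p : exists U e, adapted U e /\ U p.
Proof.
have [U1 [s [t [oU1 U1p [sf0 sfh0 tf0 tfh1] st0 Dst]]]] := parallel_spheres p.
have [ss _] := sf0; have [st _] := tf0.
have tfh0 : t p \notin fh0 p.
  by apply: (notin_fh p (st0 p U1p).2).2; exact: tfh1.2.
have sfh1 : s p \notin fh1 p.
  by apply: (notin_fh p (st0 p U1p).1).1; exact: sfh0.2.
have [U2 [x [oU2 U2U1 U2p [sx xfh0] tx]]] : exists U' (x : M -> E), [/\ open U', U' `<=` U1, U' p,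
    section U' fh0 x & forall q, U' q -> ip (t q) (x q) = 1].
  apply: (pick_dual _ nh0 oU1 U1p st) => //; first by case: Lh0.
  by apply: (n0 (q := p)); exact: tf0.2.
have [U3 [y [oU3 U3U2 U3p [sy yfh1] sy1]]] : exists U' (y : M -> E), [/\ open U', U' `<=` U2, U' p,
    section U' fh1 y & forall q, U' q -> ip (s q) (y q) = 1].
  apply: (pick_dual _ nh1 oU2 U2p (smooth_on_sub U2U1 ss)) => //; first by case: Lh1.
  by apply: (n0 (q := p)); exact: sf0.2.
have [c ac cp] := atlas_cover p.
have [U [r [[oU UU3 Uc Up r0] E0]]] := chart_ball_nbhs oU3 U3p cp.
have UU2 : U `<=` U2 by move=> q /UU3/U3U2.
have UU1 : U `<=` U1 by move=> q /UU2/U2U1.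
move: Dst => Dst1.
have Ds v c' q z : atlas c' -> U q -> chart_dom c' q -> z \in (fh0 q + fh1 q)%VS ->
    ip (chart_deriv c' v s q) z = 0.
  by move=> ac' Uq c'q zV; have [] := Dst1 c' v q z ac' (UU1 q Uq) c'q zV.
have Dt v c' q z : atlas c' -> U q -> chart_dom c' q -> z \in (fh0 q + fh1 q)%VS ->
    ip (chart_deriv c' v t q) z = 0.
  by move=> ac' Uq c'q zV; have [] := Dst1 c' v q z ac' (UU1 q Uq) c'q zV.
have {}ss : smooth_on U s by exact: smooth_on_sub ss.
have {}st : smooth_on U t by exact: smooth_on_sub st.
have {}sx : smooth_on U x by exact: smooth_on_sub sx.
have {}sy : smooth_on U y by exact: smooth_on_sub sy.
(* Subtracting this multiple of t gives (x, z) = 0, since (t, x) = 1, and keeps (s, z) = 1, since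
   (s, t) = 0. *)
have [z zE] : exists z : M -> E, forall q, z q = y q - ip (x q) (y q) *: t q.
  by exists (fun q => y q - ip (x q) (y q) *: t q).
have sz : smooth_on U z.
  apply: (@smooth_on_ext _ _ _ _ _ (fun q => y q - ip (x q) (y q) *: t q)) => //.
  apply: smooth_onD => //; apply: smooth_onN => //; apply: smooth_onZ => //.
  exact: ssmooth_ip.
have xU q : U q -> x q \in fh0 q by move=> /UU2; exact: xfh0.
have sU q : U q -> s q \in fh0 q by move=> /UU1; exact: sfh0.2.
have tU q : U q -> t q \in fh1 q by move=> /UU1; exact: tfh1.2.
have s0U q : U q -> s q \in f0 q by move=> /UU1; exact: sf0.2.
have t0U q : U q -> t q \in f0 q by move=> /UU1; exact: tf0.2.
have zU q : U q -> z q \in fh1 q.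
  by move=> Uq; rewrite zE memvB ?memvZ ?tU// yfh1//; exact: UU3.
have gst q : U q -> ip (s q) (t q) = 0 by move=> Uq; apply: (n0 (q := q)); [exact: s0U|exact: t0U].
have gss q : U q -> ip (s q) (s q) = 0 by move=> Uq; apply: (n0 (q := q)); exact: s0U.
have gtt q : U q -> ip (t q) (t q) = 0 by move=> Uq; apply: (n0 (q := q)); exact: t0U.
have gsx q : U q -> ip (s q) (x q) = 0 by move=> Uq; apply: (nh0 (q := q)); [exact: sU|exact: xU].
have gxx q : U q -> ip (x q) (x q) = 0 by move=> Uq; apply: (nh0 (q := q)); exact: xU.
have gtz q : U q -> ip (t q) (z q) = 0 by move=> Uq; apply: (nh1 (q := q)); [exact: tU|exact: zU].
have gzz q : U q -> ip (z q) (z q) = 0 by move=> Uq; apply: (nh1 (q := q)); exact: zU.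
have gtx q : U q -> ip (t q) (x q) = 1 by move=> Uq; apply: tx; exact: UU2.
have gsz q : U q -> ip (s q) (z q) = 1.
  by move=> Uq; rewrite zE !ipE gst// mulr0 subr0 sy1//; exact: UU3.
have gxz q : U q -> ip (x q) (z q) = 0.
  by move=> Uq; rewrite zE !ipE (ipC (x q) (t q)) gtx// mulr1 subrr.
have V0 q u : u \in fh0 q -> u \in (fh0 q + fh1 q)%VS by move=> H; rewrite (subvP (addvSl _ _)).
have V1 q u : u \in fh1 q -> u \in (fh0 q + fh1 q)%VS by move=> H; rewrite (subvP (addvSr _ _)).
have secx : section U fh0 x by [].
have secz : section U fh1 z by [].
(* The remaining component of the connection is the form (dx, z). *)
pose b v q := ip (chart_deriv c v x q) (z q).
(* Against fh0 this is the Legendre condition. In fh1, spanned by t and z, the pairing with z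
   vanishes by the choice of b, that with t by differentiating (t, x) = 1, t being parallel. *)
have perpx c' v q u : atlas c' -> U q -> chart_dom c' q -> u \in (fh0 q + fh1 q)%VS ->
    ip (chart_deriv c' v x q - ip (chart_deriv c' v x q) (z q) *: s q) u = 0.
  move=> ac' Uq c'q /memv_addP[u0 u00 [u1 u11 ->]].
  rewrite (dual_span (dh1 q) (tU q Uq) (zU q Uq) (a' := x q) (b' := s q) _ _ _ _ u11);
    rewrite ?(ipC (z q)) ?gtx ?gxz ?gsz ?(ipC (t q)) ?gst//.
  rewrite !ipE (legendre_pt v Lh0 oU secx ac' Uq c'q u00) (nh0 (sU q Uq) u00).
  have H := sderiv_ip v ac' oU Uq c'q sx st.
  rewrite (sderiv_ext v oU Uq c'q (g := fun=> 1)) ?sderiv_cst in H; last first.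
    by move=> q' Uq'; rewrite ipC gtx.
  move: H; rewrite (ipC (x q)) Dt// ?addr0 => [<-|]; last exact/V0/xU.
  rewrite gst// gsz//; move: (ip (chart_deriv c' v x q) (z q)) (ip u1 (x q)) (ip u1 (s q)) => *; ring.
(* The same form appears with the opposite sign, from differentiating (x, z) = 0. *)
have perpz c' v q u : atlas c' -> U q -> chart_dom c' q -> u \in (fh0 q + fh1 q)%VS ->
    ip (chart_deriv c' v z q + ip (chart_deriv c' v x q) (z q) *: t q) u = 0.
  move=> ac' Uq c'q /memv_addP[u0 u00 [u1 u11 ->]].
  rewrite (dual_span (dh0 q) (sU q Uq) (xU q Uq) (a' := z q) (b' := t q) _ _ _ _ u00);
    rewrite ?(ipC (x q) (t q)) ?gtx ?gxz ?gsz ?gst//.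
  rewrite !ipE (legendre_pt v Lh1 oU secz ac' Uq c'q u11) (nh1 (tU q Uq) u11).
  have H := sderiv_ip v ac' oU Uq c'q sz ss.
  rewrite (sderiv_ext v oU Uq c'q (g := fun=> 1)) ?sderiv_cst in H; last first.
    by move=> q' Uq'; rewrite ipC gsz.
  have H' := sderiv_ip v ac' oU Uq c'q sz sx.
  rewrite (sderiv_ext v oU Uq c'q (g := fun=> 0)) ?sderiv_cst in H'; last first.
    by move=> q' Uq'; rewrite ipC gxz.
  move: H; rewrite (ipC (z q)) Ds// ?addr0 => [<-|]; last exact/V1/zU.
  have {H'} -> : ip (chart_deriv c' v z q) (x q) = - ip (chart_deriv c' v x q) (z q).
    by apply/eqP; rewrite -addr_eq0 [X in _ + X](ipC _ (z q)) -H'.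
  rewrite (ipC (t q) (s q)) gst// gtx//.
  move: (ip (chart_deriv c' v x q) (z q)) (ip u0 (z q)) (ip u0 (t q)) => *; ring.
have sb v : ssmooth U (b v) by apply: ssmooth_ip => //; exact: chart_deriv_smooth.
have secV a : smooth_on U a -> (forall q, U q -> a q \in fh0 q) -> section U (sum_bundle fh0 fh1) a.
  by move=> sa aU; split=> // q Uq; apply: V0; exact: aU.
have secxV := secV x sx xU.
have smu v : section U (sum_bundle fh0 fh1) (fun q => b v q *: s q).
  apply: secV; first exact: smooth_onZ.
  by move=> q Uq; apply: memvZ; exact: sU.
have cov v : covariant_deriv (sum_bundle fh0 fh1) c v U x (fun q => b v q *: s q).
  move=> q Uq; split; first exact: (smu v).2.
  by move=> u uW; apply: perpx => //; exact: Uc.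
have cov2 v w : covariant_deriv (sum_bundle fh0 fh1) c v U (fun q => b w q *: s q)
    (fun q => sderiv c v (b w) q *: s q).
  move=> q Uq; split; first by apply: V0; apply: memvZ; exact: sU.
  move=> u uW; rewrite (chart_derivZ v ac oU Uq (Uc q Uq) (sb w) ss).
  by rewrite addrAC subrr add0r ipZl Ds ?mulr0//; exact: Uc.
(* The curvature applied to x is db times s, and s does not vanish. *)
have closed_b v w q : U q -> sderiv c w (b v) q = sderiv c v (b w) q.
  move=> Uq.
  move: (flatV ac oU Uc secxV (smu w) (smu v) (cov w) (cov v) (cov2 w v) (cov2 v w) Uq).
  have sn0 := (st0 q (UU1 q Uq)).1.
  rewrite -scalerBl memv0 scaler_eq0 (negPf sn0) orbF subr_eq0.
  by move/eqP.
have lin_b v q : U q -> b v q = \sum_i v 0 i * b (delta_mx 0 i) q.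
  move=> Uq; rewrite /b (chart_deriv_linear v ac Uq (Uc q Uq) sx) ip_suml.
  by apply: eq_bigr => i _; rewrite ipZl.
have [U4 [g [oU4 U4U U4p sg Dg]]] := manifold_poincare ac oU Uc Up sb lin_b closed_b.
have [U5 [r' [[oU5 U5U4 U5c U5p r'0] E5]]] := chart_ball_nbhs oU4 U4p cp.
have U5U : U5 `<=` U by move=> q /U5U4/U4U.
have ss5 := smooth_on_sub U5U ss; have st5 := smooth_on_sub U5U st.
have sx5 := smooth_on_sub U5U sx; have sz5 := smooth_on_sub U5U sz.
have sg5 : ssmooth U5 g by exact: ssmooth_sub sg.
have sgN : ssmooth U5 (fun q => - g q) by exact: ssmoothN.
(* With dg = b both corrected vectors are parallel; the opposite signs keep them orthogonal to each
   other. *)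
exists U5, (fun q => mk4 (s q) (t q) (x q + (- g q) *: s q) (z q + g q *: t q)).
split=> //; split=> //; first by exists c, (chart_map c p), r'.
have smf : forall i, smooth_on U5 (fun q => mk4 (s q) (t q) (x q + (- g q) *: s q) (z q + g q *: t q) i).
  apply: forall_ord4 => //=.
    by apply: smooth_onD => //; exact: smooth_onZ.
  by apply: smooth_onD => //; exact: smooth_onZ.
split.
- exact: smf.
- { move=> q /U5U Uq; apply: wittP; rewrite /mk4 /= ?ipE ?gss ?gst ?gsx ?gsz ?gtt ?gtx ?gtz ?gxx ?gxz ?gzz//.
  all: rewrite ?(ipC (x q) (t q)) ?(ipC (t q) (s q)) ?(ipC (x q) (s q)) ?(ipC (z q)) ?gss ?gst ?gsx ?gsz ?gtt ?gtx ?gtz ?gxx ?gxz ?gzz//.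
  all: ring. }
- by move=> q /U5U Uq; split; [exact: s0U|exact: t0U].
- move=> q /U5U Uq; split; first exact: sU.
  by rewrite /mk4 /= memvD ?memvZ ?sU// xU.
- move=> q /U5U Uq; split; first exact: tU.
  by rewrite /mk4 /= memvD ?memvZ ?tU// zU.
- move=> i j c' v q ac' U5q c'q.
  have Uq := U5U q U5q.
  have eV : mk4 (s q) (t q) (x q + (- g q) *: s q) (z q + g q *: t q) j \in (fh0 q + fh1 q)%VS.
    apply: (forall_ord4 (P := fun j => mk4 _ _ _ _ j \in _)) j; rewrite /mk4 /=.
    - exact/V0/sU.
    - exact/V1/tU.
    - by apply: V0; rewrite memvD ?memvZ ?sU// xU.
    - by apply: V1; rewrite memvD ?memvZ ?tU// zU.
  have cq := U5c q U5q.
  rewrite (chart_deriv_change v ac' oU5 U5q c'q ac cq (smf i)).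
  move: ('D_v _ _) => v' {c' ac' c'q v}.
  move: eV; move: (mk4 _ _ _ _ j) => u uV.
  apply: (forall_ord4 (P := fun i => ip (chart_deriv c v' (fun r => mk4 (s r) (t r) (x r + (- g r) *: s r) (z r + g r *: t r) i) q) u = 0)) i; rewrite /mk4 /=.
  + exact: Ds.
  + exact: Dt.
  + rewrite (chart_derivD v' ac oU5 U5q cq sx5 (smooth_onZ oU5 sgN ss5)).
    rewrite (chart_derivZ v' ac oU5 U5q cq sgN ss5) (sderivN v' ac U5q cq sg5) (Dg q v' (U5U4 q U5q)).
    by rewrite addrA ipDl scaleNr perpx// ipZl Ds// mulr0 addr0.
  + rewrite (chart_derivD v' ac oU5 U5q cq sz5 (smooth_onZ oU5 sg5 st5)).
    rewrite (chart_derivZ v' ac oU5 U5q cq sg5 st5) (Dg q v' (U5U4 q U5q)).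
    by rewrite addrA ipDl perpz// ipZl Dt// mulr0 addr0.
Qed.

End AdaptedFrames.

Lemma rev4_eq (i j : 'I_4) : (i + j == 3)%N = (j == rev_ord i).
Proof.
rewrite -val_eqE /=; apply/eqP/eqP; have := ltn_ord i; have := ltn_ord j; lia.
Qed.

(** * Uniqueness and continuation of adapted frames *)

Section GlobalFrame.
Variables (R : realType) (m : nat) (M : manifold R m).
Local Notation E := 'rV[R]_(m + 4).
Variables (f0 fh0 fh1 : M -> {vspace E}).
Implicit Types (c : chart R m M) (U : set M) (p q : M) (v w : 'rV[R]_m) (e : M -> 'I_4 -> E).
Hypothesis L0 : legendre f0.
Hypothesis Lh0 : legendre fh0.
Hypothesis Lh1 : legendre fh1.

Let n0 q : totally_null (f0 q). Proof. by case: L0. Qed.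
Let nh0 q : totally_null (fh0 q). Proof. by case: Lh0. Qed.
Let nh1 q : totally_null (fh1 q). Proof. by case: Lh1. Qed.
Let d0 q : \dim (f0 q) = 2%N. Proof. by case: L0 => -[]. Qed.
Let dh0 q : \dim (fh0 q) = 2%N. Proof. by case: Lh0 => -[]. Qed.
Let dh1 q : \dim (fh1 q) = 2%N. Proof. by case: Lh1 => -[]. Qed.

Local Notation pframe := (parallel_frame f0 fh0 fh1).

Lemma witt_rev (a : 'I_4 -> E) i j : witt a -> ip (a i) (a (rev_ord j)) = (i == j)%:R.
Proof. by move=> Wa; rewrite Wa rev4_eq (inj_eq rev_ord_inj) eq_sym. Qed.

Lemma frame_expand U e q x : pframe U e -> U q -> x \in (fh0 q + fh1 q)%VS ->
  x = \sum_i ip x (e q (rev_ord i)) *: e q i.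
Proof.
move=> fe Uq; have W := wittE (pf_witt fe Uq).
have [a0 a2] := pf_fh0 fe Uq; have [a1 a3] := pf_fh1 fe Uq.
have r0 : rev_ord o0 = o3 by exact: val_inj.
have r1 : rev_ord o1 = o2 by exact: val_inj.
have r2 : rev_ord o2 = o1 by exact: val_inj.
have r3 : rev_ord o3 = o0 by exact: val_inj.
move=> /memv_addP[y y0 [z z1 ->]]; rewrite sum_ord4 r0 r1 r2 r3 !ipDl.
rewrite (nh0 y0 a2) (nh0 y0 a0) (nh1 z1 a3) (nh1 z1 a1) !add0r !addr0.
rewrite {1}(dual_span (dh0 q) a0 a2 (a' := e q o3) (b' := e q o1) _ _ _ _ y0) ?W//.
rewrite {1}(dual_span (dh1 q) a1 a3 (a' := e q o2) (b' := e q o0) _ _ _ _ z1) ?W//.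
by rewrite addrACA addrA.
Qed.

Lemma frame_sub U e q i : pframe U e -> U q -> e q i \in (fh0 q + fh1 q)%VS.
Proof.
move=> fe Uq; have [a0 a2] := pf_fh0 fe Uq; have [a1 a3] := pf_fh1 fe Uq.
apply: (forall_ord4 (P := fun i => e q i \in (fh0 q + fh1 q)%VS)) i.
- by rewrite (subvP (addvSl _ _)).
- by rewrite (subvP (addvSr _ _)).
- by rewrite (subvP (addvSl _ _)).
- by rewrite (subvP (addvSr _ _)).
Qed.

Lemma frame_perp U e c v q i x : pframe U e -> atlas c -> U q -> chart_dom c q ->
  x \in (fh0 q + fh1 q)%VS -> ip (chart_deriv c v (fun r => e r i) q) x = 0.
Proof.
move=> fe ac Uq cq xV; rewrite (frame_expand fe Uq xV) ip_sumr big1// => j _.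
by rewrite ipZr (pf_parallel fe)// mulr0.
Qed.

(** All vectors of either frame lie in V, to which the derivatives of both frames are orthogonal; so
    the pairing has zero derivative on a chart ball. *)
Lemma transition_constant U U' e e' V c x r i j : pframe U e -> pframe U' e' ->
  V `<=` U -> V `<=` U' -> open V -> atlas c -> V `<=` chart_dom c ->
  chart_image c V = ball x r -> forall p q, V p -> V q ->
  ip (e' p i) (e p j) = ip (e' q i) (e q j).
Proof.
move=> fe fe' VU VU' oV ac Vc EV.
have se k : smooth_on V (fun q => e q k) by apply: smooth_on_sub (pf_smooth fe k).
have se' k : smooth_on V (fun q => e' q k) by apply: smooth_on_sub (pf_smooth fe' k).
apply: (sderiv0_constant ac Vc EV (ssmooth_ip oV (se' i) (se j))) => q v Vq.
have cq := Vc q Vq; have Uq := VU q Vq; have U'q := VU' q Vq.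
rewrite (sderiv_ip v ac oV Vq cq (se' i) (se j)).
rewrite (frame_perp v i fe' ac U'q cq (frame_sub j fe Uq)).
by rewrite ipC (frame_perp v j fe ac Uq cq (frame_sub i fe' U'q)) addr0.
Qed.

Lemma adapted_unique U e e' q : adapted f0 fh0 fh1 U e -> adapted f0 fh0 fh1 U e' -> U q ->
  e q = e' q -> forall x, U x -> e x = e' x.
Proof.
move=> [oU [c [y [r [ac Uc EU]]]] fe] [_ _ fe'] Uq eq_ x Ux; apply/funext => i.
rewrite [RHS](frame_expand fe Ux (frame_sub i fe' Ux)).
rewrite (bigD1 i)//= big1 => [|j ji].
  rewrite (transition_constant i (rev_ord i) fe fe' _ _ oU ac Uc EU Ux Uq)//.
  by rewrite -eq_ witt_rev ?eqxx ?scale1r ?addr0//; exact: pf_witt fe _ Uq.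
rewrite (transition_constant i (rev_ord j) fe fe' _ _ oU ac Uc EU Ux Uq)//.
rewrite -eq_ witt_rev; last exact: pf_witt fe _ Uq.
by rewrite eq_sym (negPf ji) scale0r.
Qed.

(** Combine the vectors of e with the transition coefficients at q, taken as constants. The result
    is parallel on all of U, and agrees with e' near q because the transition is constant there. *)
Lemma adapted_extend U U' e e' q : adapted f0 fh0 fh1 U e -> adapted f0 fh0 fh1 U' e' ->
  U q -> U' q -> exists e'', adapted f0 fh0 fh1 U e'' /\ \forall x \near q, e'' x = e' x.
Proof.
move=> [oU bU fe] [oU' _ fe'] Uq U'q.
pose C i j := ip (e' q i) (e q (rev_ord j)).
pose e'' x i := \sum_j C i j *: e x j.
have e''E i : e' q i = e'' q i by exact: (frame_expand fe Uq (frame_sub i fe' U'q)).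
have ipe'' x i k : U x -> ip (e'' x i) (e'' x k) = \sum_j \sum_l C i j * (C k l * (j + l == 3)%N%:R).
  move=> Ux; rewrite ip_suml; apply: eq_bigr => j _; rewrite ip_sumr; apply: eq_bigr => l _.
  by rewrite ipZl ipZr (pf_witt fe Ux).
have W x : U x -> witt (e'' x).
  by move=> Ux i k; rewrite ipe''// -(ipe'' q)// -!e''E; exact: pf_witt fe' _ U'q _ _.
have ipe x i k : U x -> ip (e'' x i) (e x k) = ip (e' q i) (e q k).
  have H y : U y -> ip (e'' y i) (e y k) = \sum_j C i j * (j + k == 3)%N%:R.
    by move=> Uy; rewrite ip_suml; apply: eq_bigr => j _; rewrite ipZl (pf_witt fe Uy).
  by move=> Ux; rewrite e''E !H.
(* The vector [e'' x i] is null since i + i is never 3, and orthogonal to F x: its pairings with the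
   basis [e x k], [e x l] are the same as at q, where they vanish. Maximality of F x then
   applies. *)
have mem (F : M -> {vspace E}) i k l : (forall y, totally_null (F y)) -> (forall y, \dim (F y) = 2%N) ->
    k != l -> (forall y, U y -> e y k \in F y /\ e y l \in F y) -> e' q i \in F q ->
    forall x, U x -> e'' x i \in F x.
  move=> nF dF kl eF e'F x Ux; have [ek el] := eF x Ux; have [ekq elq] := eF q Uq.
  have Wx := pf_witt fe Ux.
  apply: totally_null_maximal => //.
    by rewrite W// rev4_eq; apply/eqP; rewrite pnatr_eq0 eqb0 -val_eqE /=; have := ltn_ord i; lia.
  move=> w wF; rewrite (dual_span (dF x) ek el (a' := e x (rev_ord k)) (b' := e x (rev_ord l)) _ _ _ _ wF);
    rewrite ?witt_rev ?eqxx// ?(negPf kl)// 1?eq_sym ?(negPf kl)//.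
  by rewrite ipDr !ipZr !ipe// (nF q _ _ e'F ekq) (nF q _ _ e'F elq) !mulr0 addr0.
exists e''; split.
  split=> //; split=> //.
  - by move=> i; apply: smooth_on_sum => // j; apply: smooth_onZc => //; exact: pf_smooth fe j.
  - move=> x Ux; have [H0 H1] := pf_f0 fe' U'q.
    by split; apply: (mem f0 _ o0 o1 (@n0) d0 isT (pf_f0 fe)).
  - move=> x Ux; have [H0 H1] := pf_fh0 fe' U'q.
    by split; apply: (mem fh0 _ o0 o2 (@nh0) dh0 isT (pf_fh0 fe)).
  - move=> x Ux; have [H0 H1] := pf_fh1 fe' U'q.
    by split; apply: (mem fh1 _ o1 o3 (@nh1) dh1 isT (pf_fh1 fe)).
  - move=> i j c v x ac Ux cx.
    rewrite (@chart_deriv_sum _ _ _ c U x v ac oU Ux cx _ _ (fun k r => C i k *: e r k)); last first.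
      by move=> k; apply: smooth_onZc => //; exact: pf_smooth fe k.
    rewrite ip_suml big1// => k _.
    rewrite (chart_derivZc v ac oU Ux cx (C i k) (pf_smooth fe k)) ipZl.
    rewrite (frame_perp v k fe ac Ux cx) ?mulr0//.
    by apply: memv_suml => l _; apply: memvZ; exact: frame_sub fe Ux.
have [c ac cq] := atlas_cover q.
have oUU : open (U `&` U') by exact: openI.
have [V [r [[oV VU Vc Vq r0] EV]]] := chart_ball_nbhs oUU (conj Uq U'q) cq.
have : nbhs q V by exact: open_nbhs_nbhs.
apply: filterS => x Vx; apply/funext => i; have [Ux U'x] := VU x Vx.
rewrite [RHS](frame_expand fe Ux (frame_sub i fe' U'x)); apply: eq_bigr => j _.
congr (_ *: _); rewrite /C.
by apply: (transition_constant i (rev_ord j) fe fe' _ _ oV ac Vc EV Vq Vx) => y /VU[].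
Qed.

Lemma parallel_frame_local e :
  (forall q, exists U e', [/\ adapted f0 fh0 fh1 U e', U q & \forall r \near q, e r = e' r]) ->
  pframe setT e.
Proof.
move=> H.
have loc q : exists U, [/\ open U, U q & pframe U e].
  have [U [e' [[oU _ fe'] Uq ee']]] := H q.
  pose U' := (U `&` [set r | e r = e' r])^°.
  have U'U : U' `<=` U by move=> r /interior_subset[].
  have U'e r : U' r -> e r = e' r by move=> /interior_subset[].
  have oU' : open U' by exact: open_interior.
  have U'q : U' q by apply: filterI => //; exact: open_nbhs_nbhs.
  exists U'; split=> //; split.
  - move=> i; apply: (@smooth_on_ext _ _ _ _ _ (fun r => e' r i)) => //.
      by move=> r U'r; rewrite U'e.
    by apply: smooth_on_sub (pf_smooth fe' i).
  - by move=> r U'r; rewrite U'e//; apply: (pf_witt fe'); exact: U'U.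
  - by move=> r U'r; rewrite U'e//; apply: (pf_f0 fe'); exact: U'U.
  - by move=> r U'r; rewrite U'e//; apply: (pf_fh0 fe'); exact: U'U.
  - by move=> r U'r; rewrite U'e//; apply: (pf_fh1 fe'); exact: U'U.
  - move=> i j c v r ac U'r cr; rewrite U'e//.
    rewrite (@chart_deriv_ext _ _ _ c v _ U' _ (fun s => e' s i) r oU' U'r cr); last first.
      by move=> s U's; rewrite U'e.
    by apply: (pf_parallel fe') => //; exact: U'U.
split.
- move=> i; apply: smooth_on_local; first exact: openT.
  by move=> q _; have [U [oU Uq fe]] := loc q; exists U; split=> //; exact: pf_smooth fe i.
- by move=> q _; have [U [oU Uq fe]] := loc q; exact: (pf_witt fe).
- by move=> q _; have [U [oU Uq fe]] := loc q; exact: (pf_f0 fe).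
- by move=> q _; have [U [oU Uq fe]] := loc q; exact: (pf_fh0 fe).
- by move=> q _; have [U [oU Uq fe]] := loc q; exact: (pf_fh1 fe).
- by move=> i j c v q ac _ cq; have [U [oU Uq fe]] := loc q; exact: (pf_parallel fe).
Qed.

End GlobalFrame.

Lemma global_frame (R : realType) (m : nat) (M : manifold R m)
    (f0 fh0 fh1 : M -> {vspace 'rV[R]_(m + 4)}) :
  simply_connected M -> ribaucour_pair f0 fh0 -> ribaucour_pair f0 fh1 ->
  pointwise_distinct (cap_bundle f0 fh0) (cap_bundle f0 fh1) ->
  flat_bundle (sum_bundle fh0 fh1) ->
  exists e, parallel_frame f0 fh0 fh1 setT e.
Proof.
move=> [M0 pc nullh] rib0 rib1 dist flatV.
have [L0 Lh0 _ _ _] := rib0; have [_ Lh1 _ _ _] := rib1.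
have [e He] := @global_section R M _ (adapted f0 fh0 fh1)
  (fun U e a => let: And3 oU _ _ := a in oU) (exists_adapted rib0 rib1 dist flatV)
  (adapted_extend L0 Lh0 Lh1) (adapted_unique Lh0 Lh1) pc nullh
  (@manifold_locally_path_connected R m M) M0.
by exists e; exact: parallel_frame_local He.
Qed.

(** * The two families *)

Lemma tuple1E (T : Type) (F : 'I_1 -> T) : [tuple F i | i < 1] = [:: F 0] :> seq T.
Proof. by rewrite /= enum_ordSl enum_ord0 /=; congr [:: F _]; exact: val_inj. Qed.

Lemma tuple2E (T : Type) (F : 'I_2 -> T) : [tuple F i | i < 2] = [:: F 0; F 1] :> seq T.
Proof.
by rewrite /= !enum_ordSl enum_ord0 /=; congr [:: F _; F _]; exact: val_inj.
Qed.

Section Families.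
Variables (R : realType) (m : nat) (M : manifold R m).
Local Notation E := 'rV[R]_(m + 4).
Implicit Types (c : chart R m M) (U : set M) (p q : M) (v : 'rV[R]_m) (u w : 'rV[R]_2).
Local Notation b0 := (delta_mx 0 0 : 'rV[R]_2)%R.
Local Notation b1 := (delta_mx 0 1 : 'rV[R]_2)%R.

(** A global parallel frame stripped of its position relative to the three given planes, and
    therefore stable under [swap12]. *)
Definition parallel_witt (e : M -> 'I_4 -> E) : Prop :=
  [/\ forall i, smooth_on setT (fun q => e q i), forall q, witt (e q)
    & forall i j c v q, atlas c -> chart_dom c q ->
        ip (chart_deriv c v (fun r => e r i) q) (e q j) = 0].

Lemma parallel_witt_swap12 e : parallel_witt e -> parallel_witt (fun q => swap12 (e q)).
Proof.
move=> [se we pe].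
have H i : exists j, (fun q => swap12 (e q) i) = (fun q => e q j).
  by rewrite /swap12; case: eqP => _; [exists o2|case: eqP => _; [exists o1|exists i]].
split.
- by move=> i; have [j ->] := H i; exact: se.
- by move=> q; exact: witt_swap12.
- move=> i k c v q ac cq; have [j ->] := H i; have [l] := H k.
  by move=> /(congr1 (@^~ q)) ->; exact: pe.
Qed.

Section Frame.
Variable e : M -> 'I_4 -> E.
Hypothesis pwe : parallel_witt e.
Let we q : witt (e q). Proof. by case: pwe. Qed.

Definition tens_coef u w : 'I_4 -> R := fun i => match val i with
  | 0%N => u 0 0 * w 0 0 | 1%N => u 0 0 * w 0 1 | 2%N => u 0 1 * w 0 0 | _ => - (u 0 1 * w 0 1) end.

Lemma tens_sum (a : 'I_4 -> E) u w : tens a u w = \sum_i tens_coef u w i *: a i.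
Proof. by rewrite sum_ord4 /tens /tens_coef /= scaleNr. Qed.

Lemma tens_smooth u w : smooth_on setT (fun q => tens (e q) u w).
Proof.
have [se _ _] := pwe.
apply: (@smooth_on_ext _ _ _ _ _ (fun q => \sum_i tens_coef u w i *: e q i)).
- exact: openT.
- by move=> q _; rewrite tens_sum.
by apply: smooth_on_sum => [|i]; [exact: openT|apply: smooth_onZc => //; exact: openT].
Qed.

Lemma tens_parallel c v q u w u' w' : atlas c -> chart_dom c q ->
  ip (chart_deriv c v (fun r => tens (e r) u w) q) (tens (e q) u' w') = 0.
Proof.
move=> ac cq; have [se _ pe] := pwe.
rewrite (@chart_deriv_ext _ _ _ c v _ setT _ (fun r => \sum_i tens_coef u w i *: e r i) q openT I cq);
  last by move=> r _; rewrite tens_sum.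
rewrite (@chart_deriv_sum _ _ _ c setT q v ac openT I cq _ _ (fun k r => tens_coef u w k *: e r k)); last first.
  by move=> k; apply: smooth_onZc => //; exact: openT.
rewrite tens_sum ip_suml big1// => i _.
rewrite (chart_derivZc v ac openT I cq _ (se i)) ipZl ip_sumr big1 ?mulr0// => j _.
by rewrite ipZr pe// mulr0.
Qed.

Lemma ruling_legendre u : u != 0 -> legendre (fun q => ruling (e q) u).
Proof.
move=> un0; split.
- split=> [q|p]; first by rewrite dim_ruling.
  exists setT; split; [exact: openT|by []|].
  exists (fun i q => tens (e q) u (delta_mx 0 i)); split=> [i|q _]; first exact: tens_smooth.
  by rewrite basisEdim tuple2E subvv dim_ruling.
- by move=> q; exact: ruling_null.
- move=> U s0 s1 oU [ss0 s0W] [_ s1W] c ac v p Up cp.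
  have /rulingP[w ->] := s1W p Up.
  have st : smooth_on U (fun q => tens (e q) u w) by apply: smooth_on_sub (tens_smooth u w).
  (* The value of [s1] at p is extended by the parallel section u (x) w with the same constants. Its
     pairing with [s0] vanishes identically, and in the Leibniz rule parallelism removes the term
     where u (x) w is differentiated. *)
  have := sderiv_ip v ac oU Up cp ss0 st.
  rewrite (sderiv_ext v oU Up cp (g := fun=> 0)) ?sderiv_cst; last first.
    by move=> q Uq; apply: (ruling_null (we q) (u := u)); [exact: s0W|exact: mem_ruling].
  have /rulingP[w' ->] := s0W p Up.
  by rewrite [X in _ + X]ipC tens_parallel// addr0.
Qed.

End Frame.

(** * Planes of opposite rulings form Ribaucour pairs *)

Section Pairs.
Variable e : M -> 'I_4 -> E.
Hypothesis pwe : parallel_witt e.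
Let we q : witt (e q). Proof. by case: pwe. Qed.
Variables u w : 'rV[R]_2.
Hypothesis un0 : u != 0.
Hypothesis wn0 : w != 0.
Let F q := ruling (e q) u.
Let G q := ruling (swap12 (e q)) w.

(* Against a parallel section t, covariant differentiation becomes ordinary differentiation. *)
Lemma covariant_deriv_ip U c v nu mu u' w' : atlas c -> open U -> U `<=` chart_dom c ->
  (forall q, tens (e q) u' w' \in (F q + G q)%VS) ->
  section U (sum_bundle F G) nu -> covariant_deriv (sum_bundle F G) c v U nu mu ->
  forall q, U q -> ip (mu q) (tens (e q) u' w') = sderiv c v (fun r => ip (nu r) (tens (e r) u' w')) q.
Proof.
move=> ac oU Uc tW [snu nuW] cov q Uq; have cq := Uc q Uq.
have st : smooth_on U (fun q => tens (e q) u' w') by apply: smooth_on_sub (tens_smooth pwe u' w').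
rewrite (sderiv_ip v ac oU Uq cq snu st).
have [_ /(_ _ (tW q))] := cov q Uq.
rewrite ipDl ipNl => /eqP; rewrite subr_eq0 => /eqP ->.
suff -> : ip (nu q) (chart_deriv c v (fun r => tens (e r) u' w') q) = 0 by rewrite addr0.
have /memv_addP[_ /rulingP[w1 ->] [_ /ruling_swap12P[u1 ->] ->]] := nuW q Uq.
by rewrite ipC ipDr !tens_parallel// addr0.
Qed.

(** The commutator pairs to zero with every u (x) w' and every u' (x) w, which span the sum of the
    two planes; [ruling_sum_radical] turns this into membership in their intersection. *)
Lemma ruling_pair_flat : flat_connection (sum_bundle F G) (cap_bundle F G).
Proof.
move=> c ac U oU Uc v z nu mv mz mvz mzv snu smv smz cv cz cvz czv p Up.
have key u' w' : (forall q, tens (e q) u' w' \in (F q + G q)%VS) ->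
    ip (mvz p - mzv p) (tens (e p) u' w') = 0.
  move=> tW; rewrite ipDl ipNl.
  rewrite (covariant_deriv_ip ac oU Uc tW smz cvz Up) (covariant_deriv_ip ac oU Uc tW smv czv Up).
  have cp := Uc p Up; have st : smooth_on U (fun q => tens (e q) u' w').
    by apply: smooth_on_sub (tens_smooth pwe u' w').
  rewrite (sderiv_ext v oU Up cp (covariant_deriv_ip ac oU Uc tW snu cz)).
  rewrite (sderiv_ext z oU Up cp (covariant_deriv_ip ac oU Uc tW snu cv)).
  by rewrite (sderiv_comm v z oU ac Uc (ssmooth_ip oU snu.1 st) Up) subrr.
apply: ruling_sum_radical => //.
- by apply: memvB; [exact: (cvz p Up).1|exact: (czv p Up).1].
- by move=> w'; apply: key => q; rewrite (subvP (addvSl _ _))// mem_ruling.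
- by move=> u'; apply: key => q; rewrite (subvP (addvSr _ _))// mem_ruling_swap12.
Qed.

Lemma ruling_pair : ribaucour_pair F G.
Proof.
have capE q : cap_bundle F G q = <[tens (e q) u w]>%VS by exact: ruling_cap.
have tn0 q : tens (e q) u w != 0.
  by apply: contra wn0 => /eqP/(tens_eq0 (we q) un0)/eqP.
split.
- exact: ruling_legendre.
- by apply: ruling_legendre => //; exact: parallel_witt_swap12.
- move=> q FG; have := capE q; rewrite /cap_bundle -FG capvv => FE.
  by have := dim_ruling (we q) un0; rewrite -/(F q) FE dim_vline; case: (_ != _).
- split; [split| |].
  + split=> [q|p]; first by rewrite capE dim_vline tn0.
    exists setT; split; [exact: openT|by []|].
    exists (fun _ q => tens (e q) u w); split=> [_|q _]; first exact: tens_smooth.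
    by rewrite basisEdim tuple1E span_seq1 capE subvv dim_vline tn0.
  + move=> q x y; rewrite /cap_bundle !memv_cap => /andP[xF _] /andP[yF _].
    exact: (ruling_null (we q) xF yF).
  + by move=> q; exact: capvSl.
  + by move=> q; exact: capvSr.
- exact: ruling_pair_flat.
Qed.

End Pairs.

(** An arbitrary generator; the plane of the ruling depends only on the line it spans. *)
Definition homogeneous (a : RP1 R) : 'rV[R]_2 := vpick (val a).

Lemma homogeneousE a : homogeneous a != 0 /\ val a = <[homogeneous a]>%VS.
Proof.
have da := eqP (valP a).
have n0 : homogeneous a != 0 by rewrite vpick0 -dimv_eq0 da.
split=> //; apply/esym/eqP; rewrite eqEdim -memvE memv_pick da dim_vline n0.
by [].
Qed.

Fact line_dim u : u != 0 -> \dim <[u]>%VS == 1%N.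
Proof. by move=> un0; rewrite dim_vline un0. Qed.
Definition point_of u (un0 : u != 0) : RP1 R := exist _ <[u]>%VS (line_dim un0).

Lemma homogeneous_point_of u (un0 : u != 0) : exists2 k, k != 0 & homogeneous (point_of un0) = k *: u.
Proof.
have [n0 _] := homogeneousE (point_of un0).
have /vlineP[k E1] : homogeneous (point_of un0) \in <[u]>%VS by exact: memv_pick.
by exists k => //; apply: contra n0; rewrite E1 => /eqP ->; rewrite scale0r.
Qed.

Lemma ruling_homogeneous_inj (a : 'I_4 -> E) x y : witt a ->
  ruling a (homogeneous x) = ruling a (homogeneous y) -> x = y.
Proof.
move=> wa; have [x0 Ex] := homogeneousE x; have [y0 Ey] := homogeneousE y.
move=> /(ruling_inj wa x0 y0)[k Exy]; apply: val_inj; rewrite Ex Ey Exy.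
apply/esym/eqP; rewrite eqEdim !dim_vline -Exy x0 y0 andbT.
by apply/subvP => _ /vlineP[l ->]; rewrite Exy !memvZ// memv_line.
Qed.

Lemma b0_neq0 : b0 != 0.
Proof. by apply/eqP => /rowP/(_ 0)/eqP; rewrite !mxE eqxx oner_eq0. Qed.

Lemma b1_neq0 : b1 != 0.
Proof. by apply/eqP => /rowP/(_ 1)/eqP; rewrite !mxE eqxx oner_eq0. Qed.

Lemma point_b01 : point_of b1_neq0 <> point_of b0_neq0.
Proof.
move=> /(congr1 val) /= H.
have : b1 \in <[b0]>%VS by rewrite -H memv_line.
by move=> /vlineP[k /rowP/(_ 1)/eqP]; rewrite !mxE eqxx /= mulr0 oner_eq0.
Qed.

End Families.

Theorem theorem3p4 (R : realType) (m : nat) (M : manifold R m)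
    (f0 fh0 fh1 : M -> {vspace 'rV[R]_(m + 4)}) :
  simply_connected M ->
  ribaucour_pair f0 fh0 ->
  ribaucour_pair f0 fh1 ->
  (f0, fh0) <> (f0, fh1) ->
  pointwise_distinct (cap_bundle f0 fh0) (cap_bundle f0 fh1) ->
  flat_bundle (sum_bundle fh0 fh1) ->
  exists f fh : RP1 R -> M -> {vspace 'rV[R]_(m + 4)},
    [/\ injective f /\ injective fh,
        (forall a, legendre (f a)) /\ (forall b, legendre (fh b)),
        (exists a0, f a0 = f0) /\
          (exists f1, [/\ legendre f1, pointwise_distinct f1 f0,
             ribaucour_pair f1 fh0, ribaucour_pair f1 fh1
             & exists a1, f a1 = f1]),
        (exists b0, fh b0 = fh0) /\ (exists b1, fh b1 = fh1)
      & forall a b, ribaucour_pair (f a) (fh b)].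
Proof.
move=> sc rib0 rib1 _ dist flatV.
have [e pf] := global_frame sc rib0 rib1 dist flatV.
(* Injectivity of the families is tested at one point, which simple connectedness provides. *)
have [[p0 _] _ _] := sc.
have pw : parallel_witt e.
  split=> [i|q|i j c v q ac cq]; first exact: (pf_smooth pf).
    exact: (pf_witt pf).
  exact: (pf_parallel pf).
have pws := parallel_witt_swap12 pw.
have [_ we _] := pw; have [_ wse _] := pws.
have [[[d0 _] _ _] [[dh0 _] _ _] _ _ _] := rib0; have [_ [[dh1 _] _ _] _ _ _] := rib1.
pose f (a : RP1 R) q := ruling (e q) (homogeneous a).
pose fh (b : RP1 R) q := ruling (swap12 (e q)) (homogeneous b).
have rib a b : ribaucour_pair (f a) (fh b).
  by apply: ruling_pair => //; [exact: (homogeneousE a).1|exact: (homogeneousE b).1].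
have [k0 k0n E0] := homogeneous_point_of (b0_neq0 R).
have [k1 k1n E1] := homogeneous_point_of (b1_neq0 R).
have fE : f (point_of (b0_neq0 R)) = f0.
  apply/funext => q; rewrite /f E0; have [H0 H1] := pf_f0 pf (q := q) I.
  exact: ruling_delta0.
have fhE0 : fh (point_of (b0_neq0 R)) = fh0.
  apply/funext => q; rewrite /fh E0; have [H0 H2] := pf_fh0 pf (q := q) I.
  exact: ruling_delta0.
have fhE1 : fh (point_of (b1_neq0 R)) = fh1.
  apply/funext => q; rewrite /fh E1; have [H1 H3] := pf_fh1 pf (q := q) I.
  exact: ruling_delta1.
exists f, fh; split=> //.
- split=> a b /(congr1 (@^~ p0)) /ruling_homogeneous_inj; apply=> //.
- by split=> a; [case: (rib a a)|case: (rib a a)].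
- split; first by exists (point_of (b0_neq0 R)).
  (* This f1 is the plane spanned by e2 and e3: it meets fh0 in the line of e2 and fh1 in the line
     of e3. *)
  exists (f (point_of (b1_neq0 R))); split.
  + by case: (rib (point_of (b1_neq0 R)) (point_of (b0_neq0 R))).
  + by rewrite -fE => q /(ruling_homogeneous_inj (we q)); exact: point_b01.
  + by rewrite -fhE0.
  + by rewrite -fhE1.
  + by exists (point_of (b1_neq0 R)).
- by split; [exists (point_of (b0_neq0 R))|exists (point_of (b1_neq0 R))].
Qed.
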